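(* Fix integers $0\le k<m$, $n,q,r\ge1$. Let $\tau_z\subset TI^m$, $z\in I^q$, be a smooth family of hyperplane fields and $\sigma_z:I^m\to J^r(\mathbb R^m,\mathbb R^n)$ a smooth family of sections such that $\sigma_z=0$ on an open neighborhood of $\partial I^m$, $\sigma_z^\perp=0$ on $I^m$ with respect to $\tau_z$, and $\sigma_z=0$ on all of $I^m$ for $z$ in an open neighborhood of $\partial I^q$. Then for every $\varepsilon>0$ there exist a family of isotopies $F^z_t:I^m\to I^m$ and a family of holonomic sections $\hat\sigma_z$ such that: $\mathrm{dist}_{C^0}(\hat\sigma_z,\sigma_z)<\varepsilon$ on an open neighborhood of $F^z_1(I^k)$; $\|\hat\sigma^\perp_z\|_{C^0}<\varepsilon$ on $I^m$ (with respect to $\tau_z$); $\mathrm{dist}_{C^0}(F^z_t,\mathrm{id})<\varepsilon$; $F^z_t=\mathrm{id}$ and $\hat\sigma_z=0$ on an open neighborhood of $\partial I^m$; and $F^z_t=\mathrm{id}$ and $\hat\sigma_z=0$ on all of $I^m$ for $z$ in an open neighborhood of $\partial I^q$.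
   Context: $I=[-1,1]$, $I^k=I^k\times\{0\}^{m-k}\subset I^m$. $J^r(\mathbb R^m,\mathbb R^n)\cong\mathbb R^m\times(\mathcal P_r)^n$ via Taylor polynomials, with linear structure from $\mathbb R^n$; $0$ is the jet of the zero map. For a hyperplane field $\tau$, the $\perp$-component of $\sigma(x)=j^r(h)(x)$ consists of the $(r-1)$-jet of $h$ at $x$ and the derivatives $\partial_\nu\partial_\alpha h(x)$ with $|\alpha|=r-1$, $\nu\in\tau_x$; its norm is the sup of $|\partial_\nu\partial_\alpha h(x)|$ over $|\alpha|<r$, unit $\nu\in\tau_x$, and of the $(r-1)$-jet entries. Holonomic means of the form $j^r(h)$. *)

(* Defs.v *)
From HB Require Import structures.
From mathcomp Require Import all_boot all_order all_algebra.
From mathcomp Require Import all_classical all_reals all_analysis.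
Set Implicit Arguments. Unset Strict Implicit. Unset Printing Implicit Defensive.
Import Order.TTheory GRing.Theory Num.Theory.
Import numFieldNormedType.Exports.
Local Open Scope classical_set_scope.
Local Open Scope ring_scope.

Section Defs.
Variable R : realType.

Definition ev (N : nat) (i : 'I_N) : 'rV[R]_N := delta_mx 0 i.

Definition pd (N : nat) (i : 'I_N) (f : 'rV[R]_N -> R) : 'rV[R]_N -> R :=
  fun x => 'D_(ev i) f x.

Definition mindex (N : nat) := {ffun 'I_N -> nat}.
Definition mlen (N : nat) (a : mindex N) : nat := (\sum_(i < N) a i)%N.
Definition mincr (N : nat) (a : mindex N) (i : 'I_N) : mindex N :=
  [ffun k => (a k + (k == i))%N].

Definition dpart (N : nat) (a : mindex N) (f : 'rV[R]_N -> R) : 'rV[R]_N -> R :=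
  foldr (fun i g => iter (a i) (pd i) g) f (enum 'I_N).

Definition smooth (N : nat) (f : 'rV[R]_N -> R) : Prop :=
  forall a : mindex N, continuous (dpart a f) /\
    forall (i : 'I_N) (x : 'rV[R]_N), derivable (dpart a f) x (ev i).

Definition smooth2 (q p : nat) (f : 'rV[R]_q -> 'rV[R]_p -> R) : Prop :=
  smooth (fun w : 'rV[R]_(q + p) => f (lsubmx w) (rsubmx w)).

Definition smooth3 (q p : nat) (f : 'rV[R]_q -> R -> 'rV[R]_p -> R) : Prop :=
  smooth (fun w : 'rV[R]_(q + (1 + p)) =>
            f (lsubmx w) (lsubmx (rsubmx w) 0 0) (rsubmx (rsubmx w))).

Definition cube (N : nat) : set 'rV[R]_N :=
  [set x | forall i, -1 <= x 0 i <= 1].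
Definition bdry (N : nat) : set 'rV[R]_N :=
  [set x | cube x /\ exists i, `|x 0 i| = 1].
Definition subcube (N k : nat) : set 'rV[R]_N :=
  [set x | cube x /\ forall i : 'I_N, (k <= i)%N -> x 0 i = 0].

(* A family of sections z |-> sigma_z : I^m -> J^r(R^m,R^n), in the coordinates
   J^r(R^m,R^n) = R^m x (jets): sigma z x a j is the alpha-th derivative entry
   (|alpha| <= r) of the j-th component of the jet over the base point x. *)
Definition jetfam (q m n : nat) := 'rV[R]_q -> 'rV[R]_m -> mindex m -> 'I_n -> R.

Definition jet (q m n : nat) (h : 'rV[R]_q -> 'rV[R]_m -> 'rV[R]_n) : jetfam q m n :=
  fun z x a j => dpart a (fun y => h z y 0 j) x.

(* pointwise C^0 bound on the perp-component of sigma_z at x with respect to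
   the hyperplane tau_z(x) = ker nu_z(x):
   all (r-1)-jet entries, and all d_w d_alpha (|alpha| < r, w unit in tau)
   have absolute value < eps *)
Definition perp_lt (q m n r : nat) (sigma : jetfam q m n)
  (nu : 'rV[R]_q -> 'rV[R]_m -> 'rV[R]_m) (z : 'rV[R]_q) (x : 'rV[R]_m)
  (eps : R) : Prop :=
  forall (a : mindex m) (j : 'I_n), (mlen a < r)%N ->
    `|sigma z x a j| < eps /\
    forall w : 'rV[R]_m, \sum_(i < m) w 0 i ^+ 2 = 1 ->
      \sum_(i < m) w 0 i * nu z x 0 i = 0 ->
      `|\sum_(i < m) w 0 i * sigma z x (mincr a i) j| < eps.

Definition perp_zero (q m n r : nat) (sigma : jetfam q m n)
  (nu : 'rV[R]_q -> 'rV[R]_m -> 'rV[R]_m) (z : 'rV[R]_q) (x : 'rV[R]_m) : Prop :=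
  forall (a : mindex m) (j : 'I_n), (mlen a < r)%N ->
    sigma z x a j = 0 /\
    forall w : 'rV[R]_m, \sum_(i < m) w 0 i ^+ 2 = 1 ->
      \sum_(i < m) w 0 i * nu z x 0 i = 0 ->
      \sum_(i < m) w 0 i * sigma z x (mincr a i) j = 0.

Definition jet_zero (q m n r : nat) (sigma : jetfam q m n) z x : Prop :=
  forall (a : mindex m) (j : 'I_n), (mlen a <= r)%N -> sigma z x a j = 0.

Definition isotopy_family (q m : nat)
  (F : 'rV[R]_q -> R -> 'rV[R]_m -> 'rV[R]_m) : Prop :=
  (forall i : 'I_m, smooth3 (fun z t x => F z t x 0 i)) /\
  (forall z x, cube z -> cube x -> F z 0 x = x) /\
  (forall z t, cube z -> 0 <= t <= 1 ->
     (forall x, cube x -> cube (F z t x)) /\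
     exists G : 'rV[R]_m -> 'rV[R]_m,
       (forall i : 'I_m, smooth (fun y => G y 0 i)) /\
       (forall x, cube x -> cube (G x)) /\
       (forall x, cube x -> G (F z t x) = x) /\
       (forall x, cube x -> F z t (G x) = x)).

End Defs.

(* Main.v *)
(* Since the perp-component of sigma vanishes, its derivatives of order < r vanish and those of
   order r are those of c * (v . x)^r / r!, where v is the unit normal of tau.  On a lattice of
   mesh 1/P, replace this homogeneous polynomial near each node by c N^-r psi(N v . x - theta),
   with N = M P and psi a compactly supported function whose r-th derivative is 1 except
   near the integers, and glue with a partition of unity.  The r-th derivatives then
   approximate sigma where all the phases N v . x - theta in use stay away from the integers; all
   derivatives below order r, and those of order r with a factor tangent to tau, are small
   everywhere because N is large compared with P.

   The exceptional set is a union of thin pancakes of diameter about 1/P.  Choosing the phases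
   theta greedily makes nearby pancakes disjoint, so that they can be handled one at
   a time: a half-turn about a point beside it, cut off outside a slightly larger thin
   ellipsoid, moves the hyperplane {x_last = 0} off it.  These twists have disjoint supports,
   and their composition is the isotopy.  M is chosen from the precision, then P from the
   moduli of continuity. *)
Require Import Defs.
From HB Require Import structures.
From mathcomp Require Import all_boot all_order all_algebra.
From mathcomp Require Import all_classical all_reals all_analysis.
From mathcomp Require Import ring lra zify.
Set Implicit Arguments. Unset Strict Implicit. Unset Printing Implicit Defensive.
Import Order.TTheory GRing.Theory Num.Theory.
Import numFieldNormedType.Exports.
Local Open Scope classical_set_scope.
Local Open Scope ring_scope.

(** * Smooth functions *)

(** The obstacle is a circle of constants: the thickness [kappa] of the layers around the integers
    controls the derivatives of the profile, these control the choice of [M], and the layers lie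
    only 1/(M P) apart, yet neighbouring ones must be separated by many times their thickness.
    Measuring in phase breaks the circle: a layer has half-width [kappa] and period 1 whatever [M]
    and [P] are, so [kappa] only has to beat the number of lattice neighbours of a node, which
    depends on [q] and [m]. The derivatives of the profile are bounded independently of its number
    of teeth, and although the number of nodes grows with [P], each error term carries the indicator
    of a box, at most 3^(q+m) of which meet at a point. Geometric constants: in a form where a
    pancake has diameter at most 1, the half-turn is centred at distance 2 from it and supported in
    radius 4, so within radius 6 of the pancake. In phase, radius 6 is less than 17 [kappa]; with
    [kappa] for the pancake itself this makes 18. Two such supports, and [kappa] for the variation
    of the normal, give 37, below the separation 39 used for the phases. *)

Section Smoothness.
Variables (R : realType) (V : normedModType R) (I : Type) (e : I -> V).
Implicit Types f g : V -> R.

(** Only derivatives along the directions [e i] occur, over any index type. The same closure lemmas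
    then serve one real variable ([line]), row vectors ([ev]) and, with an empty index type, plain
    continuity. *)
Fixpoint Ck (n : nat) f : Prop :=
  if n is n'.+1 then
    continuous f /\ forall i, (forall x, derivable f x (e i)) /\ Ck n' ('D_(e i) f)
  else continuous f.

Definition Coo f := forall n, Ck n f.

Lemma CkW n f : Ck n.+1 f -> Ck n f.
Proof.
elim: n f => [|n IHn] f; first by case.
by move=> [cf df]; split=> // i; have [di ci] := df i; split=> //; apply: IHn.
Qed.

Lemma Coo_derivable f i x : Coo f -> derivable f x (e i).
Proof. by move=> /(_ 1%N) [_ /(_ i) []]. Qed.

Lemma Coo_derive f i : Coo f -> Coo ('D_(e i) f).
Proof. by move=> cf n; have [_ /(_ i) []] := cf n.+1. Qed.

Lemma Ck_cst n c : Ck n (fun=> c).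
Proof.
have cc (d : R) : continuous (fun _ : V => d) by move=> x; exact: cvg_cst.
elim: n c => [|n IHn] c /=; first exact: cc.
split=> [|i]; first exact: cc.
split=> [x|]; first exact: derivable_cst.
suff -> : 'D_(e i) (fun _ : V => c) = fun=> 0 by exact: IHn.
by apply/funext => x; exact: derive_cst.
Qed.

Lemma Ck_add n f g : Ck n f -> Ck n g -> Ck n (fun x => f x + g x).
Proof.
elim: n f g => [|n IHn] f g; first by move=> cf cg x; exact: (cvgD (cf x) (cg x)).
move=> [cf df] [cg dg]; split=> [x|i]; first exact: (cvgD (cf x) (cg x)).
have [df1 df2] := df i; have [dg1 dg2] := dg i.
split=> [x|]; first exact: derivableD.
suff -> : 'D_(e i) (fun x => f x + g x) = (fun x => 'D_(e i) f x + 'D_(e i) g x).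
  exact: IHn.
by apply/funext => x; exact: deriveD.
Qed.

Lemma Ck_mul n f g : Ck n f -> Ck n g -> Ck n (fun x => f x * g x).
Proof.
elim: n f g => [|n IHn] f g; first by move=> cf cg x; exact: (cvgM (cf x) (cg x)).
move=> cf' cg'; have cf0 := CkW cf'; have cg0 := CkW cg'.
move: cf' cg' => [cf df] [cg dg]; split=> [x|i].
  exact: (cvgM (cf x) (cg x)).
have [df1 df2] := df i; have [dg1 dg2] := dg i.
split=> [x|]; first exact: derivableM.
suff -> : 'D_(e i) (fun x => f x * g x) =
    (fun x => f x * 'D_(e i) g x + g x * 'D_(e i) f x).
  by apply: Ck_add; apply: IHn.
by apply/funext => x; exact: deriveM.
Qed.

Lemma Ck_inv n f : (forall x, 0 < f x) -> Ck n f -> Ck n (fun x => (f x)^-1).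
Proof.
move=> f0; have fn0 x : f x != 0 by rewrite gt_eqF.
elim: n => [|n IHn]; first by move=> cf x; apply: cvgV => //; exact: cf.
move=> cf'; have cf0 := CkW cf'; move: cf' => [cf df]; split=> [x|i].
  by apply: cvgV => //; exact: cf.
have [df1 df2] := df i; split=> [x|]; first exact: derivableV.
suff -> : 'D_(e i) (fun x => (f x)^-1) =
    (fun x => (-1) * ((f x)^-1 * (f x)^-1 * 'D_(e i) f x)).
  apply: Ck_mul; first exact: Ck_cst.
  by apply: Ck_mul => //; apply: Ck_mul; apply: IHn.
apply/funext => x; rewrite deriveV//.
by rewrite mulN1r scaleNr -invfM -expr2.
Qed.

End Smoothness.

Arguments Coo_derivable {R V I e f} i x _.

(** * Chain rule and closure properties of smooth functions *)

Section Composition.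
Variable R : realType.

Definition line (u : unit) : R := 1.
Definition Coo1 (f : R -> R) := Coo line f.

(** Restriction to the line h |-> h v + x reduces this to the one-variable chain rule, so [f] need
    only be differentiable along [v]. *)
Lemma derive_comp (V : normedModType R) (f : V -> R) (g : R -> R) x v :
  derivable f x v -> derivable g (f x) 1 ->
  is_derive x v (fun y => g (f y)) ('D_1 g (f x) * 'D_v f x).
Proof.
move=> df dg.
have fx : f x = f (0%:A *: v + x) by rewrite scale0r scale0r add0r.
have df1 : derivable (fun h : R => f (h *: v + x)) 0 1 := proj1 (derivable1P f x v) df.
have dg1 : derivable g (f (0 *: v + x)) 1 by rewrite scale0r add0r.
have df2 : differentiable (fun h : R => f (h *: v + x)) 0 := proj1 (derivable1_diffP _ _) df1.
have dg2 : differentiable g (f (0 *: v + x)) := proj1 (derivable1_diffP _ _) dg1.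
have D (k : V -> R) : 'D_v k x = 'D_1 (fun h : R => k (h *: v + x)) 0.
  rewrite /derive; set g1 := fun h => h^-1 *: _; set g2 := fun h => h^-1 *: _.
  suff -> : g1 = g2 by [].
  by apply/funext => h; rewrite /g1 /g2 /= addr0 scale0r add0r [_%:A]mulr1.
apply: DeriveDef.
  apply/derivable1P/derivable1_diffP.
  exact: (@differentiable_comp _ _ _ _ (fun h : R => f (h *: v + x)) g).
rewrite (D (fun y => g (f y))) (D f) -!derive1E.
rewrite (@derive1_comp _ (fun h : R => f (h *: v + x)) g 0); [|exact: df1|exact: dg1].
by rewrite scale0r add0r.
Qed.

Lemma Ck_comp (V : normedModType R) (I : Type) (e : I -> V) n (f : V -> R) (g : R -> R) :
  Ck e n f -> Ck line n g -> Ck e n (fun x => g (f x)).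
Proof.
elim: n f g => [|n IHn] f g.
  by move=> cf cg x; apply: (@continuous_comp _ _ _ f g); [exact: cf|exact: cg].
move=> cf' cg'; have cf0 := CkW cf'; have cg0 := CkW cg'.
move: cf' cg' => [cf df] [cg dg]; split=> [x|i].
  by apply: (@continuous_comp _ _ _ f g); [exact: cf|exact: cg].
have [df1 df2] := df i; have [dg1 dg2] := dg tt.
split=> [x|]; first by case: (derive_comp (df1 x) (dg1 (f x))).
suff -> : 'D_(e i) (fun x => g (f x)) = (fun x => 'D_1 g (f x) * 'D_(e i) f x).
  by apply: Ck_mul => //; exact: (IHn f ('D_1 g)).
by apply/funext => x; case: (derive_comp (df1 x) (dg1 (f x))).
Qed.

Lemma Ck_id n : Ck line n id.
Proof.
case: n => [|n]; first by move=> x; exact: cvg_id.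
split=> [x|i]; first exact: cvg_id.
split=> [x|]; first exact: derivable_id.
suff -> : 'D_(line i) (id : R -> R) = fun=> 1 by exact: Ck_cst.
by apply/funext => x; exact: derive_id.
Qed.

Lemma Coo1_id : Coo1 id.
Proof. by move=> n; exact: Ck_id. Qed.

Lemma sin_cos_Ck n : Ck line n (@sin R) /\ Ck line n (@cos R).
Proof.
elim: n => [|n [IHs IHc]]; first by split; [exact: continuous_sin|exact: continuous_cos].
split; (split=> [|[]]; [|split]).
- exact: continuous_sin.
- by move=> x; exact: derivable_sin.
- suff -> : 'D_(line tt) (@sin R) = cos by [].
  by apply/funext => x; apply: derive_val.
- exact: continuous_cos.
- by move=> x; exact: derivable_cos.
- suff -> : 'D_(line tt) (@cos R) = fun x => (-1) * sin x.
    by apply: Ck_mul => //; exact: Ck_cst.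
  by apply/funext => x; rewrite mulN1r; apply: derive_val.
Qed.

Section CooClosure.
Variables (V : normedModType R) (I : Type) (e : I -> V).
Implicit Types f g : V -> R.

Lemma Coo_cst c : Coo e (fun=> c).
Proof. by move=> n; exact: Ck_cst. Qed.

Lemma Coo_add f g : Coo e f -> Coo e g -> Coo e (fun x => f x + g x).
Proof. by move=> cf cg n; exact: Ck_add. Qed.

Lemma Coo_mul f g : Coo e f -> Coo e g -> Coo e (fun x => f x * g x).
Proof. by move=> cf cg n; exact: Ck_mul. Qed.

Lemma Coo_opp f : Coo e f -> Coo e (fun x => - f x).
Proof.
move=> cf; have -> : (fun x => - f x) = (fun x => (-1) * f x).
  by apply/funext => x; rewrite mulN1r.
by apply: Coo_mul => //; exact: Coo_cst.
Qed.

Lemma Coo_sub f g : Coo e f -> Coo e g -> Coo e (fun x => f x - g x).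
Proof. by move=> cf cg; apply: Coo_add => //; exact: Coo_opp. Qed.

Lemma Coo_comp f (g : R -> R) : Coo e f -> Coo1 g -> Coo e (fun x => g (f x)).
Proof. by move=> cf cg n; exact: Ck_comp. Qed.

Lemma Coo_inv f : (forall x, 0 < f x) -> Coo e f -> Coo e (fun x => (f x)^-1).
Proof. by move=> f0 cf n; exact: Ck_inv. Qed.

Lemma Coo_exp f k : Coo e f -> Coo e (fun x => f x ^+ k).
Proof.
move=> cf; elim: k => [|k IHk].
  by rewrite (_ : (fun _ => _) = fun=> 1) //; exact: Coo_cst.
rewrite (_ : (fun _ => _) = fun x => f x * f x ^+ k); first exact: Coo_mul.
by apply/funext => x; rewrite exprS.
Qed.

Lemma Coo_sum (J : Type) (s : seq J) (P : pred J) (F : J -> V -> R) :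
  (forall j, P j -> Coo e (F j)) -> Coo e (fun x => \sum_(j <- s | P j) F j x).
Proof.
move=> cF; elim: s => [|j s IHs].
  rewrite (_ : (fun _ => _) = fun=> 0); first exact: Coo_cst.
  by apply/funext => x; rewrite big_nil.
have [Pj|nPj] := boolP (P j).
  rewrite (_ : (fun _ => _) = fun x => F j x + \sum_(j <- s | P j) F j x).
    by apply: Coo_add => //; exact: cF.
  by apply/funext => x; rewrite big_cons Pj.
by rewrite (_ : (fun _ => _) = fun x => \sum_(j <- s | P j) F j x)//;
  apply/funext => x; rewrite big_cons (negbTE nPj).
Qed.

Lemma Coo_prod (J : Type) (s : seq J) (P : pred J) (F : J -> V -> R) :
  (forall j, P j -> Coo e (F j)) -> Coo e (fun x => \prod_(j <- s | P j) F j x).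
Proof.
move=> cF; elim: s => [|j s IHs].
  rewrite (_ : (fun _ => _) = fun=> 1); first exact: Coo_cst.
  by apply/funext => x; rewrite big_nil.
have [Pj|nPj] := boolP (P j).
  rewrite (_ : (fun _ => _) = fun x => F j x * \prod_(j <- s | P j) F j x).
    by apply: Coo_mul => //; exact: cF.
  by apply/funext => x; rewrite big_cons Pj.
by rewrite (_ : (fun _ => _) = fun x => \prod_(j <- s | P j) F j x)//;
  apply/funext => x; rewrite big_cons (negbTE nPj).
Qed.

Lemma Coo_cos f : Coo e f -> Coo e (fun x => cos (f x)).
Proof. by move=> cf; apply: Coo_comp => // n; have [] := sin_cos_Ck n. Qed.

Lemma Coo_sin f : Coo e f -> Coo e (fun x => sin (f x)).
Proof. by move=> cf; apply: Coo_comp => // n; have [] := sin_cos_Ck n. Qed.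

End CooClosure.

Lemma is_derive_coord (N : nat) (i j : 'I_N) (x : 'rV[R]_N) :
  is_derive x (@ev R N i) (fun w : 'rV[R]_N => w 0 j) (j == i)%:R.
Proof.
have L : (fun h : R => h^-1 *: (((fun w : 'rV[R]_N => w 0 j) \o shift x) (h *: ev R i) -
     x 0 j)) @ 0^' --> ((j == i)%:R : R).
  apply: (@cvg_trans _ ((fun=> (j == i)%:R : R) @ 0^')); last exact: cvg_cst.
  apply: near_eq_cvg; near=> h.
  rewrite /= !mxE addrK eqxx /= [_ *: _]mulrA mulVf ?mul1r//.
  by near: h; exact: nbhs_dnbhs_neq.
apply: DeriveDef; first by apply/cvg_ex; exists (j == i)%:R.
exact: cvg_lim L.
Unshelve. all: by end_near. Qed.

Lemma Coo_coord (N : nat) (j : 'I_N) : Coo (@ev R N) (fun w : 'rV[R]_N => w 0 j).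
Proof.
case=> [|n]; first exact: coord_continuous.
split=> [|i]; first exact: coord_continuous.
split=> [x|]; first by have [] := is_derive_coord i j x.
rewrite (_ : 'D_(ev R i) _ = fun=> ((j == i)%:R : R)); first exact: Ck_cst.
by apply/funext => x; have [] := is_derive_coord i j x.
Qed.

End Composition.

(** * Cut-off functions *)

Section Bump.
Variable R : realType.
Implicit Types x y s : R.

(** The power of 1/x makes the family stable under differentiation: the derivative of [flat k]
    combines [flat k.+2] and [flat k.+1], so one induction proves all members smooth. *)
Definition flat k x : R := if 0 < x then x^-1 ^+ k * expR (- x^-1) else 0.

Lemma flat_ge0 k x : 0 <= flat k x.
Proof.
rewrite /flat; case: ifP => // x0.
by rewrite mulr_ge0 ?expR_ge0// exprn_ge0// invr_ge0 ltW.
Qed.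

Lemma expR_ge_exp (n : nat) (u : R) : 0 <= u -> (u / n.+1%:R) ^+ n.+1 <= expR u.
Proof.
move=> u0.
have -> : expR u = expR (u / n.+1%:R) ^+ n.+1.
  by rewrite -expRM_natr divfK// pnatr_eq0.
have d0 : 0 <= u / n.+1%:R by rewrite divr_ge0.
rewrite lerXn2r ?nnegrE ?expR_ge0//.
by apply: le_trans (expR_ge1Dx _); rewrite lerDr.
Qed.

(** Applied one index up: for h > 0 the quotient of [flat k h] by h is [flat k.+1 h], so a linear
    bound gives derivative 0 at the origin. *)
Lemma flat_lin k x : flat k x <= (k.+1%:R ^+ k.+1) * `|x|.
Proof.
rewrite /flat; case: ifP => x0; last by rewrite mulr_ge0// exprn_ge0.
have u0 : 0 <= x^-1 by rewrite invr_ge0 ltW.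
have xn0 : x != 0 by rewrite gt_eqF.
have k0 : (k.+1%:R : R) ^+ k.+1 != 0 by rewrite expf_neq0// pnatr_eq0.
have := expR_ge_exp k u0; rewrite expr_div_n gtr0_norm// expRN.
rewrite ler_pdivrMr ?exprn_gt0// => H.
rewrite ler_pdivrMr ?expR_gt0// -(@ler_pM2r _ x^-1) ?invr_gt0//.
by apply: le_trans (_ : expR x^-1 * k.+1%:R ^+ k.+1 <= _); rewrite -?exprSr// mulrAC mulfK// mulrC.
Qed.

Lemma is_derive_flat k x :
  is_derive x 1 (flat k) (flat k.+2 x - k%:R * flat k.+1 x).
Proof.
have [x0|x0|<-] := ltgtP 0 x.
- have xn0 : x != 0 by rewrite gt_eqF.
  apply: (@near_eq_is_derive _ _ _ (fun y => (y^-1) ^+ k * expR (- y^-1))).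
    near=> y; rewrite /flat; suff -> : 0 < y by [].
    by near: y; exact: lt_nbhsr.
  have d1 : derivable (fun y : R => y^-1) x 1 by apply: derivableV.
  have e1 : 'D_1 (fun y : R => y^-1) x = - (x^-1 ^+ 2).
    rewrite deriveV; [|exact: xn0|exact: derivable_id].
    by rewrite derive_id exprVn [LHS]mulr1.
  have D2 : is_derive x^-1 1 (fun u : R => u ^+ k * expR (- u))
      (k%:R * x^-1 ^+ k.-1 * expR (- x^-1) - x^-1 ^+ k * expR (- x^-1)).
    have a1 := @exprn_derivable R k x^-1 1; have b1 := @exp_derive R k x^-1 1.
    have [n1 n2] : is_derive (x^-1) (1 : R) (fun u : R => - u) (- 1) by exact: is_deriveN.
    have [a2 b2] := @derive_comp _ _ (fun u : R => - u) (@expR R) x^-1 1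
      n1 (@derivable_expR R _).
    apply: DeriveDef; first exact: (derivableM a1 a2).
    rewrite (deriveM a1 a2) b1 b2 n2 derive_val /GRing.scale /=; ring.
  have [d2 e2] := D2.
  have [d3 e3] := @derive_comp _ _ (fun y : R => y^-1) _ x 1 d1 d2.
  apply: DeriveDef => //; rewrite e3 e2 e1 /flat x0.
  case: k {D2 d2 e2 d3 e3} => [|k] /=; first by rewrite !expr0 !mul0r; ring.
  by rewrite !exprS; ring.
- apply: (@near_eq_is_derive _ _ _ (fun=> 0)).
    near=> y; rewrite /flat; suff /lt_gtF -> : y < 0 by [].
    by near: y; exact: lt_nbhsl.
  rewrite /flat (lt_gtF x0) mulr0 subr0; exact: is_derive_cst.
have L : (fun h : R => h^-1 *: ((flat k \o shift 0) h%:A - flat k 0)) @ 0^' --> (0 : R).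
  pose C : R := k.+2%:R ^+ k.+2.
  have C0 : 0 < C by rewrite exprn_gt0.
  apply/cvgrPdist_lt => eps e0; near=> h.
  rewrite sub0r normrN /= addr0 [_%:A]mulr1 {2}/flat ltxx subr0.
  have hn0 : h != 0 by near: h; exact: nbhs_dnbhs_neq.
  apply: (@le_lt_trans _ _ (C * `|h|)).
    apply: le_trans (flat_lin k.+1 h); rewrite [X in `|X|](_ : _ = h^-1 * flat k h)// /flat.
    case: ifP => h0; last by rewrite mulr0 normr0.
    rewrite ger0_norm ?mulrA -?exprS//.
    by rewrite mulr_ge0 ?mulr_ge0 ?expR_ge0 ?exprn_ge0 ?invr_ge0 ?ltW.
  rewrite -ltr_pdivlMl// mulrC; near: h; apply: dnbhs0_lt; exact: divr_gt0.
have -> : flat k.+2 0 - k%:R * flat k.+1 0 = 0 :> R.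
  by rewrite /flat ltxx mulr0 subr0.
apply: DeriveDef; first by apply/cvg_ex; exists 0.
exact: (cvg_lim _ L).
Unshelve. all: by end_near. Qed.

Lemma Coo1_flat k : Coo1 (flat k).
Proof.
have cf j : continuous (flat j).
  move=> x; apply: differentiable_continuous; apply/derivable1_diffP.
  by have [] := is_derive_flat j x.
move=> n; elim: n k => [|n IHn] k; first exact: cf.
split=> [|i]; first exact: cf.
split=> [x|]; first by have [] := is_derive_flat k x.
rewrite (_ : 'D_(line R i) _ = fun x => flat k.+2 x - k%:R * flat k.+1 x); last first.
  by apply/funext => x; have [] := is_derive_flat k x.
apply: Ck_add => //.
rewrite (_ : (fun _ => _) = fun x => (- k%:R) * flat k.+1 x); last first.
  by apply/funext => x; rewrite mulNr.
by apply: Ck_mul => //; exact: Ck_cst.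
Qed.

Definition step s : R := flat 0 s / (flat 0 s + flat 0 (1 - s)).

Lemma flat0_gt0 x : 0 < x -> 0 < flat 0 x.
Proof. by move=> x0; rewrite /flat x0 expr0 mul1r expR_gt0. Qed.

Lemma step_den_gt0 s : 0 < flat 0 s + flat 0 (1 - s).
Proof.
have [s0|s0] := ltP 0 s; first by rewrite ltr_pwDl ?flat0_gt0 ?flat_ge0.
by rewrite ltr_wpDl ?flat_ge0// flat0_gt0//; lra.
Qed.

Lemma Coo1_step : Coo1 step.
Proof.
apply: Coo_mul; first exact: Coo1_flat.
apply: Coo_inv; first exact: step_den_gt0.
apply: Coo_add; first exact: Coo1_flat.
apply: (@Coo_comp _ _ _ _ (fun s => 1 - s) (flat 0)); last exact: Coo1_flat.
by apply: Coo_sub; [exact: Coo_cst|exact: Coo1_id].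
Qed.

Lemma step0 s : s <= 0 -> step s = 0.
Proof. by move=> s0; rewrite /step {1}/flat ltNge s0 mul0r. Qed.

Lemma step1 s : 1 <= s -> step s = 1.
Proof.
move=> s1; rewrite /step (_ : flat 0 (1 - s) = 0) ?addr0 ?divff//.
  by rewrite gt_eqF// flat0_gt0//; lra.
by rewrite /flat ltNge (_ : 1 - s <= 0) //; lra.
Qed.

Lemma step_ge0 s : 0 <= step s.
Proof. by rewrite divr_ge0 ?flat_ge0// ltW ?step_den_gt0. Qed.

Lemma step_le1 s : step s <= 1.
Proof. by rewrite ler_pdivrMr ?step_den_gt0// mul1r lerDl flat_ge0. Qed.

End Bump.

(** * Iterated derivatives in one variable and counting of overlaps *)

Section OneVariable.
Variable R : realType.
Implicit Types (f g : R -> R) (s c : R).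

Definition dn n f : R -> R := iter n (fun g => 'D_1 g) f.

Lemma dnS n f : dn n.+1 f = 'D_1 (dn n f). Proof. by []. Qed.

Lemma Coo1_D f : Coo1 f -> Coo1 ('D_1 f).
Proof. by move=> cf; exact: (Coo_derive tt cf). Qed.

Lemma Coo1_dn n f : Coo1 f -> Coo1 (dn n f).
Proof. by move=> cf; elim: n => // n IHn; exact: Coo1_D. Qed.

Lemma Coo1_derivable f s : Coo1 f -> derivable f s 1.
Proof. by move=> cf; exact: (@Coo_derivable _ _ _ (@line R) f tt s cf). Qed.

Lemma Coo1_continuous f : Coo1 f -> continuous f.
Proof. by move=> /(_ 0%N). Qed.

Lemma dn_local (U : set R) f g n : open U -> {in U, f =1 g} -> {in U, dn n f =1 dn n g}.
Proof.
move=> oU fg; elim: n => [//|n IHn] s sU; rewrite !dnS.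
apply: near_eq_derive; near=> t; apply: IHn; rewrite inE; near: t.
by apply: open_nbhs_nbhs; split=> //; rewrite inE in sU.
Unshelve. all: by end_near. Qed.

Lemma dn_cst0 n : dn n (fun=> 0 : R) = fun=> 0.
Proof.
by elim: n => // n IHn; rewrite dnS IHn; apply/funext => s; exact: derive_cst.
Qed.

Lemma dn_eq0 (a b : R) f n s : (forall t, t < a \/ b < t -> f t = 0) ->
  s < a \/ b < s -> dn n f s = 0.
Proof.
move=> f0 H; have -> : 0 = dn n (fun=> 0) s by rewrite dn_cst0.
case: H => H.
  apply: (@dn_local [set t | t < a]); [exact: open_lt| |by rewrite inE].
  by move=> t; rewrite inE /= => ta; apply: f0; left.
apply: (@dn_local [set t | b < t]); [exact: open_gt| |by rewrite inE].
by move=> t; rewrite inE /= => ta; apply: f0; right.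
Qed.

Lemma dn_bounded (a b : R) f n : Coo1 f -> (forall t, t < a \/ b < t -> f t = 0) ->
  exists K, forall s, `|dn n f s| <= K.
Proof.
move=> cf f0; have cd := Coo1_continuous (Coo1_dn n cf).
have : compact ((dn n f) @` `[a, b]).
  apply: continuous_compact; last exact: segment_compact.
  exact: continuous_subspaceT.
move=> /compact_bounded [M [_ HM]].
exists (Num.max 0 (M + 1)) => s.
have [sa|sa] := ltP s a.
  by rewrite (dn_eq0 _ f0) ?normr0 ?le_max ?lexx//; left.
have [sb|sb] := ltP b s.
  by rewrite (dn_eq0 _ f0) ?normr0 ?le_max ?lexx//; right.
rewrite le_max; apply/orP; right; apply: (HM (M + 1)); first by rewrite ltrDl.
by exists s => //=; rewrite in_itv /= sa sb.
Qed.

Lemma dn_bounded_upto (a b : R) f N : Coo1 f -> (forall t, t < a \/ b < t -> f t = 0) ->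
  exists2 K, 1 <= K & forall n s, (n <= N)%N -> `|dn n f s| <= K.
Proof.
move=> cf f0; elim: N => [|N [K K1 HK]].
  have [K HK] := dn_bounded 0 cf f0.
  exists (Num.max 1 K); first by rewrite le_max lexx.
  by move=> n s; rewrite leqn0 => /eqP->; rewrite le_max HK orbT.
have [K' HK'] := dn_bounded N.+1 cf f0.
exists (Num.max K K'); first by rewrite le_max K1.
move=> n s; rewrite leq_eqVlt => /orP[/eqP->|nN]; first by rewrite le_max HK' orbT.
by rewrite le_max HK.
Qed.

Lemma dn_sum (J : Type) (r : seq J) (P : pred J) (F : J -> R -> R) n :
  (forall j, Coo1 (F j)) ->
  dn n (fun s => \sum_(j <- r | P j) F j s) = fun s => \sum_(j <- r | P j) dn n (F j) s.
Proof.
move=> cF; elim: n => // n IHn; rewrite dnS IHn; apply/funext => s.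
elim: r {IHn} => [|j r IHr].
  rewrite big_nil (_ : (fun _ => _) = fun=> 0); first exact: derive_cst.
  by apply/funext => t; rewrite big_nil.
have cd i := Coo1_dn n (cF i).
have cS : Coo1 (fun t => \sum_(j <- r | P j) dn n (F j) t).
  by apply: Coo_sum => i _; exact: cd.
rewrite big_cons; have [Pj|nPj] := boolP (P j); last first.
  rewrite -IHr; congr (derive _ s 1); apply/funext => t.
  by rewrite big_cons (negbTE nPj).
rewrite -IHr dnS -deriveD; [|exact: Coo1_derivable|exact: Coo1_derivable].
by congr (derive _ s 1); apply/funext => t; rewrite big_cons Pj.
Qed.

Lemma Coo1_shift f c : Coo1 f -> Coo1 (fun s => f (s - c)).
Proof.
move=> cf; apply: Coo_comp => //.
by apply: Coo_sub; [exact: Coo1_id|exact: Coo_cst].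
Qed.

Lemma dn_shift f c n : Coo1 f -> dn n (fun s => f (s - c)) = fun s => dn n f (s - c).
Proof.
move=> cf; elim: n => // n IHn; rewrite !dnS IHn; apply/funext => s.
have d1 : is_derive s (1 : R) (fun t : R => t - c) 1 := is_derive_shift s 1 (- c).
have [d2 d3] := d1.
have [_ ->] := derive_comp d2 (@Coo1_derivable _ (s - c) (Coo1_dn n cf)).
by rewrite d3 mulr1.
Qed.

Lemma dn_monomial c n s : dn n (fun t => (t - c) ^+ n / n`!%:R) s = 1.
Proof.
elim: n => [|n IHn]; first by rewrite /= expr0 fact0 divr1.
rewrite /dn iterSr -/(dn n _) -[RHS]IHn; congr (dn n _ s).
apply/funext => t.
have cid : Coo1 (fun t : R => t - c) by exact: (Coo1_shift c (@Coo1_id R)).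
rewrite (_ : (fun _ => _) = fun t => (n.+1`!%:R)^-1 *: (t - c) ^+ n.+1); last first.
  by apply/funext => u; rewrite mulrC.
have d1 : is_derive t (1 : R) (fun t : R => t - c) 1 := is_derive_shift t 1 (- c).
have [d2 d3] := d1.
have [d4 d5] := derive_comp d2 (@exprn_derivable R n.+1 (t - c) 1).
rewrite deriveZ// d5 d3 exp_derive /GRing.scale /= factS natrM mulr1 mulr1 invfM.
have : (n.+1%:R : R) != 0 by rewrite pnatr_eq0.
have : (n`!%:R : R) != 0 by rewrite pnatr_eq0 -lt0n fact_gt0.
by move=> h1 h2; rewrite mulrACA mulVf// mul1r mulrC.
Qed.

(** Two such integers differ by at most 2 [d] <= 2, so all lie among the least one and its two
    successors. *)
Lemma card_near (n : nat) (s d : R) : d <= 1 ->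
  (#|[pred p : 'I_n | (`|s - p%:R| <= d)%R]| <= 3)%N.
Proof.
move=> d1; set A := [pred _ | _]; have [p0 p0A|A0] := pickP A; last first.
  by rewrite (eq_card A0) card0.
have [pm pmA pmin] := @arg_minnP _ p0 A (fun p : 'I_n => p : nat) p0A.
rewrite cardE -(size_map val) -(size_iota pm 3); apply: uniq_leq_size.
  by rewrite map_inj_uniq ?enum_uniq//; exact: val_inj.
move=> _ /mapP[p pA ->]; rewrite mem_enum in pA; rewrite mem_iota.
have := pmin p pA; move: pA pmA; rewrite inE /A /= => h1 h2 /= h3.
rewrite h3 /= addn3 ltnS -(ler_nat R) -[pm.+2]addn2 natrD.
by move: h1 h2; rewrite !ler_norml => /andP[? ?] /andP[? ?]; lra.
Qed.

Lemma sum_near_le (n : nat) (s d K : R) (F : 'I_n -> R) : d <= 1 -> 0 <= K ->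
  (forall p, `|F p| <= K) -> (forall p : 'I_n, d < `|s - p%:R| -> F p = 0) ->
  `|\sum_p F p| <= 3 * K.
Proof.
move=> d1 K0 FK F0; rewrite (bigID (fun p : 'I_n => `|s - p%:R| <= d)) /=.
rewrite [X in _ + X]big1 ?addr0; last by move=> p; rewrite -ltNge; exact: F0.
apply: le_trans (ler_norm_sum _ _ _) _.
apply: (@le_trans _ _ (\sum_(p < n | `|s - p%:R| <= d) K)).
  by apply: ler_sum => p _; exact: FK.
rewrite (eq_bigl (mem [pred p : 'I_n | `|s - p%:R| <= d])) // sumr_const.
rewrite -[_ *+ _]mulr_natl ler_wpM2r// ler_nat.
exact: card_near.
Qed.

End OneVariable.

(** * The bump of the partition of unity and the sawtooth profile *)

Section Profiles.
Variable R : realType.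
Implicit Types s t : R.

(** As a difference of shifted steps, its integer translates telescope to 1, while each is supported
    on an interval of length 2. *)
Definition bumpf s : R := step (s + 1) - step s.

Lemma Coo1_bump : Coo1 bumpf.
Proof.
apply: Coo_sub; last exact: Coo1_step.
rewrite (_ : (fun _ => _) = fun x => step (x - (-1))).
  by apply: Coo1_shift; exact: Coo1_step.
by apply/funext => x; rewrite opprK.
Qed.

Lemma bump_eq0 s : s <= -1 \/ 1 <= s -> bumpf s = 0.
Proof.
rewrite /bumpf; case=> h; first by rewrite !step0 ?subr0; lra.
by rewrite !step1 ?subrr; lra.
Qed.

Lemma norm_bump s : `|bumpf s| <= 1.
Proof.
have := @step_ge0 R s; have := @step_ge0 R (s + 1).
by have := @step_le1 R s; have := @step_le1 R (s + 1); rewrite ler_norml /bumpf; lra.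
Qed.

Lemma sum_bump (P : nat) s : `|s| <= P%:R ->
  \sum_(p < P.*2.+1) bumpf (s + P%:R - p%:R) = 1.
Proof.
rewrite ler_norml => /andP[s1 s2].
have telescope n : \sum_(p < n) bumpf (s + P%:R - p%:R) =
    step (s + P%:R + 1) - step (s + P%:R + 1 - n%:R).
  elim: n => [|n IHn]; first by rewrite big_ord0 subr0 subrr.
  rewrite big_ord_recr /= IHn /bumpf -[n.+1]addn1 natrD.
  rewrite (_ : s + P%:R - n%:R + 1 = s + P%:R + 1 - n%:R); last by ring.
  by rewrite (_ : s + P%:R + 1 - (n%:R + 1) = s + P%:R - n%:R); last ring; ring.
rewrite telescope step1; last by lra.
rewrite step0 ?subr0// -[_.+1]addn1 natrD -muln2 natrM.
by lra.
Qed.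

Lemma dn_bump_eq0 n s : 1 < `|s| -> dn n bumpf s = 0.
Proof.
move=> s1; apply: (@dn_eq0 _ (-1) 1).
  by move=> t tt; apply: bump_eq0; case: tt => /ltW; auto.
by move: s1; rewrite real_ltr_normr ?num_real// => /orP[]; [right|left]; lra.
Qed.

Variables (kappa : R) (r : nat).

Definition plateau s : R := step (s / kappa) * step ((1 - s) / kappa).
(** The polynomial has r-th derivative 1 but is unbounded on the line; restarting it in each unit
    cell keeps it bounded, at the price of layers of width [kappa] around the integers. *)
Definition sawtooth s : R := plateau s * ((s - 1 / 2) ^+ r / r`!%:R).
Definition saw (J : nat) s : R := \sum_(j < J.*2.+1) sawtooth (s + J%:R - j%:R).

Hypothesis kappa0 : 0 < kappa.

Lemma Coo1_sawtooth : Coo1 sawtooth.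
Proof.
apply: Coo_mul.
  apply: Coo_mul; apply: Coo_comp; try exact: Coo1_step;
    apply: Coo_mul; try exact: Coo_cst; first exact: Coo1_id.
  by apply: Coo_sub; [exact: Coo_cst|exact: Coo1_id].
apply: Coo_mul; last exact: Coo_cst; apply: Coo_exp.
exact: (Coo1_shift (1 / 2) (@Coo1_id R)).
Qed.

Lemma sawtooth_eq0 s : s < 0 \/ 1 < s -> sawtooth s = 0.
Proof.
rewrite /sawtooth /plateau; case=> h.
  by rewrite step0 ?mul0r// pmulr_lle0 ?invr_gt0// ltW.
rewrite [X in _ * X * _]step0 ?mulr0 ?mul0r// pmulr_lle0 ?invr_gt0//.
by lra.
Qed.

Lemma plateau_eq1 s : kappa <= s <= 1 - kappa -> plateau s = 1.
Proof.
move=> /andP[h1 h2]; rewrite /plateau !step1 ?mulr1// ler_pdivlMr// mul1r//.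
by lra.
Qed.

Lemma Coo1_saw J : Coo1 (saw J).
Proof.
apply: Coo_sum => j _.
rewrite (_ : (fun _ => _) = fun x => sawtooth (x - (j%:R - J%:R))).
  by apply: Coo1_shift; exact: Coo1_sawtooth.
by apply/funext => x; rewrite opprB addrA.
Qed.

Lemma dn_saw J n s :
  dn n (saw J) s = \sum_(j < J.*2.+1) dn n sawtooth (s + J%:R - j%:R).
Proof.
have E (j : nat) : (fun x => sawtooth (x + J%:R - j%:R)) =
    fun x => sawtooth (x - (j%:R - J%:R)).
  by apply/funext => x; rewrite opprB addrA.
rewrite /saw dn_sum; last first.
  by move=> j; rewrite E; apply: Coo1_shift; exact: Coo1_sawtooth.
apply: eq_bigr => j _; rewrite E dn_shift ?opprB ?addrA//; exact: Coo1_sawtooth.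
Qed.

(** Few teeth overlap at a point, so the bound is uniform in [J]. This matters because [J] will grow
    with [M], and [M] is chosen after this bound. *)
Lemma dn_saw_bounded (N : nat) :
  exists2 K, 1 <= K & forall J n s, (n <= N)%N -> `|dn n (saw J) s| <= K.
Proof.
have [K K1 HK] := dn_bounded_upto N Coo1_sawtooth sawtooth_eq0.
exists (3 * K); first lra.
move=> J n s nN; rewrite dn_saw.
apply: (@sum_near_le _ _ (s + J%:R - 1 / 2) 1); rewrite ?lexx//; first lra.
  by move=> p; exact: HK.
move=> p p1; apply: (@dn_eq0 _ 0 1); first exact: sawtooth_eq0.
move: p1; rewrite real_ltr_normr ?num_real// => /orP[]; [right|left]; lra.
Qed.

Lemma dn_saw_eq1 (J : nat) s : `|s| <= J%:R ->
  (forall j : int, kappa < `|s - j%:~R|) -> dn r (saw J) s = 1.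
Proof.
have k0 := kappa0; rewrite ler_norml => /andP[sJ1 sJ2] far.
(* The integer part of [s + J] selects the one tooth that contributes at [s]; distance [kappa] from
   the integers puts [s] where its plateau equals 1. *)
pose f := Num.floor (s + J%:R).
have f0 : 0 <= f by rewrite floor_ge0; lra.
have /andP[f1 f2] : f%:~R <= s + J%:R < (f + 1)%:~R.
  by rewrite floor_le floorD1_gt.
case: f f0 f1 f2 => // j _ f1 f2.
have jlt : (j < J.*2.+1)%N.
  rewrite ltnS -(ler_nat R) -muln2 natrM; move: f1; rewrite -pmulrn => f1; lra.
rewrite intrD -!pmulrn in f1 f2.
have k1 := far (j%:Z - J%:Z); have k2 := far (j%:Z + 1 - J%:Z).
rewrite !rmorphB /= ?rmorphD /= -!pmulrn in k1 k2.
have h1 : kappa < s + J%:R - j%:R.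
  by move: k1; rewrite ger0_norm; lra.
have h2 : s + J%:R - j%:R < 1 - kappa.
  by move: k2; rewrite ler0_norm; lra.
rewrite dn_saw (bigD1 (Ordinal jlt)) //= big1 ?addr0; last first.
  move=> i /eqP ij; apply: (@dn_eq0 _ 0 1); first exact: sawtooth_eq0.
  have : (i < j)%N \/ (j < i)%N.
    have [||e] := ltngtP i j; [by left|by right|].
    by case: ij; apply/val_inj.
  case; rewrite -(ltr_nat R) => _ij.
    right; have : (i.+1%:R : R) <= j%:R by rewrite ler_nat -(ltr_nat R).
    by rewrite -addn1 natrD; lra.
  left; have : (j.+1%:R : R) <= i%:R by rewrite ler_nat -(ltr_nat R).
  by rewrite -addn1 natrD; lra.
rewrite -[RHS](dn_monomial (1/2) r (s + J%:R - j%:R)).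
apply: (@dn_local _ ([set t | kappa < t] `&` [set t | t < 1 - kappa])).
- by apply: openI; [exact: open_gt|exact: open_lt].
- move=> t; rewrite inE /= => -[t1 t2]; rewrite /sawtooth plateau_eq1 ?mul1r//.
  by rewrite !ltW.
- by rewrite inE.
Qed.

End Profiles.

(** * Oscillating waves *)

Section PartialDerivatives.
Variables (R : realType) (m : nat).
Implicit Types (f g : 'rV[R]_m -> R) (I : seq 'I_m) (a b : mindex m).

Definition pdl I f := foldr (@pd R m) f I.

(** The order is that in which [dpart] nests its partial derivatives, so [dpart] becomes an iterated
    derivative along a list, open to induction. *)
Definition mlist a : seq 'I_m := flatten [seq nseq (a i) i | i <- enum 'I_m].

Lemma dpartE a f : dpart a f = pdl (mlist a) f.
Proof.
rewrite /dpart /pdl /mlist; elim: (enum 'I_m) => //= i s IHs.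
rewrite foldr_cat -IHs; elim: (a i) => //= k ->.
by [].
Qed.

Lemma size_mlist a : size (mlist a) = mlen a.
Proof.
rewrite /mlist /mlen size_flatten /shape -map_comp sumnE big_map big_enum /=.
by apply: eq_bigr => i _; rewrite size_nseq.
Qed.

Lemma prod_mlist a (v : 'I_m -> R) :
  \prod_(i <- mlist a) v i = \prod_i v i ^+ a i.
Proof.
rewrite /mlist big_flatten big_map big_enum /=.
by apply: eq_bigr => i _; rewrite big_nseq -Monoid.iteropE.
Qed.

Lemma mlen_mincr a i : mlen (mincr a i) = (mlen a).+1.
Proof.
rewrite /mlen (eq_bigr (fun k => a k + (k == i))%N); last by move=> k _; rewrite ffunE.
rewrite big_split /= (bigD1 i) //= [X in (_ + X)%N](bigD1 i) //= eqxx.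
by rewrite [X in (1 + X)%N]big1 ?addn1// => k /negbTE ->.
Qed.

Lemma prod_mincr a i (v : 'I_m -> R) :
  \prod_k v k ^+ mincr a i k = v i * \prod_k v k ^+ a k.
Proof.
rewrite (eq_bigr (fun k => v k ^+ a k * v k ^+ (k == i))); last first.
  by move=> k _; rewrite ffunE exprD.
rewrite big_split /= mulrC; congr (_ * _).
by rewrite (bigD1 i) //= eqxx expr1 big1 ?mulr1// => k /negbTE ->.
Qed.

Lemma Coo_pd i f : Coo (@ev R m) f -> Coo (@ev R m) (pd i f).
Proof. exact: Coo_derive. Qed.

Lemma Coo_pdl I f : Coo (@ev R m) f -> Coo (@ev R m) (pdl I f).
Proof. by move=> cf; elim: I => //= i I IHI; exact: Coo_pd. Qed.

Lemma Coo_smooth f : Coo (@ev R m) f -> smooth f.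
Proof.
move=> cf a; rewrite dpartE; have cp := Coo_pdl (mlist a) cf.
by split=> [|i x]; [exact: (cp 0%N)|exact: Coo_derivable].
Qed.

Lemma pdl_rcons I i f : pdl (rcons I i) f = pdl I (pd i f).
Proof. by rewrite /pdl foldr_rcons. Qed.

Lemma pd_lin2 i (c d : R) f g : Coo (@ev R m) f -> Coo (@ev R m) g ->
  pd i (fun x => c * f x + d * g x) = fun x => c * pd i f x + d * pd i g x.
Proof.
move=> cf cg; apply/funext => x; rewrite /pd.
have df := Coo_derivable i x cf; have dg := Coo_derivable i x cg.
rewrite (_ : (fun x => _) = (c *: f + d *: g)) //.
by rewrite (deriveD (@derivableZ _ _ _ f c _ _ df) (@derivableZ _ _ _ g d _ _ dg))
  (deriveZ c df) (deriveZ d dg).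
Qed.

Lemma pdl_lin2 I (c d : R) f g : Coo (@ev R m) f -> Coo (@ev R m) g ->
  pdl I (fun x => c * f x + d * g x) = fun x => c * pdl I f x + d * pdl I g x.
Proof.
move=> cf cg; elim: I => //= i I ->; rewrite pd_lin2//; exact: Coo_pdl.
Qed.

Lemma pdl_cst0 I : pdl I (fun=> 0 : R) = fun=> 0.
Proof.
by elim: I => //= i I ->; apply/funext => x; exact: derive_cst.
Qed.

Lemma pdl_sum I (J : Type) (s : seq J) (c : J -> R) (F : J -> 'rV[R]_m -> R) :
  (forall j, Coo (@ev R m) (F j)) ->
  pdl I (fun x => \sum_(j <- s) c j * F j x) =
  fun x => \sum_(j <- s) c j * pdl I (F j) x.
Proof.
move=> cF; elim: s => [|j s IHs].
  rewrite (_ : (fun x => _) = fun=> 0); last by apply/funext => x; rewrite big_nil.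
  by rewrite pdl_cst0; apply/funext => x; rewrite big_nil.
rewrite (_ : (fun x => _) =
    fun x => c j * F j x + 1 * \sum_(j <- s) c j * F j x); last first.
  by apply/funext => x; rewrite big_cons mul1r.
rewrite pdl_lin2//; last first.
  by apply: Coo_sum => k _; apply: Coo_mul => //; exact: Coo_cst.
by apply/funext => x; rewrite IHs big_cons mul1r.
Qed.

(* In a two-parameter family closed under differentiation, where each derivative
   either costs a factor [P] or pulls out the large factor [N], the top power of
   [N] dominates. *)
Lemma pdl_asymptotics (X : Type) (up : 'I_m -> X -> X) (nx : X -> X) (lev : X -> nat)
    (T : X -> 'rV[R]_m -> R) (P N M K : R) (v : 'I_m -> R) (r : nat) (x : 'rV[R]_m) :
  (forall a : X, Coo (@ev R m) (T a)) ->
  (forall (a : X) i, pd i (T a) = fun y => P * T (up i a) y + N * v i * T (nx a) y) ->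
  (forall (a : X) i, lev (up i a) = (lev a).+1) -> (forall a : X, lev (nx a) = (lev a).+1) ->
  (forall a : X, (lev a <= r)%N -> `|T a x| <= K) -> 0 <= K ->
  0 <= P -> 0 <= N -> P * M <= N -> 1 <= M -> (forall i, `|v i| <= 1) ->
  forall I (a : X), (size I + lev a <= r)%N ->
  `|pdl I (T a) x - N ^+ size I * (\prod_(i <- I) v i) * T (iter (size I) nx a) x|
    <= 3 ^+ size I * N ^+ size I * K / M.
Proof.
move=> cT dT levu levn TK K0 P0 N0 PM M1 v1.
have M0 : 0 < M by lra.
have KM0 : 0 <= K / M by rewrite divr_ge0// ltW.
have lev_iter d (a : X) : lev (iter d nx a) = (d + lev a)%N by elim: d => //= d IH; rewrite levn IH.
have prod_le1 I : `|\prod_(i <- I) v i| <= 1.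
  elim: I => [|i I IHI]; first by rewrite big_nil normr1.
  by rewrite big_cons normrM; apply: mulr_ile1.
(* The innermost derivative is peeled off, because the recurrence [dT] speaks of members of the
   family and not of their derivatives. *)
elim/last_ind => [|I i IHI] a.
  by move=> _; rewrite big_nil !mul1r subrr normr0.
rewrite size_rcons addSn => szr.
have szu : (size I + lev (up i a) <= r)%N by rewrite levu addnS.
have szn : (size I + lev (nx a) <= r)%N by rewrite levn addnS.
have Hu := IHI _ szu; have Hn := IHI _ szn.
rewrite pdl_rcons dT pdl_lin2// -cats1 big_cat big_seq1 iterSr /=.
set d := size I in szr szu szn Hu Hn *; set w := \prod_(j <- I) v j in Hu Hn *.
set A := pdl I _ x in Hu *; set B := pdl I _ x in Hn *.
have Nd0 : 0 <= N ^+ d by rewrite exprn_ge0.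
have d3 : 1 <= 3 ^+ d :> R by rewrite exprn_ege1// ler1n.
(* The 2 obtained here and the 1 in [NB] add up to the ratio 3 of the bound. *)
have A1 : `|A| <= 2 * 3 ^+ d * N ^+ d * K.
  rewrite (_ : A = (A - N ^+ d * w * T (iter d nx (up i a)) x) +
                    N ^+ d * w * T (iter d nx (up i a)) x); last by ring.
  apply: le_trans (ler_normD _ _) _.
  have : `|N ^+ d * w * T (iter d nx (up i a)) x| <= N ^+ d * K.
    rewrite !normrM ger0_norm// -mulrA ler_wpM2l//.
    rewrite -[X in _ <= X]mul1r; apply: ler_pM => //; first exact: prod_le1.
    by apply: TK; rewrite lev_iter.
  have : 3 ^+ d * N ^+ d * K / M <= 3 ^+ d * N ^+ d * K.
    by rewrite ler_pdivrMr// ler_peMr// !mulr_ge0// exprn_ge0.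
  have : N ^+ d * K <= 3 ^+ d * N ^+ d * K.
    by rewrite -mulrA ler_peMl// mulr_ge0.
  by move: Hu; lra.
rewrite (_ : P * A + N * v i * B - _ =
    P * A + N * v i * (B - N ^+ d * w * T (iter d nx (nx a)) x)); last first.
  by rewrite exprS; ring.
apply: le_trans (ler_normD _ _) _; rewrite !normrM (ger0_norm P0) (ger0_norm N0).
have PA : P * `|A| <= N / M * (2 * 3 ^+ d * N ^+ d * K).
  by apply: ler_pM => //; rewrite ler_pdivlMr.
have NB : N * `|v i| * `|B - N ^+ d * w * T (iter d nx (nx a)) x| <=
    N * (3 ^+ d * N ^+ d * K / M).
  apply: ler_pM => //; first by rewrite mulr_ge0.
  by rewrite ler_piMr.
apply: le_trans (lerD PA NB) _; rewrite !exprS le_eqVlt; apply/orP; left; apply/eqP.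
by field; rewrite gt_eqF.
Qed.

Lemma derive_const_along (f : 'rV[R]_m -> R) x w :
  (forall h : R, f (h *: w + x) = f x) -> 'D_w f x = 0.
Proof.
move=> fc; rewrite /derive (_ : (fun h => _) = fun=> 0); last first.
  by apply/funext => h /=; rewrite fc subrr scaler0.
by apply: cvg_lim => //; exact: cvg_cst.
Qed.

Section Wave.
Variables (P N theta : R) (c v : 'I_m -> R) (B S : R -> R).
Hypotheses (cB : Coo1 B) (cS : Coo1 S).

Definition phase (x : 'rV[R]_m) : R := \sum_j N * v j * x 0 j - theta.

(** The index counts the derivatives taken of each bump factor and of the oscillating factor; it is
    what makes the family closed under [pd]. *)
Definition wave (bs : mindex m * nat) (x : 'rV[R]_m) : R :=
  (\prod_j dn (bs.1 j) B (P * x 0 j - c j)) * dn bs.2 S (phase x).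

Lemma Coo_phase : Coo (@ev R m) phase.
Proof.
apply: Coo_sub; last exact: Coo_cst.
by apply: Coo_sum => j _; apply: Coo_mul; [exact: Coo_cst|exact: Coo_coord].
Qed.

Lemma Coo_cell (j : 'I_m) : Coo (@ev R m) (fun x : 'rV[R]_m => P * x 0 j - c j).
Proof.
apply: Coo_sub; last exact: Coo_cst.
by apply: Coo_mul; [exact: Coo_cst|exact: Coo_coord].
Qed.

Lemma Coo_wave bs : Coo (@ev R m) (wave bs).
Proof.
apply: Coo_mul.
  apply: Coo_prod => j _; apply: (@Coo_comp _ _ _ _ (fun x : 'rV[R]_m => P * x 0 j - c j)).
    exact: Coo_cell.
  exact: Coo1_dn.
by apply: (@Coo_comp _ _ _ _ phase); [exact: Coo_phase|exact: Coo1_dn].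
Qed.

Lemma derive_phase i x : 'D_(ev R i) phase x = N * v i.
Proof.
have cL : Coo (@ev R m) (fun x : 'rV[R]_m => \sum_j (N * v j) * x 0 j).
  by apply: Coo_sum => j _; apply: Coo_mul; [exact: Coo_cst|exact: Coo_coord].
rewrite (_ : phase = (fun x : 'rV[R]_m => \sum_j (N * v j) * x 0 j) - cst theta) //.
rewrite (deriveB (Coo_derivable i x cL) (derivable_cst theta x (ev R i))).
rewrite derive_cst subr0 -[LHS]/(pdl [:: i] _ x).
rewrite (pdl_sum [:: i] _ (fun j => N * v j) (@Coo_coord R m)) /= (bigD1 i) //= big1 ?addr0.
  rewrite /pd; by have [_ ->] := is_derive_coord i i x; rewrite eqxx mulr1.
move=> j ji; rewrite /pd; have [_ ->] := is_derive_coord i j x.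
by rewrite (negbTE ji) mulr0.
Qed.

Lemma derive_cell (j i : 'I_m) x :
  'D_(ev R i) (fun x : 'rV[R]_m => P * x 0 j - c j) x = P * (j == i)%:R.
Proof.
have [d1 d2] := is_derive_coord i j x.
rewrite (_ : (fun x => _) = P *: (fun x : 'rV[R]_m => x 0 j) - cst (c j)) //.
rewrite (deriveB (@derivableZ _ _ _ _ P _ _ d1) (derivable_cst (c j) x (ev R i))).
by rewrite derive_cst subr0 (deriveZ P d1) d2.
Qed.

Lemma pd_wave bs i :
  pd i (wave bs) = fun x => P * wave (mincr bs.1 i, bs.2) x + N * v i * wave (bs.1, bs.2.+1) x.
Proof.
case: bs => b s; apply/funext => x; rewrite /pd /wave /=.
pose F j (x : 'rV[R]_m) := dn (b j) B (P * x 0 j - c j).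
pose G (x : 'rV[R]_m) := \prod_(j | j != i) F j x.
pose H (x : 'rV[R]_m) := dn s S (phase x).
have cF j : Coo (@ev R m) (F j).
  apply: (@Coo_comp _ _ _ _ (fun x : 'rV[R]_m => P * x 0 j - c j)).
    exact: Coo_cell.
  exact: Coo1_dn.
have cG : Coo (@ev R m) G by apply: Coo_prod => j _; exact: cF.
have cH : Coo (@ev R m) H.
  by apply: (@Coo_comp _ _ _ _ phase); [exact: Coo_phase|exact: Coo1_dn].
have dG : 'D_(ev R i) G x = 0.
  apply: derive_const_along => h; apply: eq_bigr => j ji.
  by rewrite /F !mxE eqxx /= (negbTE ji) mulr0 add0r.
have dF : 'D_(ev R i) (F i) x = P * dn (b i).+1 B (P * x 0 i - c i).
  have [_ ->] := derive_comp (Coo_derivable i x (Coo_cell i))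
    (@Coo1_derivable _ _ (P * x 0 i - c i) (Coo1_dn (b i) cB)).
  by rewrite derive_cell eqxx mulr1 mulrC.
have dH : 'D_(ev R i) H x = N * v i * dn s.+1 S (phase x).
  have [_ ->] := derive_comp (Coo_derivable i x Coo_phase)
    (@Coo1_derivable _ _ (phase x) (Coo1_dn s cS)).
  by rewrite derive_phase mulrC.
rewrite (_ : (fun x => _) = (F i * G) * H); last first.
  by apply/funext => y; rewrite /= (bigD1 i).
have df := Coo_derivable i x (cF i); have dg := Coo_derivable i x cG.
have dh := Coo_derivable i x cH.
rewrite (deriveM (derivableM df dg) dh) (deriveM df dg) dG dF dH
  [in RHS](bigD1 i) //= [in X in _ = _ + X](bigD1 i) //=.
rewrite ffunE eqxx addn1 (eq_bigr (fun j => F j x)); last first.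
  by move=> j ji; rewrite ffunE (negbTE ji) addn0.
have EG : \prod_(j < m | j != i) dn (b j) B (P * x 0 j - c j) = G x by [].
rewrite EG -/(G x) /GRing.scale /= -/(H x) (_ : (F i * G) x = F i x * G x) // -/(F i x).
by ring.
Qed.

Definition wave0 : 'rV[R]_m -> R :=
  fun x => (\prod_j B (P * x 0 j - c j)) * S (phase x).

Lemma Coo_wave0 : Coo (@ev R m) wave0.
Proof.
have := Coo_wave ([ffun=> 0%N], 0%N); congr (Coo _ _).
apply/funext => x; rewrite /wave /wave0 /=; congr (_ * _).
by apply: eq_bigr => j _; rewrite ffunE.
Qed.

(** [pdl_asymptotics] is pointwise in x, so its bound may be taken to be 0 off the box, where all
    members of the family vanish. This indicator is what later allows a sum over all nodes bounded
    independently of [P]. *)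
Lemma wave0_asymptotics (M Kb Ks : R) (r : nat) I x :
  (forall n s, (n <= r)%N -> `|dn n B s| <= Kb) ->
  (forall n s, 1 < `|s| -> dn n B s = 0) ->
  (forall n s, (n <= r)%N -> `|dn n S s| <= Ks) ->
  0 <= Kb -> 0 <= Ks -> 0 <= P -> 0 <= N -> P * M <= N -> 1 <= M ->
  (forall i, `|v i| <= 1) -> (size I <= r)%N ->
  `|pdl I wave0 x - N ^+ size I * (\prod_(i <- I) v i) *
      ((\prod_j B (P * x 0 j - c j)) * dn (size I) S (phase x))| <=
    3 ^+ size I * N ^+ size I *
      (if [forall j, `|P * x 0 j - c j| <= 1] then Kb ^+ m * Ks else 0) / M.
Proof.
move=> HB B0 HS Kb0 Ks0 P0 N0 PM M1 v1 szI.
pose nx (bs : mindex m * nat) := (bs.1, bs.2.+1).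
pose up i (bs : mindex m * nat) := (mincr bs.1 i, bs.2).
pose lev (bs : mindex m * nat) := (mlen bs.1 + bs.2)%N.
pose z : mindex m * nat := ([ffun=> 0%N], 0%N).
have iter_nx d : iter d nx z = (z.1, d) by elim: d => //= d ->.
have W bs y : wave bs y = (\prod_j dn (bs.1 j) B (P * y 0 j - c j)) * dn bs.2 S (phase y) by [].
have z0 d : wave (z.1, d) = fun y => (\prod_j B (P * y 0 j - c j)) * dn d S (phase y).
  apply/funext => y; rewrite W /=; congr (_ * _).
  by apply: eq_bigr => j _; rewrite ffunE.
have lz : lev z = 0%N.
  by rewrite /lev /= addn0 /mlen big1// => j _; rewrite ffunE.
have -> : wave0 = wave z by rewrite [z]surjective_pairing z0.
set K := if _ then _ else _.
have K0 : 0 <= K by rewrite /K; case: ifP => // _; rewrite mulr_ge0// exprn_ge0.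
have TK bs : (lev bs <= r)%N -> `|wave bs x| <= K.
  move=> levr; rewrite /K; case: ifP => [_|/negbT].
    have bj j : (bs.1 j <= r)%N.
      apply: leq_trans levr; rewrite /lev /mlen (bigD1 j) //= -addnA.
      exact: leq_addr.
    rewrite W normrM; apply: ler_pM => //; last first.
      by apply: HS; apply: leq_trans levr; rewrite leq_addl.
    rewrite normr_prod -[X in Kb ^+ X]card_ord -prodr_const.
    by apply: ler_prod => j _; rewrite normr_ge0/= HB.
  rewrite negb_forall => /existsP[j]; rewrite -ltNge => Pj.
  by rewrite W (bigD1 j) //= B0// !mul0r normr0.
have := @pdl_asymptotics _ up nx lev wave P N M K v r x Coo_wave
  (fun bs i => pd_wave bs i) _ _ TK K0 P0 N0 PM M1 v1 I z.
rewrite iter_nx z0 => H; apply: H; last by rewrite lz addn0.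
- by move=> bs i; rewrite /lev /up /= mlen_mincr.
- by move=> bs; rewrite /lev /nx /= addnS.
Qed.

End Wave.

End PartialDerivatives.

(** * Choice of phases *)

Section Phases.
Variable R : realType.

Definition far (kap x : R) : Prop := forall j : int, kap < `|x - j%:~R|.

(** Let n be the length of [cs]. Of the n+1 phases t/(n+1), two clashing with the same [c] would
    differ modulo 1 by at most 2 [kap] < 1/(n+1), so they coincide; hence n forbidden values cannot
    exclude them all. *)
Lemma pigeonhole_phase (kap : R) (cs : seq R) : kap * (2 * (size cs).+1%:R) < 1 ->
  exists2 theta, 0 <= theta <= 1 & forall c, c \in cs -> far kap (theta - c).
Proof.
move=> kn; set n := size cs in kn *.
pose th (t : 'I_n.+1) : R := t%:R / n.+1%:R.
have n0 : (0 : R) < n.+1%:R by rewrite ltr0n.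
have th01 t : 0 <= th t <= 1.
  by rewrite divr_ge0//= ler_pdivrMr// mul1r ler_nat ltnW.
apply: contrapT => nex.
have bad t : {i : 'I_n | exists j : int, `|th t - nth 0 cs i - j%:~R| <= kap}.
  apply: cid; apply: contrapT => nbad; apply: nex; exists (th t) => // c ccs j.
  rewrite ltNge; apply/negP => le; apply: nbad.
  have ltc : (index c cs < n)%N by rewrite /n index_mem.
  by exists (Ordinal ltc), j => /=; rewrite nth_index.
pose f t := sval (bad t).
have finj : injective f.
  move=> t t' ff; have [j Hj] := svalP (bad t); have [j' Hj'] := svalP (bad t').
  rewrite -/(f t) ff in Hj; rewrite -/(f t') in Hj'.
  have D : `|th t - th t' - (j - j')%:~R| < n.+1%:R^-1.
    have -> : th t - th t' - (j - j')%:~R =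
      (th t - nth 0 cs (f t') - j%:~R) - (th t' - nth 0 cs (f t') - j'%:~R).
      by rewrite rmorphB /=; ring.
    apply: le_lt_trans (ler_normB _ _) _.
    apply: (@le_lt_trans _ _ (kap * 2)); first lra.
    by rewrite -[ltRHS]mul1r ltr_pdivlMr// -mulrA.
  (* [z] is the numerator of the difference over n+1: an integer of absolute value below 1. Then t -
     t' is a multiple of n+1, and both are at most n. *)
  pose z : int := t%:Z - t'%:Z - (j - j') * n.+1%:Z.
  have zE : th t - th t' - (j - j')%:~R = z%:~R / n.+1%:R.
    rewrite /th /z !rmorphB /= rmorphM /= rmorphB /= -!pmulrn.
    by field; rewrite gt_eqF.
  have z0 : z = 0.
    move: D; rewrite zE normrM normfV [X in _ / X]ger0_norm// ltr_pdivrMr// mulVf ?gt_eqF//.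
    rewrite -intr_norm -[1]/(1%:~R) ltr_int; lia.
  have tn := ltn_ord t; have tn' := ltn_ord t'.
  apply/val_inj; rewrite /= /z in z0 *.
  have : (j - j') = 0 \/ 1 <= j - j' \/ j - j' <= -1 by lia.
  by case=> [E|[E|E]]; nia.
by have := leq_card f finj; rewrite !card_ord ltnn.
Qed.

(** A new phase avoids the value [L] and one value per neighbour, at most n+1 in all, whence n+2 in
    the hypothesis. Since [K] need not be symmetric, only the orientation from the later to the
    earlier node is controlled; this is the disjunction. *)
Lemma greedy_phases (T : finType) (near : rel T) (K : T -> T -> R) (L : T -> R)
    (n : nat) (kap : R) :
  (forall p, (#|near p| <= n)%N) -> symmetric near -> 0 <= kap ->
  kap * (2 * n.+2%:R) < 1 ->
  exists theta : T -> R, [/\ forall p, 0 <= theta p <= 1,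
    forall p, far kap (theta p - L p) &
    forall p p', near p p' -> p != p' ->
      far kap (theta p - theta p' - K p p') \/ far kap (theta p' - theta p - K p' p)].
Proof.
move=> deg sym k0 kn.
have H : forall s : seq T, exists theta : T -> R,
    [/\ forall p, 0 <= theta p <= 1,
    forall p, p \in s -> far kap (theta p - L p) &
    forall p p', p \in s -> p' \in s -> near p p' -> p != p' ->
      far kap (theta p - theta p' - K p p') \/ far kap (theta p' - theta p - K p' p)].
  elim=> [|p s [th [h1 h2 h3]]].
    by exists (fun=> 0); split=> // p; rewrite lexx ler01.
  have [ps|pns] := boolP (p \in s).
    exists th; split=> // [p'|p1 p2]; rewrite !inE.
      by case/orP=> [/eqP->|]; apply: h2.
    by case/orP=> [/eqP->|p1s]; case/orP=> [/eqP->|p2s]; exact: h3.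
  pose cs := L p :: [seq th p' + K p p' | p' <- enum (near p)].
  have szcs : (size cs <= n.+1)%N by rewrite /= size_map -cardE ltnS.
  have [|t t01 tfar] := @pigeonhole_phase kap cs.
    apply: le_lt_trans kn; rewrite ler_wpM2l// ler_wpM2l// ler_nat; exact: szcs.
  have tp p' : near p p' -> far kap (t - th p' - K p p').
    move=> np; have := tfar (th p' + K p p'); rewrite opprD addrA; apply.
    by rewrite inE; apply/orP; right; apply/mapP; exists p' => //; rewrite mem_enum.
  exists (fun p' => if p' == p then t else th p'); split.
  - by move=> p'; case: ifP.
  - move=> p'; case: eqVneq => [->|pp']; first by move=> _; apply: tfar; rewrite inE eqxx.
    by rewrite inE (negbTE pp') /= => /h2.
  move=> p1 p2; rewrite !inE.
  have [->|p1p] := eqVneq p1 p; have [->|p2p] := eqVneq p2 p; rewrite ?eqxx//=.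
  - by move=> _ _ np _; left; apply: tp.
  - by move=> _ _ np _; right; apply: tp; rewrite sym.
  - by exact: h3.
have [th [h1 h2 h3]] := H (enum T).
by exists th; split=> // [p|p p']; [apply: h2|apply: h3]; rewrite mem_enum.
Qed.

Lemma card_near_lattice (I : finType) (n D : nat) (p : {ffun I -> 'I_n}) :
  (#|[pred p' : {ffun I -> 'I_n} | [forall i, (p i <= p' i + D) && (p' i <= p i + D)]]|
    <= D.*2.+1 ^ #|I|)%N.
Proof.
pose F i := [pred x : 'I_n | ((p i <= x + D) && (x <= p i + D))%N].
rewrite (@eq_card _ _ (family F)); last first.
  move=> p'; rewrite [LHS]inE; apply/forallP/familyP => h i; have := h i; by rewrite inE.
rewrite card_family -prod_nat_const foldrE big_map big_enum /=.
apply: leq_prod => i _; rewrite cardE -(size_map val) -(size_iota (p i - D) D.*2.+1).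
apply: uniq_leq_size; first by rewrite map_inj_uniq ?enum_uniq//; exact: val_inj.
move=> _ /mapP[x xF ->]; move: xF; rewrite mem_enum !inE => /andP[h1 h2].
rewrite mem_iota -muln2 -[val x]/(nat_of_ord x); lia.
Qed.

End Phases.

(** * Twists *)

Section Rotation.
Variables (R : realType) (m : nat).
Implicit Types x y u w : 'rV[R]_m.

Section Form.
Variables (bl : 'rV[R]_m -> 'rV[R]_m -> R) (e b : 'rV[R]_m).
Hypotheses (blD : forall x y w, bl (x + y) w = bl x w + bl y w)
  (blZ : forall (a : R) x w, bl (a *: x) w = a * bl x w)
  (blC : forall x y, bl x y = bl y x) (bl_ge0 : forall x, 0 <= bl x x)
  (ee : bl e e = 1) (bb : bl b b = 1) (eb : bl e b = 0).

(** Rotation by [phi] in the plane of the [bl]-orthonormal pair [e], [b], minus the identity.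
    Displacements, unlike maps, can be summed over disjoint supports. *)
Definition rot_disp (phi : R) x : 'rV[R]_m :=
  (cos phi - 1) *: (bl x e *: e + bl x b *: b) + sin phi *: (bl x e *: b - bl x b *: e).

Let blN x w : bl (- x) w = - bl x w.
Proof. by rewrite -scaleN1r blZ mulN1r. Qed.

Let be0 : bl b e = 0. Proof. by rewrite blC. Qed.

Let blDr x y w : bl w (x + y) = bl w x + bl w y.
Proof. by rewrite blC blD !(blC w). Qed.

Let blZr (a : R) x w : bl w (a *: x) = a * bl w x.
Proof. by rewrite blC blZ !(blC w). Qed.

Let blNr x w : bl w (- x) = - bl w x.
Proof. by rewrite blC blN !(blC w). Qed.

Lemma rot_e phi x : bl (x + rot_disp phi x) e = cos phi * bl x e - sin phi * bl x b.
Proof.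
rewrite /rot_disp !(blD, blZ, blN, ee, bb, eb, be0); ring.
Qed.

Lemma rot_b phi x : bl (x + rot_disp phi x) b = cos phi * bl x b + sin phi * bl x e.
Proof.
rewrite /rot_disp !(blD, blZ, blN, ee, bb, eb, be0); ring.
Qed.

Lemma rot_norm phi x : bl (x + rot_disp phi x) (x + rot_disp phi x) = bl x x.
Proof.
set u := x + _; have ue := rot_e phi x; have ub := rot_b phi x; rewrite -/u in ue ub.
rewrite {2}/u /rot_disp !(blDr, blZr, blNr) ue ub /u /rot_disp.
rewrite !(blD, blZ, blN) (blC e x) (blC b x).
have cs := cos2Dsin2 phi; move: (bl x e) (bl x b) => p q.
transitivity (bl x x + (cos phi ^+ 2 + sin phi ^+ 2 - 1) * (p ^+ 2 + q ^+ 2)).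
  by ring.
by rewrite cs subrr mul0r addr0.
Qed.

Lemma rotK phi x : rot_disp (- phi) (x + rot_disp phi x) = - rot_disp phi x.
Proof.
rewrite {1}/rot_disp rot_e rot_b cosN sinN /rot_disp.
have cs := cos2Dsin2 phi; move: (bl x e) (bl x b) => p q.
apply/rowP => i; rewrite !mxE; move: (e 0 i) (b 0 i) => ei bi.
transitivity ((cos phi - 1) * (- p * ei - q * bi) - sin phi * (p * bi - q * ei)
  + (cos phi ^+ 2 + sin phi ^+ 2 - 1) * (p * ei + q * bi)); first by ring.
by rewrite cs subrr mul0r addr0; ring.
Qed.

Lemma rot0 x : rot_disp 0 x = 0.
Proof. by rewrite /rot_disp cos0 sin0 subrr !scale0r addr0. Qed.

(** A half-turn up to squared radius 15, nothing from 16 on. *)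
Definition angle (s : R) : R := pi * step (16 - s).

Definition twist_disp (tau : R) (c x : 'rV[R]_m) : 'rV[R]_m :=
  rot_disp (tau * angle (bl (x - c) (x - c))) (x - c).

Lemma twist_disp0 tau c x : 16 <= bl (x - c) (x - c) -> twist_disp tau c x = 0.
Proof.
by move=> h; rewrite /twist_disp /angle step0 ?mulr0 ?rot0//; lra.
Qed.

Lemma twist_disp_t0 c x : twist_disp 0 c x = 0.
Proof. by rewrite /twist_disp mul0r rot0. Qed.

Lemma twist_norm tau c x :
  bl (x + twist_disp tau c x - c) (x + twist_disp tau c x - c) = bl (x - c) (x - c).
Proof. by rewrite /twist_disp addrAC rot_norm. Qed.

(** A twist preserves the distance to [c], on which its angle depends, so the opposite parameter
    applies exactly the opposite rotation. *)
Lemma twistK tau c x :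
  twist_disp (- tau) c (x + twist_disp tau c x) = - twist_disp tau c x.
Proof.
by rewrite {1}/twist_disp twist_norm /twist_disp mulNr addrAC rotK.
Qed.

Lemma sqr_bl_le w : bl w e ^+ 2 <= bl w w.
Proof.
have := bl_ge0 (w - bl w e *: e).
rewrite !(blD, blDr, blN, blNr, blZ, blZr, ee) (blC e w).
by nra.
Qed.

(* The twist about [y + 2 e] reflects the hyperplane [bl (_ - y) e = 0] to the far
   side of its centre, away from the unit ball about [y]. *)
Lemma twist_avoids y x : bl (x - y) e = 0 ->
  1 < bl (x + twist_disp 1 (y + 2 *: e) x - y) (x + twist_disp 1 (y + 2 *: e) x - y).
Proof.
move=> xe; set c := y + 2 *: e; set u := x + _; rewrite ltNge; apply/negP => le1.
have unorm : bl (u - c) (u - c) = bl (x - c) (x - c) by exact: twist_norm.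
have uc : u - c = (u - y) - 2 *: e by rewrite /c opprD addrA.
have cs := sqr_bl_le (u - y).
have [w1 w2] : -1 <= bl (u - y) e /\ bl (u - y) e <= 1 by split; nra.
(* A point of the unit ball about [y] is within 3 of the centre, and 9 <= 15: the full half-turn was
   applied, flipping the [e]-coordinate about [c] from -2 to 2. On that ball this coordinate is at
   most -1. *)
have uy9 : bl (u - c) (u - c) <= 9.
  rewrite uc; move: le1 w1 w2; move: (u - y) => w le1 w1 w2.
  rewrite !(blD, blDr, blN, blNr, blZ, blZr, ee) (blC e w); lra.
have xc : bl (x - c) e = - 2.
  by rewrite /c opprD addrA blD blN blZ ee xe; ring.
have : bl (u - c) e = 2.
  rewrite /u addrAC /twist_disp rot_e /angle step1; last by rewrite -unorm; lra.
  by rewrite mulr1 mul1r cospi sinpi xc; ring.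
by rewrite uc blD blN blZ ee; lra.
Qed.

End Form.

(** * Ellipsoidal forms and frames adapted to a hyperplane *)

Section Ellipsoid.
Variables (A Bc : R) (v : 'rV[R]_m).
Hypotheses (A0 : 0 <= A) (B0 : 0 < Bc).

Definition dot x y : R := \sum_i x 0 i * y 0 i.
(** For [A] large against [Bc] its unit ball is thin along [v], which is the shape of a pancake. *)
Definition ell x y : R := A * dot v x * dot v y + Bc * dot x y.

Lemma dotC x y : dot x y = dot y x.
Proof. by apply: eq_bigr => i _; rewrite mulrC. Qed.

Lemma dotDl x y w : dot (x + y) w = dot x w + dot y w.
Proof. by rewrite -big_split /=; apply: eq_bigr => i _; rewrite !mxE mulrDl. Qed.

Lemma dotZl (a : R) x w : dot (a *: x) w = a * dot x w.
Proof. by rewrite mulr_sumr; apply: eq_bigr => i _; rewrite !mxE mulrA. Qed.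

Lemma dotBl x y w : dot (x - y) w = dot x w - dot y w.
Proof. by rewrite dotDl -scaleN1r dotZl mulN1r. Qed.

Lemma dotBr x y w : dot w (x - y) = dot w x - dot w y.
Proof. by rewrite !(dotC w) dotBl. Qed.

Lemma dot_ge0 x : 0 <= dot x x.
Proof. by apply: sumr_ge0 => i _; rewrite -expr2 sqr_ge0. Qed.

Lemma dot_ev x i : dot x (ev R i) = x 0 i.
Proof.
rewrite /dot (bigD1 i) //= big1; first by rewrite !mxE !eqxx mulr1 addr0.
by move=> j ji; rewrite !mxE (negbTE ji) mulr0.
Qed.

Lemma coord_dot x i : x 0 i ^+ 2 <= dot x x.
Proof.
rewrite /dot (bigD1 i) //= -expr2 lerDl; apply: sumr_ge0 => j _.
by rewrite -expr2 sqr_ge0.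
Qed.

Lemma ellD x y w : ell (x + y) w = ell x w + ell y w.
Proof. by rewrite /ell (dotC v (x + y)) !dotDl !(dotC _ v); ring. Qed.

Lemma ellZ (a : R) x w : ell (a *: x) w = a * ell x w.
Proof. by rewrite /ell (dotC v (a *: x)) !dotZl !(dotC _ v); ring. Qed.

Lemma ellC x y : ell x y = ell y x.
Proof. by rewrite /ell (dotC x y); ring. Qed.

Lemma ell_ge0 x : 0 <= ell x x.
Proof.
rewrite /ell; apply: addr_ge0; last by rewrite mulr_ge0 ?dot_ge0 ?ltW.
by rewrite -mulrA mulr_ge0// -expr2 sqr_ge0.
Qed.

Lemma ell_dot x : Bc * dot x x <= ell x x.
Proof. by rewrite /ell lerDr -mulrA mulr_ge0// -expr2 sqr_ge0. Qed.

Lemma ell_slope x : A * dot v x ^+ 2 <= ell x x.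
Proof. by rewrite /ell expr2 mulrA lerDl mulr_ge0 ?dot_ge0// ltW. Qed.

(** [e] is the unit normal, for the form, of the hyperplane where coordinate [l] vanishes, and [b] a
    unit vector inside it; the latter requires a second coordinate [o]. *)
Lemma ell_frame (l o : 'I_m) : o != l ->
  exists e b : 'rV[R]_m, exists mu : R,
    [/\ ell e e = 1, ell b b = 1, ell e b = 0 & forall x, ell x e = mu * x 0 l].
Proof.
move=> ol; have D0 : 0 < Bc + A * dot v v.
  by rewrite ltr_pwDl// mulr_ge0// dot_ge0.
(* The Sherman-Morrison inverse of Bc + A v v^T, applied to Bc times the l-th unit vector. *)
pose e0 := ev R l - (A * v 0 l / (Bc + A * dot v v)) *: v.
have e0E x : ell x e0 = Bc * x 0 l.
  rewrite ellC /e0 -scaleNr ellD ellZ !(ellC _ x) /ell !dot_ev (dotC x v).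
  by field; rewrite gt_eqF.
have n0 : 0 < ell e0 e0.
  rewrite e0E mulr_gt0// /e0 !mxE !eqxx /= subr_gt0 mulrAC ltr_pdivrMr// mul1r.
  rewrite -mulrA -expr2; apply: (@le_lt_trans _ _ (A * dot v v)).
    by rewrite ler_wpM2l// coord_dot.
  by rewrite ltrDr.
have b0 : 0 < ell (ev R o) (ev R o).
  rewrite /ell !dot_ev !mxE !eqxx /= mulr1 ltr_wpDl// -mulrA mulr_ge0// -expr2.
  exact: sqr_ge0.
pose se := Num.sqrt (ell e0 e0); pose sb := Num.sqrt (ell (ev R o) (ev R o)).
have se0 : 0 < se by rewrite sqrtr_gt0.
have sb0 : 0 < sb by rewrite sqrtr_gt0.
have see : se ^+ 2 = ell e0 e0 by rewrite sqr_sqrtr// ltW.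
have sbb : sb ^+ 2 = ell (ev R o) (ev R o) by rewrite sqr_sqrtr// ltW.
exists (se^-1 *: e0), (sb^-1 *: ev R o), (se^-1 * Bc); split.
- rewrite ellZ ellC ellZ -see; field; by rewrite gt_eqF.
- rewrite ellZ ellC ellZ -sbb; field; by rewrite gt_eqF.
- rewrite ellZ ellC ellZ e0E !mxE eqxx /= (negbTE (_ : l != o)) ?mulr0//.
  by rewrite eq_sym.
- by move=> x; rewrite ellC ellZ ellC e0E mulrA.
Qed.

End Ellipsoid.

(** Each support is invariant under its own displacement and no two meet, so at most one summand
    acts at a point, before and after the motion. *)
Lemma glue_displacements (S : finType) (D : S -> R -> 'rV[R]_m -> 'rV[R]_m)
    (E : S -> set 'rV[R]_m) :
  (forall s t x, ~ E s x -> D s t x = 0) ->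
  (forall s t x, E s x -> E s (x + D s t x)) ->
  (forall s t x, D s (- t) (x + D s t x) = - D s t x) ->
  (forall s s' x, E s x -> E s' x -> s = s') ->
  let F t x := x + \sum_s D s t x in
  [/\ forall s t x, E s x -> F t x = x + D s t x,
      forall t x, (forall s, ~ E s x) -> F t x = x &
      forall t x, F (- t) (F t x) = x].
Proof.
move=> D0 DE DK dis F.
have F1 s t x : E s x -> F t x = x + D s t x.
  move=> Es; rewrite /F (bigD1 s) //= big1 ?addr0// => s' ss'; apply: D0 => Es'.
  by move/eqP: ss'; apply; apply: (dis _ _ x).
have F0 t x : (forall s, ~ E s x) -> F t x = x.
  by move=> nE; rewrite /F big1 ?addr0// => s _; apply: D0.
split=> // t x; have [[s Es]|nE] := pselect (exists s, E s x).
  rewrite (F1 s t x Es) (F1 s); last exact: DE.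
  by rewrite DK addrK.
by rewrite (F0 t x) ?F0// => s Es; apply: nE; exists s.
Qed.

Lemma Coo_ell (V : normedModType R) (I : Type) (d : I -> V) (A Bc : R) (v : 'rV[R]_m)
    (X Y : V -> 'rV[R]_m) :
  (forall i, Coo d (fun k => X k 0 i)) -> (forall i, Coo d (fun k => Y k 0 i)) ->
  Coo d (fun k => ell A Bc v (X k) (Y k)).
Proof.
move=> cX cY; rewrite /ell /dot.
apply: Coo_add; last first.
  apply: Coo_mul; first exact: Coo_cst.
  by apply: Coo_sum => i _; exact: Coo_mul.
apply: Coo_mul; first (apply: Coo_mul; first exact: Coo_cst).
  by apply: Coo_sum => i _; apply: Coo_mul => //; exact: Coo_cst.
by apply: Coo_sum => i _; apply: Coo_mul => //; exact: Coo_cst.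
Qed.

Lemma Coo_twist_disp (V : normedModType R) (I : Type) (d : I -> V) (A Bc : R)
    (v e b c : 'rV[R]_m) (tau : V -> R) (X : V -> 'rV[R]_m) i :
  Coo d tau -> (forall i, Coo d (fun k => X k 0 i)) ->
  Coo d (fun k => twist_disp (ell A Bc v) e b (tau k) c (X k) 0 i).
Proof.
move=> ct cX.
have cXc j : Coo d (fun k => (X k - c) 0 j).
  rewrite (_ : (fun k => _) = fun k => X k 0 j - c 0 j); last first.
    by apply/funext => k; rewrite !mxE.
  by apply: Coo_sub => //; exact: Coo_cst.
have cc (u : 'rV[R]_m) j : Coo d (fun _ => u 0 j) by exact: Coo_cst.
have ce : Coo d (fun k => ell A Bc v (X k - c) e) by exact: Coo_ell.
have cb : Coo d (fun k => ell A Bc v (X k - c) b) by exact: Coo_ell.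
pose th k := tau k * angle (ell A Bc v (X k - c) (X k - c)).
have cth : Coo d th.
  apply: Coo_mul => //; apply: Coo_mul; first exact: Coo_cst.
  apply: (@Coo_comp _ _ _ _ (fun k => 16 - ell A Bc v (X k - c) (X k - c)));
    last exact: Coo1_step.
  by apply: Coo_sub; [exact: Coo_cst|exact: Coo_ell].
rewrite (_ : (fun k => _) = fun k => (cos (th k) - 1) *
     (ell A Bc v (X k - c) e * e 0 i + ell A Bc v (X k - c) b * b 0 i) +
  sin (th k) *
     (ell A Bc v (X k - c) e * b 0 i - ell A Bc v (X k - c) b * e 0 i)); last first.
  by apply/funext => k; rewrite /twist_disp /rot_disp !mxE.
apply: Coo_add; apply: Coo_mul.
- by apply: Coo_sub; [exact: Coo_cos|exact: Coo_cst].
- by apply: Coo_add; apply: Coo_mul.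
- exact: Coo_sin.
- by apply: Coo_sub; apply: Coo_mul.
Qed.

End Rotation.

(** * Compactness and principal symbols *)

Section Compactness.
Variables (R : realType) (N : nat).
Implicit Types x y : 'rV[R]_N.

Lemma ball_rV x y (d : R) : 0 < d -> (forall i, `|x 0 i - y 0 i| < d) -> ball x d y.
Proof. by move=> d0 h; split=> // i j; rewrite (ord1 i); exact: h. Qed.

Lemma ball_rV_coord x y (d : R) i : ball x d y -> `|x 0 i - y 0 i| < d.
Proof. by case=> _ /(_ 0 i). Qed.

Lemma norm_rV_lt x (d : R) : 0 < d -> (forall i, `|x 0 i| < d) -> `|x| < d.
Proof.
move=> d0 h; have : ball (0 : 'rV[R]_N) d x.
  by apply: ball_rV => // i; rewrite mxE sub0r normrN.
by rewrite -ball_normE /= sub0r normrN.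
Qed.

Lemma cube_compact : compact (@cube R N).
Proof.
rewrite (_ : @cube R N = [set x | forall i, `[-1, 1]%classic (x 0 i)]).
  by apply: (@rV_compact R N (fun=> `[-1, 1]%classic)) => i; exact: segment_compact.
by apply/seteqP; split=> x h i; have := h i; rewrite /= in_itv.
Qed.

(** Continuity is asked only at points of the cube because the unit normal is controlled only there:
    [nu] may vanish outside. *)
Lemma unif_continuous_cube (f : 'rV[R]_N -> R) (e : R) : 0 < e ->
  (forall x, cube x -> {for x, continuous f}) ->
  exists2 d, 0 < d & forall x y, cube x -> cube y ->
    (forall i, `|x 0 i - y 0 i| < d) -> `|f x - f y| < e.
Proof.
move=> e0 cf.
have e20 : 0 < e / 2 by rewrite divr_gt0.
have := proj1 (compact_near_coveringP _) cube_compact R (0 : R)^'+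
  (fun d x => forall y, (forall i, `|x 0 i - y 0 i| < d) -> `|f x - f y| < e) _.
case=> [x cx|d /= d0 H].
  have := cf x cx => /cvgrPdist_lt /(_ _ e20) /nbhs_ballP [d /= d0 dH].
  have d20 : 0 < d / 2 by rewrite divr_gt0.
  exists (ball x (d / 2), [set t | t < d / 2]) => /=.
    by split; [exact: nbhsx_ballx|exact: nbhs_right_lt].
  case=> x' t /= [bx' td] y xy.
  have h1 : `|f x - f x'| < e / 2.
    by apply: dH; apply: le_ball bx'; lra.
  have h2 : `|f x - f y| < e / 2.
    apply: dH; apply: ball_rV => // i.
    have := ball_rV_coord i bx'; have := xy i.
    have -> : x 0 i - y 0 i = (x 0 i - x' 0 i) + (x' 0 i - y 0 i) by ring.
    by have := ler_normD (x 0 i - x' 0 i) (x' 0 i - y 0 i); lra.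
  have -> : f x' - f y = (f x - f y) - (f x - f x') by ring.
  by have := ler_normB (f x - f y) (f x - f x'); lra.
exists (d / 2); first by rewrite divr_gt0.
move=> x y cx cy; apply: (H (d / 2)) => //=.
- by rewrite sub0r normrN ger0_norm; lra.
- by rewrite divr_gt0.
Qed.

Lemma bounded_on_cube (f : 'rV[R]_N -> R) :
  (forall x, cube x -> {for x, continuous f}) ->
  exists2 K, 0 <= K & forall x, cube x -> `|f x| <= K.
Proof.
move=> cf.
have := proj1 (compact_near_coveringP _) cube_compact R +oo%R
  (fun K x => `|f x| <= K) _.
case=> [x cx|K [Kr H]].
  have := cf x cx => /cvgrPdist_lt /(_ _ ltr01) nf.
  exists ([set y | `|f x - f y| < 1], [set K | `|f x| + 1 <= K]) => /=.
    by split=> //; exact: nbhs_pinfty_ge.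
  case=> y K /= [h1 h2].
  have -> : f y = f x - (f x - f y) by ring.
  by have := ler_normB (f x) (f x - f y); lra.
exists (Num.max 0 (K + 1)); first by rewrite le_max lexx.
by move=> x cx; rewrite le_max (H (K + 1)) ?orbT// ltrDl.
Qed.

(** The part of the cube outside [U] is compact and misses the boundary, so its coordinates stay
    uniformly below 1 in absolute value. *)
Lemma bdry_collar (U : set 'rV[R]_N) : open U -> @bdry R N `<=` U ->
  exists2 eta, 0 < eta < 1 & forall x, cube x ->
    (exists i, 1 - eta <= `|x 0 i|) -> U x.
Proof.
move=> oU bU.
have cK : compact (@cube R N `&` ~` U).
  by apply: compact_closedI; [exact: cube_compact|exact: open_closedC].
have := proj1 (compact_near_coveringP _) cK R (0 : R)^'+
  (fun d x => forall i, `|x 0 i| < 1 - d) _.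
case=> [x [cx nUx]|d /= d0 H].
  have lt1 i : `|x 0 i| < 1.
    rewrite lt_neqAle; apply/andP; split; last by rewrite ler_norml cx.
    by apply/eqP => x1; apply: nUx; apply: bU; split=> //; exists i.
  have nr (i : 'I_N) : filter_prod (nbhs (x : 'rV[R]_N)) (0 : R)^'+
      [set z : 'rV[R]_N * R | `|z.1 0 i| < 1 - z.2].
    pose d := (1 - `|x 0 i|) / 2.
    have d0 : 0 < d by rewrite divr_gt0// subr_gt0.
    exists (ball x d, [set t | t < d]) => /=.
      by split; [exact: nbhsx_ballx|exact: nbhs_right_lt].
    case=> y t /= [by_ td]; have hb := ball_rV_coord i by_.
    have E : `|y 0 i| <= `|x 0 i| + `|x 0 i - y 0 i|.
      apply: le_trans (ler_normB _ _).
      by rewrite (_ : x 0 i - (x 0 i - y 0 i) = y 0 i)//; ring.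
    have d2 : d * 2 = 1 - `|x 0 i| by rewrite divfK.
    by lra.
  by apply: filterS (filter_forall (filter_prod_filter _ _) nr) => -[y t].
pose eta := Num.min (d / 2) (1 / 2).
have d20 : 0 < d / 2 by rewrite divr_gt0.
have eta0 : 0 < eta by rewrite lt_min d20; lra.
have etad : eta <= d / 2 by rewrite ge_min lexx.
have eta1 : eta < 1 by rewrite (@le_lt_trans _ _ (1/2)) ?ge_min ?lexx ?orbT//; lra.
exists eta; first by rewrite eta0.
move=> x cx [i xi]; apply: contrapT => nU.
have : `|x 0 i| < 1 - eta.
  apply: (H eta) => //=; rewrite sub0r normrN gtr0_norm//; lra.
by lra.
Qed.

End Compactness.

(** * Symmetric tensors of rank one *)

Section RankOne.
Variables (R : realType) (m : nat).
Implicit Types (a b : mindex m) (T : mindex m -> R).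

Definition mrep (i : 'I_m) k : mindex m := [ffun j => (if j == i then k else 0)%N].

Lemma mincr_mlist a : foldr (fun i b => mincr b i) [ffun=> 0%N] (mlist a) = a.
Proof.
have H (s : seq 'I_m) b k : foldr (fun i b => mincr b i) b s k = (b k + count_mem k s)%N.
  elim: s => [|i s IHs]; first by rewrite addn0.
  by rewrite /= ffunE IHs -addnA; congr (_ + _)%N; rewrite addnC eq_sym.
apply/ffunP => k; rewrite H ffunE add0n /mlist count_flatten -map_comp sumnE big_map.
rewrite big_enum /= (bigD1 k) //= big1 ?addn0.
  by rewrite count_nseq /= eqxx mul1n.
by move=> j jk; rewrite count_nseq /= (negbTE jk).
Qed.

(** The hypothesis makes every slot of the symmetric tensor [T] parallel to [v], so [T] is a
    multiple of the r-th power of [v]. Trading indices one by one for [i0] identifies the multiple,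
    stated here without division. *)
Lemma rank_one T (v : 'I_m -> R) r i0 :
  (forall a i j, (mlen a).+1 = r -> T (mincr a i) * v j = T (mincr a j) * v i) ->
  forall a, mlen a = r -> T a * v i0 ^+ r = T (mrep i0 r) * \prod_i v i ^+ a i.
Proof.
move=> sym.
have mc a i j : mincr (mincr a i) j = mincr (mincr a j) i.
  by apply/ffunP => k; rewrite !ffunE addnAC.
have S (s : seq 'I_m) k : mincr (foldr (fun i b => mincr b i) (mrep i0 k) s) i0 =
    foldr (fun i b => mincr b i) (mrep i0 k.+1) s.
  elim: s => [|i s IHs] /=; last by rewrite mc IHs.
  by apply/ffunP => j; rewrite !ffunE; case: eqP => _; rewrite ?addn1 ?addn0.
have L (s : seq 'I_m) k : mlen (foldr (fun i b => mincr b i) (mrep i0 k) s) = (size s + k)%N.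
  elim: s => [|i s IHs] /=; last by rewrite mlen_mincr IHs.
  rewrite /mlen (bigD1 i0) //= ffunE eqxx big1 ?addn0// => j /negbTE ji.
  by rewrite ffunE ji.
have H (s : seq 'I_m) k : (size s + k)%N = r ->
    T (foldr (fun i b => mincr b i) (mrep i0 k) s) * v i0 ^+ size s =
    T (mrep i0 r) * \prod_(i <- s) v i.
  elim: s k => [|i s IHs] k /=; first by move=> <-; rewrite big_nil !mulr1.
  rewrite addSn => E; rewrite exprS mulrA sym; last by rewrite L.
  by rewrite S mulrAC IHs ?addnS// big_cons; ring.
move=> a ar; have := H (mlist a) 0%N; rewrite size_mlist addn0 => /(_ ar).
have -> : mrep i0 0 = [ffun=> 0%N] by apply/ffunP => j; rewrite !ffunE if_same.
by rewrite mincr_mlist ar prod_mlist.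
Qed.

Lemma hyperplane_parallel (F n : 'rV[R]_m) :
  (forall w : 'rV[R]_m, \sum_i w 0 i ^+ 2 = 1 -> \sum_i w 0 i * n 0 i = 0 ->
     \sum_i w 0 i * F 0 i = 0) ->
  forall i j, F 0 i * n 0 j = F 0 j * n 0 i.
Proof.
move=> H i j; have [->//|ij] := eqVneq i j.
have [z|nz] := eqVneq (n 0 i ^+ 2 + n 0 j ^+ 2) 0.
  have : n 0 i = 0 /\ n 0 j = 0.
    have := sqr_ge0 (n 0 i); have := sqr_ge0 (n 0 j) => h1 h2.
    by split; apply/eqP; rewrite -sqrf_eq0; apply/eqP; lra.
  by case=> -> ->; rewrite !mulr0.
have s0 : 0 < n 0 i ^+ 2 + n 0 j ^+ 2.
  by rewrite lt_neqAle eq_sym nz /= addr_ge0 ?sqr_ge0.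
pose s := Num.sqrt (n 0 i ^+ 2 + n 0 j ^+ 2).
have sp : 0 < s by rewrite sqrtr_gt0.
have s2 : s ^+ 2 = n 0 i ^+ 2 + n 0 j ^+ 2 by rewrite sqr_sqrtr// ltW.
(* The normalised tangent vector n_j e_i - n_i e_j; its pairing with [F] is, up to scale, the
   required 2 by 2 minor. *)
pose w : 'rV[R]_m := s^-1 *: (n 0 j *: ev R i - n 0 i *: ev R j).
have dw (x : 'rV[R]_m) : dot w x = s^-1 * (n 0 j * x 0 i - n 0 i * x 0 j).
  by rewrite /w dotZl -scaleNr dotDl !dotZl !(dotC (ev R _)) !dot_ev; ring.
have w1 : \sum_k w 0 k ^+ 2 = 1.
  transitivity (dot w w); first by apply: eq_bigr => k _; rewrite expr2.
  rewrite dw !mxE !eqxx /= (negbTE ij) eq_sym (negbTE ij) /=.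
  rewrite !mulr1n !mulr0n.
  transitivity (s^-1 * s^-1 * (n 0 i ^+ 2 + n 0 j ^+ 2)); first by ring.
  by rewrite -s2; field; rewrite gt_eqF.
have w0 : \sum_k w 0 k * n 0 k = 0 by rewrite -/(dot w n) dw; ring.
have := H w w1 w0; rewrite -/(dot w F) dw => /eqP.
by rewrite mulf_eq0 invr_eq0 gt_eqF//= subr_eq0 => /eqP E; rewrite mulrC E mulrC.
Qed.

(** Otherwise m v_i^2 <= m |v_i| < 1 for all i, and the squares would sum to less than 1. This gives
    a coordinate to divide by with a uniform bound. *)
Lemma unit_coord (v : 'rV[R]_m) : dot v v = 1 -> exists i, 1 <= m%:R * `|v 0 i|.
Proof.
move=> v1; apply: contrapT => nex.
have lt i : m%:R * `|v 0 i| < 1 by rewrite ltNge; apply/negP => h; apply: nex; exists i.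
have m0 : (0 < m)%N.
  case: m v v1 {nex lt} => // v; rewrite /dot big_ord0 => /eqP.
  by rewrite eq_sym oner_eq0.
have v1i i : `|v 0 i| <= 1.
  rewrite -(@ler_pXn2r _ 2) ?nnegrE// expr1n -normrX ger0_norm ?sqr_ge0// -v1.
  exact: coord_dot.
have : \sum_(i < m) m%:R * (v 0 i * v 0 i) < \sum_(i < m) (1 : R).
  apply: ltr_sum.
    by apply/hasP; exists (Ordinal m0) => //; rewrite mem_index_enum.
  move=> i _; apply: le_lt_trans (lt i); rewrite ler_wpM2l// -expr2
    -[_ ^+ 2]ger0_norm ?sqr_ge0// normrX.
  by rewrite expr2 ler_piMr.
by rewrite -mulr_sumr -/(dot v v) v1 sumr_const card_ord mulr1 ltxx.
Qed.

End RankOne.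

(** * Clearing the pancakes *)

Section Clearing.
Variables (R : realType) (q m : nat) (M P : nat).
Hypotheses (M0 : (0 < M)%N) (P0 : (0 < P)%N).

Definition node := {ffun 'I_(q + m) -> 'I_(P.*2.+1)}.

Definition cz (p : node) (i : 'I_q) : R := (p (lshift m i))%:R - P%:R.
Definition cx (p : node) (i : 'I_m) : R := (p (rshift q i))%:R - P%:R.
Definition xnode (p : node) : 'rV[R]_m := \row_i (cx p i / P%:R).
Definition znode (p : node) : 'rV[R]_q := \row_i (cz p i / P%:R).

Definition freq : R := (M * P)%:R.

(** If boxes of radius 18 m about two nodes share a point, their indices differ by at most 36 m. *)
Definition reach : nat := (36 * m)%N.
Definition near_node (p p' : node) : bool :=
  [forall i, (p i <= p' i + reach)%N && (p' i <= p i + reach)%N].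
Definition max_degree : nat := (reach.*2.+1 ^ (q + m))%N.
(** Chosen so that 39 [kappa] meets the condition of [greedy_phases]: 39 * 2 / 80 < 1. It depends on
    [q] and [m] alone. *)
Definition kappa : R := (80 * max_degree.+2%:R)^-1.

Definition zbox (d : R) (p : node) (z : 'rV[R]_q) : Prop :=
  forall i, `|P%:R * z 0 i - cz p i| <= d.
Definition xbox (d : R) (p : node) (x : 'rV[R]_m) : Prop :=
  forall i, `|P%:R * x 0 i - cx p i| <= d.

Variables (v : node -> 'rV[R]_m) (act : pred node).
Hypothesis v1 : forall p, dot (v p) (v p) = 1.

Definition offset (p : node) (theta : node -> R) : R :=
  freq * dot (v p) (xnode p) + theta p.

Definition uphase (theta : node -> R) (p : node) : 'rV[R]_m -> R :=
  phase freq (offset p theta) (fun i => v p 0 i).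

Definition bad (theta : node -> R) (z : 'rV[R]_q) (x : 'rV[R]_m) : Prop :=
  exists p, [/\ act p, zbox 1 p z, xbox 1 p x &
    exists j : int, `|uphase theta p x - j%:~R| <= kappa].

Let P0R : (0 : R) < P%:R. Proof. by rewrite ltr0n. Qed.
Let M0R : (0 : R) < M%:R. Proof. by rewrite ltr0n. Qed.

Lemma freq_gt0 : 0 < freq.
Proof. by rewrite /freq ltr0n muln_gt0 M0. Qed.

Lemma kappa_gt0 : 0 < kappa.
Proof. by rewrite invr_gt0 mulr_gt0// ltr0n. Qed.

Lemma kappa_small : 39 * kappa * (2 * max_degree.+2%:R) < 1.
Proof.
rewrite /kappa; have n0 : (0 : R) < max_degree.+2%:R by rewrite ltr0n.
have -> : 39 * (80 * max_degree.+2%:R)^-1 * (2 * max_degree.+2%:R) = 78 / 80 :> R.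
  by field; rewrite gt_eqF.
lra.
Qed.

Lemma kappa_lt : kappa < 1 / 80.
Proof.
rewrite /kappa div1r ltf_pV2 ?posrE ?mulr_gt0 ?ltr0n// ltr_pMr ?ltr0n//.
by rewrite ltr1n.
Qed.

Lemma uphaseE theta p x : uphase theta p x = freq * dot (v p) (x - xnode p) - theta p.
Proof.
rewrite /uphase /phase /offset dotBr.
have -> : \sum_j freq * v p 0 j * x 0 j = freq * dot (v p) x.
  by rewrite /dot mulr_sumr; apply: eq_bigr => j _; rewrite mulrA.
ring.
Qed.

Lemma uphaseB theta p x y : uphase theta p x - uphase theta p y = freq * dot (v p) (x - y).
Proof.
rewrite !uphaseE; have -> : x - xnode p = (x - y) + (y - xnode p) by rewrite addrA subrK.
by rewrite (dotC (v p)) dotDl !(dotC _ (v p)); ring.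
Qed.

Lemma coord_v p i : `|v p 0 i| <= 1.
Proof.
rewrite -(@ler_pXn2r _ 2) ?nnegrE// expr1n -normrX ger0_norm ?sqr_ge0// -(v1 p).
exact: coord_dot.
Qed.

Lemma dot_le (a b : R) (x y : 'rV[R]_m) : 0 <= a -> 0 <= b ->
  (forall i, `|x 0 i| <= a) -> (forall i, `|y 0 i| <= b) -> `|dot x y| <= m%:R * (a * b).
Proof.
move=> a0 b0 xa yb; apply: le_trans (ler_norm_sum _ _ _) _.
rewrite mulr_natl -[X in _ *+ X]card_ord -sumr_const.
by apply: ler_sum => i _; rewrite normrM; apply: ler_pM.
Qed.

Lemma xbox_coord d p x i : xbox d p x -> `|x 0 i - xnode p 0 i| <= d / P%:R.
Proof.
move=> /(_ i); rewrite mxE ler_pdivlMr// => h.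
rewrite -[X in _ * X]gtr0_norm// -normrM.
by rewrite (_ : (x 0 i - cx p i / P%:R) * P%:R = P%:R * x 0 i - cx p i)//;
  field; rewrite gt_eqF.
Qed.

(** On the unit box of a node the phase is at most m M + 1 in absolute value; one more unit
    accommodates the integer within [kappa] of it. So finitely many levels index all pancakes. *)
Definition layer_range : nat := (m * M).+2.
Definition pancake := (node * 'I_(layer_range.*2.+1))%type.
Definition level (s : pancake) : int := s.2%:Z - layer_range%:Z.

Lemma uphase_bound theta p x : (forall p, 0 <= theta p <= 1) -> xbox 1 p x ->
  `|uphase theta p x| <= (m * M)%:R + 1.
Proof.
move=> theta01 xp; rewrite uphaseE; apply: le_trans (ler_normB _ _) _; apply: lerD; last first.
  by have := theta01 p; rewrite ler_norml; lra.
rewrite normrM gtr0_norm ?freq_gt0//.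
have D : `|dot (v p) (x - xnode p)| <= m%:R * (1 * (1 / P%:R)).
  apply: dot_le => //; first exact: coord_v.
  by move=> i; have := xbox_coord i xp; rewrite !mxE.
apply: le_trans (ler_wpM2l (ltW freq_gt0) D) _.
rewrite /freq !natrM le_eqVlt; apply/orP; left; apply/eqP.
by field; rewrite gt_eqF.
Qed.

Lemma level_exists theta p x (j : int) : (forall p, 0 <= theta p <= 1) -> xbox 1 p x ->
  `|uphase theta p x - j%:~R| <= kappa ->
  exists s : pancake, s.1 = p /\ level s = j.
Proof.
move=> theta01 xp uj; have up := uphase_bound theta01 xp.
have jb : `|j%:~R| < ((m * M).+2%:R : R).
  have -> : j%:~R = uphase theta p x - (uphase theta p x - j%:~R) :> R by ring.
  apply: le_lt_trans (ler_normB _ _) _.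
  by rewrite -[_.+2]addn2 natrD; have := kappa_lt; lra.
rewrite -intr_norm -/layer_range pmulrn ltr_int in jb.
have jlt : (absz (j + layer_range%:Z)%R < layer_range.*2.+1)%N by rewrite -muln2; lia.
exists (p, Ordinal jlt); split=> //; rewrite /level /=; lia.
Qed.

Variable l : 'I_m.

Let m0R : (1 : R) <= m%:R. Proof. by rewrite ler1n; case: m l => // -[]. Qed.

Lemma near_of_box p p' z x : zbox 2 p z -> zbox 2 p' z ->
  xbox (18 * m%:R) p x -> xbox (18 * m%:R) p' x -> near_node p p'.
Proof.
move=> zp zp' xp xp'; apply/forallP => i.
suff : `|(p i)%:R - (p' i)%:R| <= (reach%:R : R).
  rewrite ler_norml => /andP[h1 h2].
  rewrite -!(ler_nat R) (natrD _ (p' i) reach) (natrD _ (p i) reach).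
  by apply/andP; split; lra.
rewrite /reach natrM -(splitK i); case: (fintype.split i) => k /=.
  have := zp k; have := zp' k; rewrite /cz => h1 h2.
  have -> : (p (lshift m k))%:R - (p' (lshift m k))%:R =
    (P%:R * z 0 k - ((p' (lshift m k))%:R - P%:R)) -
    (P%:R * z 0 k - ((p (lshift m k))%:R - P%:R)) :> R by ring.
  by apply: le_trans (ler_normB _ _) _; have := m0R; lra.
have := xp k; have := xp' k; rewrite /cx => h1 h2.
have -> : (p (rshift q k))%:R - (p' (rshift q k))%:R =
  (P%:R * x 0 k - ((p' (rshift q k))%:R - P%:R)) -
  (P%:R * x 0 k - ((p (rshift q k))%:R - P%:R)) :> R by ring.
by apply: le_trans (ler_normB _ _) _; lra.
Qed.

(** With equal normals, the phase of [p'] minus that of [p] would be the constant theta p - theta p'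
    - [shiftK p p']. *)
Definition shiftK (p p' : node) : R := freq * dot (v p') (xnode p' - xnode p).

Lemma near_sym : symmetric near_node.
Proof. by move=> p p'; apply: eq_forallb => i; rewrite andbC. Qed.

(** The condition at the origin serves m = 1: there is then no plane to rotate in, the hyperplane is
    the point 0, and the phases themselves must keep it clear. *)
Lemma good_phases : exists theta : node -> R,
  [/\ forall p, 0 <= theta p <= 1,
      forall p (j : int), kappa < `|uphase theta p 0 - j%:~R| &
      forall p p', near_node p p' -> p != p' ->
        far (39 * kappa) (theta p - theta p' - shiftK p p') \/
        far (39 * kappa) (theta p' - theta p - shiftK p' p)].
Proof.
have k0 := kappa_gt0.
have [||||theta [h1 h2 h3]] := @greedy_phases R node near_node shiftK
  (fun p => - (freq * dot (v p) (xnode p))) max_degree (39 * kappa).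
- move=> p; have := @card_near_lattice 'I_(q + m) P.*2.+1 reach p.
  by rewrite card_ord; apply: leq_trans; apply: eq_leq; exact: eq_card.
- exact: near_sym.
- lra.
- exact: kappa_small.
exists theta; split=> // p j; have := h2 p (- j); rewrite uphaseE sub0r.
have d0 : dot (v p) 0 = 0 by rewrite /dot big1// => i _; rewrite mxE mulr0.
rewrite -[- xnode p]sub0r dotBr d0 rmorphN /= => h.
apply: (@le_lt_trans _ _ (39 * kappa)); first lra.
apply: lt_le_trans h _; rewrite -normrN le_eqVlt; apply/orP; left; apply/eqP.
by congr (`|_|); ring.
Qed.

Variable omega : R.
Hypotheses (v_near : forall p p', near_node p p' -> forall i, `|v p 0 i - v p' 0 i| <= omega)
  (omega_small : 18 * m%:R ^+ 2 * M%:R * omega <= kappa).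

(* Neighbouring layers are nearly parallel, so up to [37 * kappa] the two phases
   differ by the constant that the choice of [theta] controls. *)
Lemma layers_disjoint theta p p' x (j j' : int) :
  near_node p p' -> xbox (18 * m%:R) p x ->
  `|uphase theta p x - j%:~R| <= 18 * kappa -> `|uphase theta p' x - j'%:~R| <= 18 * kappa ->
  ~ far (39 * kappa) (theta p - theta p' - shiftK p p').
Proof.
move=> np xp h h' /(_ (j' - j)); apply/negP; rewrite -leNgt.
have k0 := kappa_gt0.
have w0 : 0 <= omega.
  by apply: le_trans (v_near np l).
(* Frequency M P times m * omega * 18 m / P is the left side of [omega_small]. *)
have drift : `|freq * dot (v p - v p') (x - xnode p)| <= kappa.
  rewrite normrM gtr0_norm ?freq_gt0//.
  apply: le_trans omega_small.
  have D : `|dot (v p - v p') (x - xnode p)| <= m%:R * (omega * (18 * m%:R / P%:R)).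
    apply: dot_le => //.
    - by move=> i; rewrite !mxE; exact: v_near.
    - by move=> i; have := xbox_coord i xp; rewrite !mxE.
  apply: le_trans (ler_wpM2l (ltW freq_gt0) D) _.
  rewrite /freq natrM le_eqVlt; apply/orP; left; apply/eqP.
  by field; rewrite gt_eqF.
rewrite !uphaseE in h h'.
have E : theta p - theta p' - shiftK p p' - (j' - j)%:~R =
    freq * dot (v p - v p') (x - xnode p)
    - (freq * dot (v p) (x - xnode p) - theta p - j%:~R)
    + (freq * dot (v p') (x - xnode p') - theta p' - j'%:~R).
  rewrite /shiftK rmorphB /=.
  have -> : x - xnode p' = (x - xnode p) - (xnode p' - xnode p).
    by rewrite opprB addrA subrK.
  by rewrite dotBl (dotBr (x - xnode p)); ring.
rewrite E; apply: le_trans (ler_normD _ _) _.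
by have := ler_normB (freq * dot (v p - v p') (x - xnode p))
  (freq * dot (v p) (x - xnode p) - theta p - j%:~R); lra.
Qed.

(** * Pancakes, the zones of their twists, and the resulting flow *)

Section Twists.
Variable theta : node -> R.
Hypotheses (theta01 : forall p, 0 <= theta p <= 1)
  (theta_far : forall p p', near_node p p' -> p != p' ->
     far (39 * kappa) (theta p - theta p' - shiftK p p') \/
     far (39 * kappa) (theta p' - theta p - shiftK p' p)).

(** For distinct nodes this is the choice of phases; for a single node, two levels would be at
    distance at most 36 [kappa] < 1. *)
Lemma layer_unique z x p p' (j j' : int) : zbox 2 p z -> zbox 2 p' z ->
  xbox (18 * m%:R) p x -> xbox (18 * m%:R) p' x ->
  `|uphase theta p x - j%:~R| <= 18 * kappa -> `|uphase theta p' x - j'%:~R| <= 18 * kappa ->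
  p = p' /\ j = j'.
Proof.
move=> zp zp' xp xp' hj hj'.
have np := near_of_box zp zp' xp xp'.
have [E|pp'] := eqVneq p p'; last first.
  case: (theta_far np pp') => f.
    by case: (layers_disjoint np xp hj hj' f).
  by rewrite near_sym in np; case: (layers_disjoint np xp' hj' hj f).
split=> //; rewrite -E in hj'.
have : `|(j - j')%:~R| < (1 : R).
  rewrite rmorphB /=.
  have -> : j%:~R - j'%:~R = (uphase theta p x - j'%:~R) - (uphase theta p x - j%:~R) :> R by ring.
  by apply: le_lt_trans (ler_normB _ _) _; have := kappa_lt; lra.
rewrite -intr_norm -[1]/(1%:~R) ltr_int; lia.
Qed.

(** Between two points of a pancake the phase varies by at most 2 [kappa] and each P x_i by at most
    2. The slopes make either term of the form at most 1/2, so the pancake lies in the unit ball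
    about each of its points. *)
Definition slopeA : R := freq ^+ 2 / (8 * kappa ^+ 2).
Definition slopeB : R := P%:R ^+ 2 / (8 * m%:R).
Definition form (p : node) := ell slopeA slopeB (v p).

Let m0 : (0 : R) < m%:R. Proof. by apply: lt_le_trans m0R. Qed.

Lemma slopeA_ge0 : 0 <= slopeA.
Proof.
apply: divr_ge0; first exact: sqr_ge0.
by apply: mulr_ge0; [exact: ler0n|exact: sqr_ge0].
Qed.

Lemma slopeB_gt0 : 0 < slopeB.
Proof. by rewrite /slopeB divr_gt0 ?exprn_gt0 ?mulr_gt0. Qed.

Lemma xbox_sub p x y i : xbox 1 p x -> xbox 1 p y -> `|P%:R * (x - y) 0 i| <= 2.
Proof.
move=> /(_ i) hx /(_ i) hy; rewrite !mxE.
have -> : P%:R * (x 0 i - y 0 i) = (P%:R * x 0 i - cx p i) - (P%:R * y 0 i - cx p i).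
  by ring.
by apply: le_trans (ler_normB _ _) _; lra.
Qed.

Lemma sqr_bound (a b c : R) : 0 <= c -> a ^+ 2 <= b -> b <= c ^+ 2 -> `|a| <= c.
Proof.
move=> c0 h1 h2; rewrite -(@ler_pXn2r _ 2) ?nnegrE// -normrX ger0_norm ?sqr_ge0//.
exact: le_trans h1 h2.
Qed.

Lemma sqr_le (a c : R) : `|a| <= c -> a ^+ 2 <= c ^+ 2.
Proof.
move=> h; rewrite -[a ^+ 2]ger0_norm ?sqr_ge0// normrX.
by rewrite lerXn2r ?nnegrE// (le_trans (normr_ge0 _) h).
Qed.

Lemma pancake_unit p x y (j : int) : xbox 1 p x -> xbox 1 p y ->
  `|uphase theta p x - j%:~R| <= kappa -> `|uphase theta p y - j%:~R| <= kappa ->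
  form p (x - y) (x - y) <= 1.
Proof.
move=> hx hy ux uy; rewrite /form /ell.
have k0 := kappa_gt0.
have h1 : slopeA * dot (v p) (x - y) * dot (v p) (x - y) <= 1 / 2.
  have d : `|freq * dot (v p) (x - y)| <= 2 * kappa.
    rewrite -(uphaseB theta).
    have -> : uphase theta p x - uphase theta p y =
      (uphase theta p x - j%:~R) - (uphase theta p y - j%:~R) by ring.
    by apply: le_trans (ler_normB _ _) _; lra.
  have -> : slopeA * dot (v p) (x - y) * dot (v p) (x - y) =
      (freq * dot (v p) (x - y)) ^+ 2 / (8 * kappa ^+ 2).
    by rewrite /slopeA; field; rewrite gt_eqF.
  rewrite ler_pdivrMr ?mulr_gt0 ?exprn_gt0//.
  by apply: le_trans (sqr_le d) _; rewrite exprMn; lra.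
have h2 : slopeB * dot (x - y) (x - y) <= 1 / 2.
  have -> : slopeB * dot (x - y) (x - y) =
      (\sum_i (P%:R * (x - y) 0 i) ^+ 2) / (8 * m%:R).
    rewrite /slopeB /dot mulr_sumr mulr_suml; apply: eq_bigr => i _.
    by rewrite exprMn; ring.
  rewrite ler_pdivrMr ?mulr_gt0//.
  apply: (@le_trans _ _ (\sum_(i < m) 4)); last by rewrite sumr_const card_ord -mulr_natr; lra.
  by apply: ler_sum => i _; have := sqr_le (xbox_sub i hx hy); lra.
lra.
Qed.

Lemma form_coord p w (c : R) i : form p w w <= c -> (P%:R * w 0 i) ^+ 2 <= c * (8 * m%:R).
Proof.
move=> h; have h2 := ell_dot slopeB (v p) slopeA_ge0 w; have h1 := coord_dot w i.
have h3 : slopeB * w 0 i ^+ 2 <= c.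
  apply: le_trans h; apply: le_trans h2; rewrite ler_wpM2l// ltW//; exact: slopeB_gt0.
have -> : (P%:R * w 0 i) ^+ 2 = slopeB * w 0 i ^+ 2 * (8 * m%:R).
  by rewrite /slopeB exprMn; field; rewrite gt_eqF.
by rewrite ler_wpM2r// mulr_ge0// ltW.
Qed.

(** Both bounds rest on 36 * 8 = 288 < 17^2. *)
Lemma form_size p w : form p w w <= 36 ->
  `|freq * dot (v p) w| <= 17 * kappa /\ forall i, `|P%:R * w 0 i| <= 17 * m%:R.
Proof.
move=> h; have k0 := kappa_gt0; split.
  apply: (@sqr_bound _ (288 * kappa ^+ 2)); first lra.
    have h1 := ell_slope slopeA (v p) slopeB_gt0 w.
    have -> : (freq * dot (v p) w) ^+ 2 = slopeA * dot (v p) w ^+ 2 * (8 * kappa ^+ 2).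
      by rewrite /slopeA exprMn; field; rewrite gt_eqF.
    have -> : 288 * kappa ^+ 2 = 36 * (8 * kappa ^+ 2) by ring.
    apply: ler_wpM2r; first by rewrite mulr_ge0 ?sqr_ge0.
    exact: le_trans h1 h.
  by rewrite exprMn; have := sqr_ge0 kappa; lra.
have m1 := m0R; move=> i; apply: (sqr_bound _ (form_coord i h)); first lra.
rewrite exprMn expr2; have : m%:R <= m%:R ^+ 2 :> R by rewrite expr2 ler_peMl// ltW.
lra.
Qed.

(** Radius 4 about the centre of a twist is within radius 4 + 2 of the point from which that centre
    was displaced. *)
Lemma form_recenter p w e : form p e e = 1 -> form p w w < 16 ->
  form p (w + 2 *: e) (w + 2 *: e) <= 36.
Proof.
move=> e1 w16.
have blC x y : form p x y = form p y x by exact: ellC.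
have S := @sqr_bl_le R m (form p) e (@ellD _ _ _ _ _) (@ellZ _ _ _ _ _) blC
  (fun x => ell_ge0 (v p) slopeA_ge0 slopeB_gt0 x) e1 w.
have h : `|form p w e| <= 4 by apply: (sqr_bound _ S); lra.
have E : form p (w + 2 *: e) (w + 2 *: e) = form p w w + 4 * form p w e + 4.
  rewrite /form ellD ellZ (ellC _ _ _ w) (ellC _ _ _ e) !ellD !ellZ -/(form p e e) e1.
  by rewrite (ellC _ _ _ e w); ring.
by rewrite E; move: h; rewrite ler_norml => /andP[? ?]; lra.
Qed.

Section Frames.
Variables (e b : node -> 'rV[R]_m) (mu : node -> R).
Hypotheses (ee : forall p, form p (e p) (e p) = 1) (bb : forall p, form p (b p) (b p) = 1)
  (eb : forall p, form p (e p) (b p) = 0)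
  (el : forall p x, form p x (e p) = mu p * x 0 l).

Definition crossing (s : pancake) : set 'rV[R]_m :=
  [set y : 'rV[R]_m | [/\ y 0 l = 0, xbox 1 s.1 y &
    `|uphase theta s.1 y - (level s)%:~R| <= kappa]].
(** A pancake that misses the hyperplane is left untwisted: having no crossing, it has no point to
    place the half-turn beside. *)
Definition live (s : pancake) : Prop := act s.1 /\ exists y, crossing s y.
Definition spot (s : pancake) : 'rV[R]_m := xget 0 (crossing s).
Definition centre (s : pancake) : 'rV[R]_m := spot s + 2 *: e s.1.

(** In z each factor is 1 up to distance 1 and 0 from distance 2 on; squaring instead of taking
    absolute values keeps it smooth. *)
Definition cutoff (p : node) (z : 'rV[R]_q) : R :=
  \prod_i step ((4 - (P%:R * z 0 i - cz p i) ^+ 2) / 3).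

Definition push (z : 'rV[R]_q) (s : pancake) (t : R) (x : 'rV[R]_m) : 'rV[R]_m :=
  if `[< live s >] then
    twist_disp (form s.1) (e s.1) (b s.1) (t * cutoff s.1 z) (centre s) x
  else 0.

Definition zone (z : 'rV[R]_q) (s : pancake) : set 'rV[R]_m :=
  [set x | [/\ live s, zbox 2 s.1 z & form s.1 (x - centre s) (x - centre s) < 16]].

Lemma spotP s : live s -> crossing s (spot s).
Proof. by case=> _; exact: xgetPex. Qed.

Lemma cutoff1 p z : zbox 1 p z -> cutoff p z = 1.
Proof.
move=> zp; rewrite /cutoff big1// => i _; apply: step1.
rewrite ler_pdivlMr// mul1r.
by have := sqr_le (zp i); rewrite expr1n; lra.
Qed.

Lemma cutoff0 p z : ~ zbox 2 p z -> cutoff p z = 0.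
Proof.
move=> nz; have [i Hi] : exists i, 2 < `|P%:R * z 0 i - cz p i|.
  apply: contrapT => nex; apply: nz => i; rewrite leNgt; apply/negP => h.
  by apply: nex; exists i.
rewrite /cutoff (bigD1 i) //= step0 ?mul0r// pmulr_lle0 ?invr_gt0//.
suff : 2 ^+ 2 < (P%:R * z 0 i - cz p i) ^+ 2 by lra.
rewrite ltNge; apply/negP => h; move: Hi; apply/negP; rewrite -leNgt.
exact: (sqr_bound _ h).
Qed.

Let fD p := @ellD _ _ slopeA slopeB (v p).
Let fZ p := @ellZ _ _ slopeA slopeB (v p).
Let fC p := @ellC _ _ slopeA slopeB (v p).
Let f0 p := ell_ge0 (v p) slopeA_ge0 slopeB_gt0.

Lemma push_out z s t x : ~ zone z s x -> push z s t x = 0.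
Proof.
move=> nz; rewrite /push; case: asboolP => // ls.
have [zp|nzp] := pselect (zbox 2 s.1 z); last first.
  by rewrite cutoff0// mulr0 twist_disp_t0.
apply: twist_disp0; rewrite leNgt; apply/negP => h; exact: nz.
Qed.

Lemma push_in z s t x : zone z s x -> zone z s (x + push z s t x).
Proof.
move=> [ls zp h]; split=> //; rewrite /push; case: asboolP => // _.
by rewrite twist_norm//; [exact: fD|exact: fZ|exact: fC].
Qed.

Lemma pushK z s t x : push z s (- t) (x + push z s t x) = - push z s t x.
Proof.
rewrite /push; case: asboolP => [ls|_]; last by rewrite oppr0.
by rewrite mulNr twistK//; [exact: fD|exact: fZ|exact: fC].
Qed.

(** The 17 of [form_size], plus 1 for the position of the spot in its own pancake, gives 18. *)
Lemma zone_layer z s x : zone z s x ->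
  xbox (18 * m%:R) s.1 x /\ `|uphase theta s.1 x - (level s)%:~R| <= 18 * kappa.
Proof.
move=> [ls zp h]; have [yl yb yu] := spotP ls.
have xy : x - spot s = (x - centre s) + 2 *: e s.1.
  by rewrite /centre opprD addrA subrK.
have [d1 d2] : _ /\ _ := form_size (form_recenter (ee s.1) h).
rewrite -xy in d1 d2; split.
  move=> i; have := yb i; have := d2 i; rewrite !mxE => h1 h2.
  have -> : P%:R * x 0 i - cx s.1 i =
    P%:R * (x 0 i - spot s 0 i) + (P%:R * spot s 0 i - cx s.1 i) by ring.
  by apply: le_trans (ler_normD _ _) _; have := m0R; lra.
rewrite -(uphaseB theta) in d1.
have -> : uphase theta s.1 x - (level s)%:~R =
  (uphase theta s.1 x - uphase theta s.1 (spot s)) +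
  (uphase theta s.1 (spot s) - (level s)%:~R) by ring.
by apply: le_trans (ler_normD _ _) _; lra.
Qed.

Lemma zone_unique z s p x (j : int) : zone z s x -> zbox 2 p z -> xbox (18 * m%:R) p x ->
  `|uphase theta p x - j%:~R| <= 18 * kappa -> s.1 = p /\ level s = j.
Proof.
move=> zs zp xp hj; have [h1 h2] := zone_layer zs; have [_ zsp _] := zs.
exact: layer_unique zsp zp h1 xp h2 hj.
Qed.

Lemma level_inj s s' : s.1 = s'.1 -> level s = level s' -> s = s'.
Proof.
case: s s' => p j [p' j'] /= -> /addIr [jj']; congr (_, _); exact/val_inj.
Qed.

Lemma zone_disjoint z s s' x : zone z s x -> zone z s' x -> s = s'.
Proof.
move=> zs zs'; have [h1 h2] := zone_layer zs'; have [_ zsp _] := zs'.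
by have [E1 E2] := zone_unique zs zsp h1 h2; exact: level_inj.
Qed.

Definition flow (z : 'rV[R]_q) (t : R) (x : 'rV[R]_m) : 'rV[R]_m :=
  x + \sum_s push z s t x.

Let flowP z := glue_displacements (@push_out z) (@push_in z) (@pushK z) (@zone_disjoint z).

Lemma flow_zone z s t x : zone z s x -> flow z t x = x + push z s t x.
Proof. by have [h _ _] := flowP z; exact: h. Qed.

Lemma flow_fix z t x : (forall s, ~ zone z s x) -> flow z t x = x.
Proof. by have [_ h _] := flowP z; exact: h. Qed.

Lemma flowK z t x : flow z (- t) (flow z t x) = x.
Proof. by have [_ _ h] := flowP z; exact: h. Qed.

(** A bad image [u] lies on some pancake [s], hence within 1 of its spot. Uniqueness of layers
    leaves the twist of [s] as the only one that acted on [x], and [twist_avoids] puts [u] farther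
    than 1 from that spot. *)
Lemma flow_clears z (x : 'rV[R]_m) : x 0 l = 0 -> ~ bad theta z (flow z 1 x).
Proof.
move=> xl [p [ap zp xp [j uj]]].
set u := flow z 1 x in xp uj.
have k0 := kappa_gt0.
have zp2 : zbox 2 p z by move=> i; have := zp i; lra.
have xp18 : xbox (18 * m%:R) p u by move=> i; have := xp i; have := m0R; lra.
have uj18 : `|uphase theta p u - j%:~R| <= 18 * kappa by lra.
have [s [sp sj]] := level_exists theta01 xp uj.
have same s0 : zone z s0 u -> s0 = s.
  by move=> zs; have [E1 E2] := zone_unique zs zp2 xp18 uj18; apply: level_inj; congruence.
(* Either a twist moved [x], and it belongs to [s]; or u = x is on the hyperplane and is itself a
   crossing of [s]. *)
have ls : live s.
  have [[s0 zs0]|nz] := pselect (exists s0, zone z s0 x).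
    have : zone z s0 u by rewrite /u (flow_zone _ zs0); exact: push_in.
    by move=> zu; rewrite -(same _ zu); case: zu.
  split; first by rewrite sp.
  exists x; have ux : u = x by apply: flow_fix => s0 zs0; apply: nz; exists s0.
  by rewrite -ux; split; rewrite ?sp ?sj// ux.
have [yl yb yu] := spotP ls.
have unit : form s.1 (u - spot s) (u - spot s) <= 1.
  by apply: (pancake_unit (j := level s)) => //; rewrite ?sj ?sp.
(* The point is at distance at most 1 + 2 from the centre, and 9 < 16. *)
have zu : zone z s u.
  split=> //; first by rewrite sp.
  have S := @sqr_bl_le R m (form s.1) (e s.1) (fD s.1) (fZ s.1) (fC s.1) (f0 s.1)
    (ee s.1) (u - spot s).
  have h : `|form s.1 (u - spot s) (e s.1)| <= 1 by apply: (sqr_bound _ S); lra.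
  have -> : u - centre s = (u - spot s) + (-2) *: e s.1.
    by rewrite /centre opprD addrA scaleNr.
  move: (u - spot s) unit h => w unit h.
  have -> : form s.1 (w + -2 *: e s.1) (w + -2 *: e s.1) =
    form s.1 w w - 4 * form s.1 w (e s.1) + 4.
    rewrite /form ellD ellZ (ellC _ _ _ w) (ellC _ _ _ (e s.1)) !ellD !ellZ.
    by rewrite -/(form s.1 (e s.1) (e s.1)) ee (ellC _ _ _ (e s.1) w); ring.
  by move: h; rewrite ler_norml => /andP[? ?]; lra.
have zx : zone z s x.
  have [[s0 zs0]|nz] := pselect (exists s0, zone z s0 x).
    have : zone z s0 u by rewrite /u (flow_zone _ zs0); exact: push_in.
    by move=> /same <-.
  by have ux : u = x by [apply: flow_fix => s0 zs0; apply: nz; exists s0]; rewrite -ux.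
have := unit; rewrite /u (flow_zone _ zx) /push asboolT// cutoff1 ?sp// mulr1 -sp.
apply/negP; rewrite -ltNge.
apply: (twist_avoids (fD s.1) (fZ s.1) (fC s.1) (f0 s.1) (ee s.1) (bb s.1) (eb s.1)).
by rewrite -[LHS]/(form s.1 (x - spot s) (e s.1)) el !mxE xl yl subrr mulr0.
Qed.

(** A moved point and its image share a zone of radius 4, and 16 * 8 m <= (12 m)^2. *)
Lemma flow_move z t x i : `|P%:R * (flow z t x 0 i - x 0 i)| <= 24 * m%:R.
Proof.
have m12 (w : 'rV[R]_m) p : form p w w < 16 -> `|P%:R * w 0 i| <= 12 * m%:R.
  have m1 := m0R; move=> h; apply: (sqr_bound _ (form_coord i (ltW h))); first lra.
  rewrite exprMn expr2; have : m%:R <= m%:R ^+ 2 :> R by rewrite expr2 ler_peMl// ltW.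
  lra.
have [[s zs]|nz] := pselect (exists s, zone z s x); last first.
  rewrite flow_fix ?subrr ?mulr0 ?normr0; last by move=> s zs; apply: nz; exists s.
  by rewrite mulr_ge0// ltW.
have [_ _ h1] := zs; have [_ _ h2] := push_in t zs.
rewrite (flow_zone t zs); move: h1 h2 => /m12 h1 /m12 h2.
move: h1 h2; move: (centre s) (push z s t x) => c d; rewrite !mxE => h1 h2.
have -> : P%:R * (x 0 i + d 0 i - x 0 i) =
  P%:R * (x 0 i + d 0 i - c 0 i) - P%:R * (x 0 i - c 0 i) by ring.
by apply: le_trans (ler_normB _ _) _; lra.
Qed.

Lemma flow_support z t x : flow z t x = x \/
  exists p, [/\ act p, zbox 2 p z, xbox (18 * m%:R) p x & xbox (18 * m%:R) p (flow z t x)].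
Proof.
have [[s zs]|nz] := pselect (exists s, zone z s x); last first.
  by left; apply: flow_fix => s zs; apply: nz; exists s.
right; exists s.1; have [ls zp _] := zs; have [a _] := ls; split=> //.
  by have [] := zone_layer zs.
by rewrite (flow_zone t zs); have [] := zone_layer (push_in t zs).
Qed.

Lemma flow0 z x : flow z 0 x = x.
Proof.
have [[s zs]|nz] := pselect (exists s, zone z s x); last first.
  by apply: flow_fix => s zs; apply: nz; exists s.
rewrite (flow_zone 0 zs) /push; case: asboolP => _; last by rewrite addr0.
by rewrite mul0r twist_disp_t0 addr0.
Qed.

Lemma Coo_flow (V : normedModType R) (I : Type) (d : I -> V) (Z : V -> 'rV[R]_q)
    (T : V -> R) (X : V -> 'rV[R]_m) i :
  (forall i, Coo d (fun k => Z k 0 i)) -> Coo d T -> (forall i, Coo d (fun k => X k 0 i)) ->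
  Coo d (fun k => flow (Z k) (T k) (X k) 0 i).
Proof.
move=> cZ cT cX.
rewrite (_ : (fun k => _) = fun k => X k 0 i + \sum_s push (Z k) s (T k) (X k) 0 i); last first.
  by apply/funext => k; rewrite /flow !mxE summxE.
apply: Coo_add => //; apply: Coo_sum => s _; rewrite /push.
case: asboolP => _; last first.
  rewrite (_ : (fun k => _) = fun=> 0); first exact: Coo_cst.
  by apply/funext => k; rewrite mxE.
apply: Coo_twist_disp => //; apply: Coo_mul => //.
apply: Coo_prod => j _.
apply: (@Coo_comp _ _ _ _ (fun k => (4 - (P%:R * Z k 0 j - cz s.1 j) ^+ 2) / 3));
  last exact: Coo1_step.
apply: Coo_mul; last exact: Coo_cst.
apply: Coo_sub; first exact: Coo_cst.
apply: Coo_exp; apply: Coo_sub; last exact: Coo_cst.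
by apply: Coo_mul; first exact: Coo_cst.
Qed.

End Frames.

End Twists.

(** The hypothesis keeps the zones of active nodes inside the cube, so the flow preserves it. *)
Lemma clearing_isotopy :
  (forall p i, act p -> `|cx p i| + 18 * m%:R <= (P%:R : R)) ->
  exists (theta : node -> R) (F : 'rV[R]_q -> R -> 'rV[R]_m -> 'rV[R]_m),
    [/\ forall p, 0 <= theta p <= 1,
        isotopy_family F,
        forall z (x : 'rV[R]_m), x 0 l = 0 -> ~ bad theta z (F z 1 x),
        forall z t (x : 'rV[R]_m) i, `|P%:R * (F z t x 0 i - x 0 i)| <= 24 * m%:R &
        forall z t (x : 'rV[R]_m), F z t x = x \/
          exists p, [/\ act p, zbox 2 p z & xbox (18 * m%:R) p x]].
Proof.
move=> act_in.
have [theta [th01 thK thfar]] := good_phases.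
have cW1 i : Coo (@ev R (q + (1 + m))) (fun w : 'rV[R]_(q + (1 + m)) => lsubmx w 0 i).
  rewrite (_ : (fun w => _) = fun w : 'rV[R]_(q + (1 + m)) => w 0 (lshift _ i)).
    exact: Coo_coord.
  by apply/funext => w; rewrite mxE.
have cW2 : Coo (@ev R (q + (1 + m)))
    (fun w : 'rV[R]_(q + (1 + m)) => lsubmx (rsubmx w) 0 0).
  rewrite (_ : (fun w => _) =
      fun w : 'rV[R]_(q + (1 + m)) => w 0 (rshift q (lshift m 0))).
    exact: Coo_coord.
  by apply/funext => w; rewrite !mxE.
have cW3 i : Coo (@ev R (q + (1 + m)))
    (fun w : 'rV[R]_(q + (1 + m)) => rsubmx (rsubmx w) 0 i).
  rewrite (_ : (fun w => _) =
      fun w : 'rV[R]_(q + (1 + m)) => w 0 (rshift q (rshift 1 i))).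
    exact: Coo_coord.
  by apply/funext => w; rewrite !mxE.
have [[j0 ol]|nex] := pselect (exists j : 'I_m, j != l); last first.
  (* In dimension one the hyperplane is the origin, already off the layers by [thK]; the constant
     isotopy will do. *)
  exists theta, (fun _ _ x => x); split=> //.
  - split; first by move=> i; apply: Coo_smooth; exact: cW3.
    split=> // z t _ _; split=> //; exists id; split=> // i.
    by apply: Coo_smooth; exact: Coo_coord.
  - move=> z x xl [p [_ _ _ [j uj]]].
    have x0 : x = 0.
      apply/rowP => i; rewrite mxE; have [->//|il] := eqVneq i l.
      by case: nex; exists i.
    by have := thK p j; rewrite ltNge -x0 uj.
  - by move=> z t x i; rewrite subrr mulr0 normr0 mulr_ge0.
  - by move=> z t x; left.
have fr p := ell_frame (v p) slopeA_ge0 slopeB_gt0 ol.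
have [e fr1] := choice fr; have [b fr2] := choice fr1; have [mu fr3] := choice fr2.
have ee p : form p (e p) (e p) = 1 by case: (fr3 p).
have bb p : form p (b p) (b p) = 1 by case: (fr3 p).
have eb p : form p (e p) (b p) = 0 by case: (fr3 p).
have el p x : form p x (e p) = mu p * x 0 l by have [_ _ _] := fr3 p; apply.
exists theta, (flow theta e b).
have fcube z t x : cube x -> cube (flow theta e b z t x).
  move=> cx0; have := flow_support thfar ee bb eb z t x.
  case=> [->//|[p [ap _ _ fp]]] i; rewrite -ler_norml -(ler_pM2l P0R) mulr1.
  rewrite -{1}[P%:R]gtr0_norm// -normrM.
  have -> : P%:R * flow theta e b z t x 0 i =
     (P%:R * flow theta e b z t x 0 i - cx p i) + cx p i by ring.
  apply: le_trans (ler_normD _ _) _; have := fp i; have := act_in p i ap; lra.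
split=> //.
- split; first by move=> i; apply: Coo_smooth; exact: Coo_flow.
  split; first by move=> z x _ _; exact: flow0.
  move=> z t _ _; split; first by move=> x; exact: fcube.
  exists (flow theta e b z (- t)); split; [|split; [|split]].
  + move=> i; apply: Coo_smooth.
    apply: (@Coo_flow theta e b _ _ _ (fun=> z) (fun=> - t) (fun x => x)).
    * by move=> j; exact: Coo_cst.
    * exact: Coo_cst.
    * by move=> j; exact: Coo_coord.
  + by move=> x; exact: fcube.
  + by move=> x _; exact: flowK.
  + by move=> x _; rewrite -{1}[t]opprK; exact: flowK.
- by move=> z x; exact: flow_clears.
- by move=> z t x i; exact: flow_move.
- move=> z t x; have := flow_support thfar ee bb eb z t x.
  by case=> [->|[p [h1 h2 h3 _]]]; [left|right; exists p].
Qed.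

End Clearing.

(** * The corrugated section *)

Section Corrugation.
Variables (R : realType) (q m n r M P : nat).
Hypotheses (M0 : (0 < M)%N) (P0 : (0 < P)%N).
Notation node := (node q m P).
Variables (v : node -> 'rV[R]_m) (c : node -> 'I_n -> R) (theta : node -> R).

Definition zweight (p : node) (z : 'rV[R]_q) : R := \prod_i bumpf (P%:R * z 0 i - cz R p i).
Definition xweight (p : node) (x : 'rV[R]_m) : R := \prod_i bumpf (P%:R * x 0 i - cx R p i).

Lemma bumpf_out (s : R) : 1 < `|s| -> bumpf s = 0.
Proof. exact: (@dn_bump_eq0 R 0). Qed.

Definition inbox (p : node) (z : 'rV[R]_q) (x : 'rV[R]_m) : bool :=
  [forall i, `|P%:R * z 0 i - cz R p i| <= 1] && [forall i, `|P%:R * x 0 i - cx R p i| <= 1].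

Lemma inboxP p z x : reflect (zbox 1 p z /\ xbox 1 p x) (inbox p z x).
Proof.
by apply: (iffP andP) => -[h1 h2]; split;
  (apply/forallP: h1 || apply/forallP: h2 || (by apply/forallP)).
Qed.

Let prod_node (F : R -> R) (p : node) (z : 'rV[R]_q) (x : 'rV[R]_m) :
  (\prod_i F (P%:R * z 0 i - cz R p i)) * (\prod_i F (P%:R * x 0 i - cx R p i)) =
  \prod_i F (P%:R * (row_mx z x) 0 i + P%:R - (p i)%:R).
Proof.
rewrite big_split_ord /=; congr (_ * _); apply: eq_bigr => i _; congr F.
  by rewrite row_mxEl /cz; ring.
by rewrite row_mxEr /cx; ring.
Qed.

Let cube_row (z : 'rV[R]_q) (x : 'rV[R]_m) : cube z -> cube x -> cube (row_mx z x).
Proof.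
move=> cz0 cx0 i; rewrite -(splitK i); case: (fintype.split i) => k /=.
  by rewrite row_mxEl; exact: cz0.
by rewrite row_mxEr; exact: cx0.
Qed.

(** Distributivity turns the sum over nodes into a product over the q + m coordinates of telescoping
    sums. *)
Lemma sum_weight z x : cube z -> cube x -> \sum_p zweight p z * xweight p x = 1.
Proof.
move=> cz0 cx0; under eq_bigr do rewrite /zweight /xweight prod_node.
rewrite -(bigA_distr_bigA (fun i (k : 'I_(P.*2.+1)) =>
  bumpf (P%:R * (row_mx z x) 0 i + P%:R - k%:R))) /=.
apply: big1 => i _; apply: sum_bump; rewrite normrM ger0_norm// ler_piMr//.
by rewrite ler_norml; exact: (cube_row cz0 cx0).
Qed.

Lemma sum_inbox z x : \sum_p (inbox p z x)%:R <= (3 ^ (q + m))%:R :> R.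
Proof.
pose G (s : R) : R := if `|s| <= 1 then 1 else 0.
have -> : \sum_p (inbox p z x)%:R =
    \sum_(p : node) \prod_i G (P%:R * (row_mx z x) 0 i + P%:R - (p i)%:R).
  apply: eq_bigr => p _; rewrite -prod_node /inbox -mulnb natrM; congr (_ * _).
    have [/forallP h|] := boolP [forall i, `|P%:R * z 0 i - cz R p i| <= 1].
      by rewrite big1// => i _; rewrite /G h.
    by rewrite negb_forall => /existsP[i hi]; rewrite (bigD1 i) //= /G (negbTE hi) mul0r.
  have [/forallP h|] := boolP [forall i, `|P%:R * x 0 i - cx R p i| <= 1].
    by rewrite big1// => i _; rewrite /G h.
  by rewrite negb_forall => /existsP[i hi]; rewrite (bigD1 i) //= /G (negbTE hi) mul0r.
rewrite -(bigA_distr_bigA (fun i (k : 'I_(P.*2.+1)) =>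
  G (P%:R * (row_mx z x) 0 i + P%:R - k%:R))) /=.
rewrite natrX -[X in _ <= 3%:R ^+ X]card_ord -prodr_const; apply: ler_prod => i _.
rewrite sumr_ge0 //=; last by move=> k _; rewrite /G; case: ifP.
have -> : \sum_(k < P.*2.+1) G (P%:R * (row_mx z x) 0 i + P%:R - k%:R) =
   #|[pred k : 'I_(P.*2.+1) | `|P%:R * (row_mx z x) 0 i + P%:R - k%:R| <= 1]|%:R.
  by rewrite -sum1_card natr_sum [RHS]big_mkcond; apply: eq_bigr => k _; rewrite /G inE; case: ifP.
by rewrite ler_nat card_near.
Qed.

Lemma norm_prod_bump (I : finType) (F : I -> R) : `|\prod_i bumpf (F i)| <= 1.
Proof.
have /andP[] // : 0 <= `|\prod_i bumpf (F i)| <= 1.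
rewrite normr_prod; apply: (big_ind (fun s : R => 0 <= s <= 1)).
- by rewrite ler01 lexx.
- by move=> s t /andP[s0 s1] /andP[t0 t1]; rewrite mulr_ge0// mulr_ile1.
- by move=> i _; rewrite normr_ge0 norm_bump.
Qed.

Lemma norm_weight p z x : `|zweight p z * xweight p x| <= (inbox p z x)%:R.
Proof.
have [ib|] := boolP (inbox p z x).
  by rewrite normrM mulr_ile1// norm_prod_bump.
rewrite /inbox negb_and !negb_forall => /orP[] /existsP[i]; rewrite -ltNge => h.
  by rewrite /zweight (bigD1 i) //= bumpf_out// !mul0r normr0.
by rewrite /xweight (bigD1 i) //= bumpf_out// mul0r mulr0 normr0.
Qed.

Definition profile : R -> R := saw (kappa R q m) r (layer_range m M).

Definition ripple (p : node) : 'rV[R]_m -> R :=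
  wave0 P%:R (freq R M P) (offset M v p theta) (cx R p) (fun i => v p 0 i) (@bumpf R) profile.

(** Dividing by the r-th power of the frequency compensates r derivatives of the oscillating
    factor. *)
Definition amplitude (p : node) (j : 'I_n) (z : 'rV[R]_q) : R :=
  c p j * zweight p z / freq R M P ^+ r.

Definition corrugated (z : 'rV[R]_q) (x : 'rV[R]_m) : 'rV[R]_n :=
  \row_j \sum_p amplitude p j z * ripple p x.

(** What remains of an r-th order derivative when all r differentiations fall on the profile. *)
Definition top_symbol (z : 'rV[R]_q) (x : 'rV[R]_m) (a : mindex m) (j : 'I_n) : R :=
  \sum_p c p j * (zweight p z * xweight p x) * (\prod_i v p 0 i ^+ a i) *
    dn r profile (uphase M v theta p x).

Let cprofile : Coo1 profile.
Proof. by apply: Coo1_saw; exact: kappa_gt0. Qed.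

Lemma Coo_ripple p : Coo (@ev R m) (ripple p).
Proof. by apply: Coo_wave0; [exact: Coo1_bump|exact: cprofile]. Qed.

Lemma Coo_corrugated (V : normedModType R) (I : Type) (d : I -> V)
    (Z : V -> 'rV[R]_q) (X : V -> 'rV[R]_m) j :
  (forall i, Coo d (fun k => Z k 0 i)) -> (forall i, Coo d (fun k => X k 0 i)) ->
  Coo d (fun k => corrugated (Z k) (X k) 0 j).
Proof.
move=> cZ cX.
rewrite (_ : (fun k => _) = fun k => \sum_p amplitude p j (Z k) * ripple p (X k)); last first.
  by apply/funext => k; rewrite mxE.
have cb (f : V -> R) (t : R) : Coo d f -> Coo d (fun k => bumpf (P%:R * f k - t)).
  move=> cf; apply: (@Coo_comp _ _ _ _ (fun k => P%:R * f k - t)); last exact: Coo1_bump.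
  apply: Coo_sub; last exact: Coo_cst.
  by apply: Coo_mul; first exact: Coo_cst.
apply: Coo_sum => p _; apply: Coo_mul.
  apply: Coo_mul; last exact: Coo_cst.
  apply: Coo_mul; first exact: Coo_cst.
  by apply: Coo_prod => i _; apply: cb.
apply: Coo_mul; first by apply: Coo_prod => i _; apply: cb.
apply: (@Coo_comp _ _ _ _ (fun k => phase _ _ _ (X k))); last exact: cprofile.
apply: Coo_sub; last exact: Coo_cst.
by apply: Coo_sum => i _; apply: Coo_mul; first exact: Coo_cst.
Qed.

Variables (C Kb Ks : R).
Hypotheses (cC : forall p j, `|c p j| <= C) (Kb1 : 1 <= Kb) (Ks1 : 1 <= Ks)
  (HKb : forall k s, (k <= r)%N -> `|dn k (@bumpf R) s| <= Kb)
  (HKs : forall k s, (k <= r)%N -> `|dn k profile s| <= Ks)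
  (v1 : forall p i, `|v p 0 i| <= 1).

Lemma norm_prod_v p (a : mindex m) : `|\prod_i v p 0 i ^+ a i| <= 1.
Proof.
have /andP[] // : 0 <= `|\prod_i v p 0 i ^+ a i| <= 1.
rewrite normr_prod; apply: (big_ind (fun s : R => 0 <= s <= 1)).
- by rewrite ler01 lexx.
- by move=> s t /andP[s0 s1] /andP[t0 t1]; rewrite mulr_ge0// mulr_ile1.
- by move=> i _; rewrite normr_ge0 normrX exprn_ile1.
Qed.

(** 3^r comes from the remainder in [wave0_asymptotics], the added 1 from leading terms of order
    below [r], and 3^(q+m) from overlapping boxes. *)
Definition jet_error : R := C * (3 ^ (q + m))%:R * ((3 ^+ r + 1) * (Kb ^+ m * Ks)).

(** The leading term of order d has size N^d / N^r, N being the frequency: it is the symbol when d =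
    r and at most of size 1/N <= 1/M when d < r. *)
Lemma jet_estimate z x (a : mindex m) j : (mlen a <= r)%N ->
  `|jet corrugated z x a j - (if mlen a == r then top_symbol z x a j else 0)| <=
    jet_error / M%:R.
Proof.
move=> ar.
have N0 : 0 < freq R M P by rewrite /freq ltr0n muln_gt0 M0.
have M0R : (0 : R) < M%:R by rewrite ltr0n.
have M1R : (1 : R) <= M%:R by rewrite ler1n.
have MN : (M%:R : R) <= freq R M P by rewrite /freq ler_nat leq_pmulr.
have N1 : 1 <= freq R M P by lra.
have PMle : P%:R * M%:R <= freq R M P by rewrite /freq natrM mulrC.
have C0 : 0 <= C by exact: le_trans (normr_ge0 _) (cC [ffun=> ord0] j).
have KK1 : 1 <= Kb ^+ m * Ks.
  by rewrite -[leLHS]mulr1; apply: ler_pM => //; rewrite exprn_ege1.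
set K := Kb ^+ m * Ks in KK1 *.
have e3 : 1 <= 3 ^+ r :> R by rewrite exprn_ege1// ler1n.
have K0 : 0 <= K by lra.
have e31 : 0 <= (3 ^+ r + 1) * K by rewrite mulr_ge0//; lra.
have B0 : 0 <= C * ((3 ^+ r + 1) * K) / M%:R.
  by apply: divr_ge0 => //; apply: mulr_ge0.
pose d := size (mlist a); have dr : (d <= r)%N by rewrite /d size_mlist.
have ad : mlen a = d by rewrite /d size_mlist.
have -> : jet corrugated z x a j = \sum_p amplitude p j z * pdl (mlist a) (ripple p) x.
  rewrite /jet dpartE (_ : (fun y => _) = fun y => \sum_p amplitude p j z * ripple p y).
    by rewrite pdl_sum//; exact: Coo_ripple.
  by apply/funext => y; rewrite mxE.
pose main p : R := if d == r then c p j * (zweight p z * xweight p x) *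
  (\prod_i v p 0 i ^+ a i) * dn r profile (uphase M v theta p x) else 0.
have -> : (if mlen a == r then top_symbol z x a j else 0) = \sum_p main p.
  by rewrite /main ad; case: eqP => // _; rewrite big1.
rewrite -sumrB; apply: le_trans (ler_norm_sum _ _ _) _.
have term p : `|amplitude p j z * pdl (mlist a) (ripple p) x - main p| <=
    (inbox p z x)%:R * (C * ((3 ^+ r + 1) * K) / M%:R).
  have [Z|nZ] := boolP [forall i, `|P%:R * z 0 i - cz R p i| <= 1]; last first.
    have z0 : zweight p z = 0.
      move: nZ; rewrite negb_forall => /existsP[i]; rewrite -ltNge => h.
      by rewrite /zweight (bigD1 i) //= bumpf_out// !mul0r.
    rewrite /amplitude /main z0 !(mul0r, mulr0) if_same subrr normr0.
    by rewrite mulr_ge0.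
  have := @wave0_asymptotics R m P%:R (freq R M P) (offset M v p theta) (cx R p)
    (fun i => v p 0 i) (@bumpf R) profile (@Coo1_bump R) cprofile M%:R Kb Ks r (mlist a) x
    HKb (@dn_bump_eq0 R) HKs (le_trans ler01 Kb1) (le_trans ler01 Ks1) (ler0n _ _) (ltW N0)
    PMle M1R (v1 p) dr.
  rewrite -/(ripple p) -/(xweight p x) -/(uphase M v theta p x) prod_mlist -/d -/K.
  rewrite /inbox Z /=.
  set X := [forall i, _]; set V := \prod_i _ ^+ _; set U := uphase _ _ _ _ _.
  set N := freq R M P in N0 MN N1 *; set L := pdl _ _ _.
  move=> est.
  have V1 : `|V| <= 1 by exact: norm_prod_v.
  have z1 : `|zweight p z| <= 1 by exact: norm_prod_bump.
  have Nr0 : 0 < N ^+ r by rewrite exprn_gt0.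
  have Nd0 : 0 < N ^+ d by rewrite exprn_gt0.
  have e3d : 3 ^+ d <= 3 ^+ r :> R by rewrite ler_eXn2l// ltr1n.
  have amp : `|amplitude p j z| <= C / N ^+ r.
    rewrite /amplitude normrM normfV (gtr0_norm Nr0) ler_wpM2r ?invr_ge0 ?(ltW Nr0)//.
    by rewrite normrM -[leRHS]mulr1; apply: ler_pM.
  have CN0 : 0 <= C / N ^+ r by rewrite divr_ge0 ?(ltW Nr0).
  have est' : `|L - N ^+ d * V * (xweight p x * dn d profile U)| <=
      X%:R * (3 ^+ r * N ^+ d * K / M%:R).
    apply: le_trans est _; case: X; last by rewrite mulr0 mul0r mul0r.
    rewrite mul1r ler_wpM2r ?invr_ge0 ?(ltW M0R)// ler_wpM2r// ler_wpM2r//.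
    exact: ltW.
  have [E|ne] := eqVneq d r.
    have -> : main p = amplitude p j z * (N ^+ d * V * (xweight p x * dn d profile U)).
      rewrite /main E eqxx /amplitude -/N -/V -/U; field; by rewrite expf_neq0// gt_eqF.
    rewrite -mulrBr normrM; apply: le_trans (ler_pM _ _ amp est') _ => //.
    rewrite E mulrCA; apply: ler_wpM2l => //.
    have -> : C / N ^+ r * (3 ^+ r * N ^+ r * K / M%:R) = C * (3 ^+ r * K) / M%:R.
      by field; rewrite !gt_eqF.
    rewrite ler_wpM2r ?invr_ge0 ?(ltW M0R)// ler_wpM2l// ler_wpM2r//; lra.
  rewrite /main (negbTE ne) subr0 normrM.
  have xw : `|xweight p x * dn d profile U| <= X%:R * K.
    have [ib|] := boolP X.
      rewrite mul1r normrM -[leRHS]mul1r; apply: ler_pM => //; first exact: norm_prod_bump.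
      apply: le_trans (HKs _ dr) _; rewrite /K ler_peMl//; first exact: le_trans ler01 Ks1.
      by rewrite exprn_ege1.
    rewrite negb_forall => /existsP[i]; rewrite -ltNge => h.
    by rewrite /xweight (bigD1 i) //= bumpf_out// !mul0r normr0.
  have LL : `|L| <= X%:R * ((3 ^+ r + 1) * K) * N ^+ d.
    rewrite (_ : L = (L - N ^+ d * V * (xweight p x * dn d profile U)) +
        N ^+ d * V * (xweight p x * dn d profile U)); last by ring.
    apply: le_trans (ler_normD _ _) _.
    have h1 : `|N ^+ d * V * (xweight p x * dn d profile U)| <= N ^+ d * (X%:R * K).
      rewrite normrM; apply: ler_pM => //; rewrite normrM (gtr0_norm Nd0).
      by rewrite ler_piMr// ltW.
    have h2 : X%:R * (3 ^+ r * N ^+ d * K / M%:R) <= X%:R * (3 ^+ r * N ^+ d * K).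
      rewrite ler_wpM2l// ler_pdivrMr// ler_peMr//.
      by apply: mulr_ge0 => //; apply: mulr_ge0; [lra|exact: ltW].
    by move: est' h1 h2; lra.
  apply: le_trans (ler_pM _ _ amp LL) _ => //.
  have rd : N ^+ d * M%:R <= N ^+ r.
    apply: (@le_trans _ _ (N ^+ d.+1)); first by rewrite exprSr ler_wpM2l// ltW.
    by rewrite ler_weXn2l// ltn_neqAle ne.
  rewrite (_ : C / N ^+ r * (X%:R * ((3 ^+ r + 1) * K) * N ^+ d) =
     X%:R * (C * ((3 ^+ r + 1) * K)) * (N ^+ d / N ^+ r)); last by ring.
  rewrite [leRHS]mulrA; apply: ler_wpM2l.
    by apply: mulr_ge0 => //; exact: mulr_ge0.
  by rewrite ler_pdivrMr// mulrC ler_pdivlMr.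
apply: le_trans (ler_sum _ (fun p _ => term p)) _.
rewrite -mulr_suml /jet_error -/K.
rewrite (_ : C * (3 ^ (q + m))%:R * ((3 ^+ r + 1) * K) / M%:R =
  (3 ^ (q + m))%:R * (C * ((3 ^+ r + 1) * K) / M%:R)); last by ring.
apply: ler_wpM2r => //; exact: sum_inbox.
Qed.

(** Contraction with [w] pulls out the factor w . v_p, equal to w . (v_p - nv) since [w] is
    tangent. *)
Lemma top_symbol_perp z x (nv w : 'rV[R]_m) (om : R) a j : 0 <= om ->
  (forall p, inbox p z x -> forall i, `|v p 0 i - nv 0 i| <= om) ->
  \sum_i w 0 i ^+ 2 = 1 -> \sum_i w 0 i * nv 0 i = 0 ->
  `|\sum_i w 0 i * top_symbol z x (mincr a i) j| <=
    (3 ^ (q + m))%:R * (C * Ks * (m%:R * om)).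
Proof.
move=> om0 near w1 wn.
have w1i i : `|w 0 i| <= 1.
  rewrite -(@ler_pXn2r _ 2) ?nnegrE// expr1n -normrX ger0_norm ?sqr_ge0// -w1.
  by rewrite (bigD1 i) //= lerDl sumr_ge0// => k _; rewrite sqr_ge0.
pose g p := c p j * (zweight p z * xweight p x) * (\prod_i v p 0 i ^+ a i) *
    dn r profile (uphase M v theta p x).
have -> : \sum_i w 0 i * top_symbol z x (mincr a i) j =
    \sum_p g p * \sum_i w 0 i * (v p 0 i - nv 0 i).
  transitivity (\sum_i \sum_p g p * (w 0 i * v p 0 i)).
    apply: eq_bigr => i _; rewrite /top_symbol mulr_sumr; apply: eq_bigr => p _.
    by rewrite prod_mincr /g; ring.
  rewrite exchange_big /=; apply: eq_bigr => p _; rewrite -mulr_sumr; congr (_ * _).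
  by under [RHS]eq_bigr do rewrite mulrBr; rewrite sumrB wn subr0.
have C0 : 0 <= C by exact: le_trans (normr_ge0 _) (cC [ffun=> ord0] j).
have Ks0 : 0 <= Ks by exact: le_trans ler01 Ks1.
apply: le_trans (ler_norm_sum _ _ _) _.
apply: (@le_trans _ _ (\sum_p (inbox p z x)%:R * (C * Ks * (m%:R * om)))); last first.
  rewrite -mulr_suml ler_wpM2r//; last exact: sum_inbox.
  by apply: mulr_ge0; apply: mulr_ge0.
apply: ler_sum => p _.
have gp : `|g p| <= (inbox p z x)%:R * (C * Ks).
  have -> : g p = (zweight p z * xweight p x) * (c p j *
      ((\prod_i v p 0 i ^+ a i) * dn r profile (uphase M v theta p x))).
    by rewrite /g; ring.
  rewrite normrM; apply: ler_pM => //; first exact: norm_weight.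
  rewrite normrM; apply: ler_pM => //.
  rewrite normrM -[leRHS]mul1r; apply: ler_pM => //; first exact: norm_prod_v.
  exact: HKs.
rewrite normrM; have [ib|nib] := boolP (inbox p z x); last first.
  move: gp; rewrite (negbTE nib) !mul0r => g0.
  by rewrite (_ : `|g p| = 0) ?mul0r//; apply: le_anti; rewrite g0 normr_ge0.
move: gp; rewrite ib !mul1r => gp; apply: ler_pM => //.
apply: le_trans (ler_norm_sum _ _ _) _.
rewrite mulr_natl -[X in _ *+ X]card_ord -sumr_const; apply: ler_sum => i _.
by rewrite normrM -[leRHS]mul1r; apply: ler_pM => //; exact: near.
Qed.

(** Since the weights sum to 1, the difference is a weighted mean of local errors. The profile is
    controlled only where [c p j] is nonzero because only layers of active nodes are cleared. *)
Lemma top_symbol_close z x (s om : R) (a : mindex m) j : cube z -> cube x -> 0 <= om ->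
  (forall p, inbox p z x -> `|c p j * (\prod_i v p 0 i ^+ a i) - s| <= om) ->
  (forall p, inbox p z x -> c p j != 0 -> dn r profile (uphase M v theta p x) = 1) ->
  `|top_symbol z x a j - s| <= (3 ^ (q + m))%:R * om.
Proof.
move=> cz0 cx0 om0 near good.
have -> : top_symbol z x a j - s = \sum_p (zweight p z * xweight p x) *
    (c p j * (\prod_i v p 0 i ^+ a i) - s).
  under [RHS]eq_bigr do rewrite mulrBr.
  rewrite sumrB -[X in _ = _ - X]mulr_suml sum_weight// mul1r; congr (_ - _).
  apply: eq_bigr => p _; have [ib|nib] := boolP (inbox p z x); last first.
    have := norm_weight p z x; rewrite (negbTE nib) normr_le0 => /eqP ->.
    by rewrite mul0r mulr0 !mul0r.
  have [->|cn] := eqVneq (c p j) 0; first by rewrite !mul0r mulr0.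
  by rewrite good// mulr1; ring.
apply: le_trans (ler_norm_sum _ _ _) _.
apply: (@le_trans _ _ (\sum_p (inbox p z x)%:R * om)); last first.
  by rewrite -mulr_suml ler_wpM2r//; exact: sum_inbox.
apply: ler_sum => p _; rewrite normrM; have [ib|nib] := boolP (inbox p z x).
  by apply: ler_pM => //; [have := norm_weight p z x; rewrite ib|exact: near].
have := norm_weight p z x; rewrite (negbTE nib) normr_le0 => /eqP ->.
by rewrite normr0 !mul0r.
Qed.

End Corrugation.

(** * Locality of derivatives, uniform bounds for finite families *)

Section Locality.
Variables (R : realType) (m : nat).

Lemma pdl_local (I : seq 'I_m) (U : set 'rV[R]_m) f g : open U ->
  (forall x, U x -> f x = g x) -> forall x, U x -> pdl I f x = pdl I g x.
Proof.
move=> oU fg; elim: I => [//|i I IHI] x Ux /=.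
apply: near_eq_derive; near=> y; apply: IHI; near: y.
by apply: open_nbhs_nbhs.
Unshelve. all: by end_near. Qed.

Lemma smooth_continuous (N : nat) (f : 'rV[R]_N -> R) : smooth f -> continuous f.
Proof.
move=> /(_ [ffun=> 0%N]) [+ _].
suff -> : dpart [ffun=> 0%N] f = f by [].
by rewrite /dpart; elim: (enum 'I_N) => //= i s ->; rewrite ffunE.
Qed.

Lemma unif_continuous_family (N : nat) (T : finType) (f : T -> 'rV[R]_N -> R) (e : R) :
  0 < e -> (forall t x, cube x -> {for x, continuous (f t)}) ->
  exists2 d, 0 < d & forall t x y, cube x -> cube y ->
    (forall i, `|x 0 i - y 0 i| < d) -> `|f t x - f t y| < e.
Proof.
move=> e0 cf.
have H t : exists d : R, 0 < d /\ forall x y, cube x -> cube y ->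
    (forall i, `|x 0 i - y 0 i| < d) -> `|f t x - f t y| < e.
  by have [d d0 h] := unif_continuous_cube e0 (cf t); exists d.
have [d Hd] := choice H.
exists (\big[Num.min/1]_t d t).
  by apply: lt_bigmin => // t _; case: (Hd t).
move=> t x y cx0 cy0 h; have [_] := Hd t; apply=> // i.
by apply: lt_le_trans (h i) _; exact: bigmin_le_cond.
Qed.

Lemma bounded_family (N : nat) (T : finType) (f : T -> 'rV[R]_N -> R) :
  (forall t x, cube x -> {for x, continuous (f t)}) ->
  exists2 K, 0 <= K & forall t x, cube x -> `|f t x| <= K.
Proof.
move=> cf.
have H t : exists K : R, 0 <= K /\ forall x, cube x -> `|f t x| <= K.
  by have [K K0 h] := bounded_on_cube (cf t); exists K.
have [K HK] := choice H.
exists (\sum_t K t); first by apply: sumr_ge0 => t _; case: (HK t).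
move=> t x cx0; apply: le_trans (proj2 (HK t) x cx0) _.
by rewrite (bigD1 t) //= lerDl sumr_ge0// => u _; case: (HK u).
Qed.

Lemma open_cond (V : topologicalType) (g : V -> R) (b : R) :
  continuous g -> open [set x | b < g x].
Proof. by move=> cg; apply: (open_comp _ (@open_gt _ b)) => x _; exact: cg. Qed.

End Locality.

(** * Unit normals of the hyperplane fields *)

Section UnitNormal.
Variables (R : realType) (q m : nat) (nu : 'rV[R]_q -> 'rV[R]_m -> 'rV[R]_m).
Hypotheses (cnu : forall i, continuous (fun w : 'rV[R]_(q + m) => nu (lsubmx w) (rsubmx w) 0 i))
  (nu0 : forall z x, cube z -> cube x -> nu z x != 0).

Definition unit_normal (z : 'rV[R]_q) (x : 'rV[R]_m) : 'rV[R]_m :=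
  \row_i (nu z x 0 i / Num.sqrt (\sum_k nu z x 0 k ^+ 2)).

Lemma normal_gt0 z x : cube z -> cube x -> 0 < \sum_k nu z x 0 k ^+ 2.
Proof.
move=> cz0 cx0; rewrite lt_neqAle sumr_ge0 ?andbT; last by move=> k _; rewrite sqr_ge0.
apply/negP => /eqP E; move/negP: (nu0 cz0 cx0); apply; apply/eqP/rowP => i.
have h k : 0 <= nu z x 0 k ^+ 2 by rewrite sqr_ge0.
rewrite mxE; apply/eqP; rewrite -sqrf_eq0; apply/eqP.
move/esym: E; rewrite (bigD1 i) //= => /eqP.
rewrite paddr_eq0 ?sumr_ge0//; first by case/andP => /eqP.
Qed.

Lemma unit_normal1 z x : cube z -> cube x -> dot (unit_normal z x) (unit_normal z x) = 1.
Proof.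
move=> cz0 cx0; have n0 := normal_gt0 cz0 cx0.
rewrite /dot; under eq_bigr do rewrite mxE -expr2 expr_div_n (sqr_sqrtr (ltW n0)).
by rewrite -mulr_suml divff// gt_eqF.
Qed.

Lemma unit_normal_perp z x (w : 'rV[R]_m) :
  \sum_i w 0 i * nu z x 0 i = 0 -> \sum_i w 0 i * unit_normal z x 0 i = 0.
Proof.
move=> wn; under eq_bigr do rewrite mxE mulrA.
by rewrite -mulr_suml wn mul0r.
Qed.

Lemma cube_split (w : 'rV[R]_(q + m)) : cube w -> cube (lsubmx w) /\ cube (rsubmx w).
Proof. by move=> cw; split=> i; rewrite mxE; exact: cw. Qed.

Lemma cube_join (z : 'rV[R]_q) (x : 'rV[R]_m) : cube z -> cube x -> cube (row_mx z x).
Proof.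
move=> cz0 cx0 i; rewrite -(splitK i); case: (fintype.split i) => k /=.
  by rewrite row_mxEl; exact: cz0.
by rewrite row_mxEr; exact: cx0.
Qed.

Lemma unit_normal_continuous i (w : 'rV[R]_(q + m)) : cube w ->
  {for w, continuous (fun w : 'rV[R]_(q + m) => unit_normal (lsubmx w) (rsubmx w) 0 i)}.
Proof.
move=> /cube_split [c1 c2]; have n0 := normal_gt0 c1 c2.
pose nn (w : 'rV[R]_(q + m)) := \sum_k nu (lsubmx w) (rsubmx w) 0 k ^+ 2.
rewrite (_ : (fun w => _) = fun w : 'rV[R]_(q + m) =>
    nu (lsubmx w) (rsubmx w) 0 i * (Num.sqrt (nn w))^-1); last first.
  by apply/funext => u; rewrite mxE.
have cn : {for w, continuous nn}.
  (* Over the empty type of directions [Coo] is mere continuity, so its closure lemmas apply to the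
     sum of squares. *)
  pose e0 (k : void) : 'rV[R]_(q + m) := match k with end.
  suff : Coo e0 nn by move=> /(_ 0%N); exact.
  apply: Coo_sum => k _; apply: Coo_exp.
  by case=> [|n]; [exact: cnu|split=> [|[]]; exact: cnu].
have cs : {for w, continuous (fun w => Num.sqrt (nn w))}.
  by apply: (continuous_comp cn); exact: sqrt_continuous.
have cV : {for w, continuous (fun w => (Num.sqrt (nn w))^-1)}.
  by apply: cvgV cs; rewrite gt_eqF// sqrtr_gt0.
exact: (cvgM (@cnu i w) cV).
Qed.

(** Vanishing on unit tangent vectors makes each slot of the symbol parallel to [nu], hence to its
    normalisation; [rank_one] then applies. *)
Lemma perp_rank_one n r (sigma : jetfam R q m n) z x i0 j (a : mindex m) :
  cube z -> cube x -> perp_zero r sigma nu z x -> mlen a = r ->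
  sigma z x a j * unit_normal z x 0 i0 ^+ r =
    sigma z x (mrep i0 r) j * \prod_i unit_normal z x 0 i ^+ a i.
Proof.
move=> cz0 cx0 perp; apply: (@rank_one R m (fun a => sigma z x a j) (fun i => unit_normal z x 0 i)).
move=> b i k br; have [_ H] := perp b j (eq_leq br).
pose F : 'rV[R]_m := \row_i sigma z x (mincr b i) j.
have := @hyperplane_parallel R m F (nu z x) _ i k; rewrite !mxE => E.
rewrite !mulrA E// => w w1 w0; rewrite -[RHS](H w w1 w0).
by apply: eq_bigr => s _; rewrite mxE.
Qed.

End UnitNormal.

(** * Assembly *)

Section Assembly.
Variables (R : realType) (q m n r M P : nat).
Hypotheses (M0 : (0 < M)%N) (P0 : (0 < P)%N).
Variables (v : node q m P -> 'rV[R]_m) (c : node q m P -> 'I_n -> R).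
Variables (theta : node q m P -> R) (act : pred (node q m P)).

Lemma corrugated_eq0 z x : (forall p j, c p j != 0 -> ~~ inbox p z x) ->
  corrugated r M v c theta z x = 0.
Proof.
move=> out; apply/rowP => j; rewrite !mxE big1// => p _.
have [c0|cn] := eqVneq (c p j) 0; first by rewrite /amplitude c0 !mul0r.
have := norm_weight p z x; rewrite (negbTE (out p j cn)) normr_le0 mulf_eq0.
rewrite /amplitude /ripple /wave0 -/(xweight p x) => /orP[]/eqP ->.
  by rewrite mulr0 !mul0r.
by rewrite mul0r mulr0.
Qed.

Hypotheses (v1 : forall p, dot (v p) (v p) = 1) (theta01 : forall p, 0 <= theta p <= 1).

(* Only the finitely many levels indexing [pancake] can occur on a box. *)
Lemma open_not_bad (z : 'rV[R]_q) : open [set x | ~ bad M v act theta z x].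
Proof.
pose G (s : pancake q m M P) : set 'rV[R]_m := [set x : 'rV[R]_m | act s.1 -> zbox 1 s.1 z ->
  (exists i, 1 < `|P%:R * x 0 i - cx R s.1 i|) \/
  kappa R q m < `|uphase M v theta s.1 x - (level s)%:~R| ].
rewrite (_ : [set x | _] = [set x | forall s, G s x]); last first.
  apply/seteqP; split=> x /=.
    move=> nb s a1 z1; apply: contrapT => /not_orP[n1 n2]; apply: nb.
    exists s.1; split=> //.
      by move=> i; rewrite leNgt; apply/negP => hi; apply: n1; exists i.
    by exists (level s); rewrite leNgt; apply/negP.
  move=> Gx [p [ap zb xb [j uj]]].
  have [s [sp sj]] := level_exists M0 P0 v1 theta01 xb uj.
  have := Gx s; rewrite /G /= sp sj => /(_ ap zb) [[i]|]; last by rewrite ltNge uj.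
  by rewrite ltNge xb.
rewrite openE => x Gx; apply: (@filter_forall _ _ (fun s y => G s y) (nbhs x)) => s.
apply: open_nbhs_nbhs; split; last exact: Gx.
have [[a1 z1]|nas1] := pselect (act s.1 /\ zbox 1 s.1 z); last first.
  rewrite (_ : G s = setT); first exact: openT.
  by apply/seteqP; split=> // y _ a1 z1; case: nas1.
rewrite (_ : G s = (\bigcup_i [set y : 'rV[R]_m | 1 < `|P%:R * y 0 i - cx R s.1 i|]) `|`
   [set y : 'rV[R]_m | kappa R q m < `|uphase M v theta s.1 y - (level s)%:~R|]).
  apply: openU; first (apply: bigcup_open => i _); apply: open_cond => y.
    apply: (@continuous_comp _ _ _ (fun y : 'rV[R]_m => P%:R * y 0 i - cx R s.1 i)
      (fun t : R => `|t|)); last exact: norm_continuous.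
    exact: (Coo_cell P%:R (cx R s.1) i 0%N).
  apply: (@continuous_comp _ _ _ (fun y : 'rV[R]_m =>
    uphase M v theta s.1 y - (level s)%:~R) (fun t : R => `|t|)); last exact: norm_continuous.
  exact: (Coo_sub (Coo_phase _ _ _) (Coo_cst _ _) 0%N).
apply/seteqP; split=> y.
  by move=> /(_ a1 z1) [[i hi]|hu]; [left; exists i|right].
by move=> [[i _ hi]|hu] _ _; [left; exists i|right].
Qed.

Variables (nu : 'rV[R]_q -> 'rV[R]_m -> 'rV[R]_m) (sigma : jetfam R q m n) (C Ks om e : R).
Local Notation h := (corrugated r M v c theta).
Hypotheses (om0 : 0 <= om) (cC : forall p j, `|c p j| <= C) (Ks1 : 1 <= Ks)
  (HKs : forall k s, (k <= r)%N -> `|dn k (profile q m r M) s| <= Ks)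
  (c_act : forall p j, ~~ act p -> c p j = 0)
  (jet_h : forall z x a j, (mlen a <= r)%N ->
    `|jet h z x a j - (if mlen a == r then top_symbol r M v c theta z x a j else 0)| <= e)
  (v_near : forall z x p, cube z -> cube x -> inbox p z x ->
    forall i, `|v p 0 i - unit_normal nu z x 0 i| <= om)
  (sigma_near : forall z x p, cube z -> cube x -> inbox p z x ->
    forall a j, mlen a = r -> `|c p j * \prod_i v p 0 i ^+ a i - sigma z x a j| <= om).

Let v1i p i : `|v p 0 i| <= 1.
Proof. exact: coord_v. Qed.

(** Below order [r] sigma is zero and h small everywhere. At order [r], off the bad set, the phases
    of all active boxes containing the point lie where the profile has r-th derivative 1. *)
Lemma jet_close z x a j : cube z -> cube x -> perp_zero r sigma nu z x ->
  ~ bad M v act theta z x -> (mlen a <= r)%N ->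
  `|jet h z x a j - sigma z x a j| <= e + (3 ^ (q + m))%:R * om.
Proof.
move=> cz0 cx0 perp nb ar; have E := jet_h z x j ar.
move: ar; rewrite leq_eqVlt => /orP[/eqP ar|ar]; last first.
  rewrite (ltn_eqF ar) subr0 in E; have [-> _] := perp a j ar.
  by rewrite subr0 -[leLHS]addr0; apply: lerD => //; exact: mulr_ge0.
rewrite ar eqxx in E.
have -> : jet h z x a j - sigma z x a j = (jet h z x a j - top_symbol r M v c theta z x a j) +
  (top_symbol r M v c theta z x a j - sigma z x a j) by ring.
apply: le_trans (ler_normD _ _) _; apply: lerD => //.
apply: top_symbol_close => //; first by move=> p ib; exact: sigma_near.
move=> p /inboxP[zb xb] cn; apply: dn_saw_eq1; first exact: kappa_gt0.
  apply: le_trans (uphase_bound M0 P0 v1 theta01 xb) _.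
  by rewrite /layer_range -[_.+2]addn2 natrD lerD2l ler1n.
move=> i; rewrite ltNge; apply/negP => ui; apply: nb; exists p; split=> //; last by exists i.
by apply: contraNT cn => na; rewrite c_act.
Qed.

(** This holds on the bad set too: the tangential contraction is small whatever value the profile
    takes. *)
Lemma jet_perp z x a j : cube z -> cube x -> (mlen a < r)%N ->
  `|jet h z x a j| <= e /\
  forall w : 'rV[R]_m, \sum_i w 0 i ^+ 2 = 1 -> \sum_i w 0 i * nu z x 0 i = 0 ->
    `|\sum_i w 0 i * jet h z x (mincr a i) j| <=
      m%:R * e + (3 ^ (q + m))%:R * (C * Ks * (m%:R * om)).
Proof.
move=> cz0 cx0 ar; split.
  by have E := jet_h z x j (ltnW ar); rewrite (ltn_eqF ar) subr0 in E.
move=> w w1 wn; have wV := unit_normal_perp wn.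
have w1i i : `|w 0 i| <= 1.
  rewrite -(@ler_pXn2r _ 2) ?nnegrE// expr1n -normrX ger0_norm ?sqr_ge0// -w1.
  by rewrite (bigD1 i) //= lerDl sumr_ge0// => k _; rewrite sqr_ge0.
pose main i := if (mlen a).+1 == r then top_symbol r M v c theta z x (mincr a i) j else 0.
have E i : `|jet h z x (mincr a i) j - main i| <= e.
  by have := jet_h z x (a := mincr a i) j; rewrite mlen_mincr; apply.
have -> : \sum_i w 0 i * jet h z x (mincr a i) j =
    \sum_i w 0 i * (jet h z x (mincr a i) j - main i) + \sum_i w 0 i * main i.
  by rewrite -big_split /=; apply: eq_bigr => i _; ring.
apply: le_trans (ler_normD _ _) _; apply: lerD.
  apply: le_trans (ler_norm_sum _ _ _) _.
  rewrite mulr_natl -[X in _ *+ X]card_ord -sumr_const; apply: ler_sum => i _.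
  by rewrite normrM -[leRHS]mul1r; apply: ler_pM.
rewrite /main; case: eqP => _; last first.
  rewrite big1 ?normr0; last by move=> i _; rewrite mulr0.
  have C0 : 0 <= C by exact: le_trans (normr_ge0 _) (cC [ffun=> ord0] j).
  have Ks0 : 0 <= Ks by exact: le_trans ler01 Ks1.
  by apply: mulr_ge0 => //; apply: mulr_ge0; apply: mulr_ge0.
exact: (top_symbol_perp theta cC Ks1 HKs v1i a j om0 (fun p => v_near cz0 cx0 (p := p)) w1 wV).
Qed.

End Assembly.

(** * Numerical margins and collars of the boundary *)

Section Margins.
Variable R : realType.
Implicit Types a b e s t : R.

Lemma near_lt_mulrn a b : 0 < b -> \forall n \near \oo, a < b * n%:R.
Proof.
move=> b0; apply: filterS (nbhs_infty_gtr (a / b)) => n.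
by rewrite ltr_pdivrMr// mulrC.
Qed.

Lemma norm_natrB_le (i j k : nat) s :
  (i <= j + k)%N -> (j <= i + k)%N -> `|(i%:R - s) - (j%:R - s)| <= k%:R.
Proof. by rewrite -!(ler_nat R) !natrD ler_norml; lra. Qed.

Lemma norm_centred (P : nat) (i : 'I_(P.*2.+1)) : `|i%:R - P%:R| <= P%:R :> R.
Proof.
have : (i%:R : R) <= P%:R + P%:R by rewrite -natrD ler_nat addnn -ltnS.
by have : (0 : R) <= i%:R by []; rewrite ler_norml; lra.
Qed.

(** Used with [mu] = m, [e] the jet error over [M], [D] = 3^(q+m) and [B] = C Ks m; the errors from
    [M] and from the modulus [om] receive eps / 2 each. *)
Lemma error_budget (mu e D B om eps : R) : 0 <= mu -> 0 <= e -> 0 <= D -> 0 <= B -> 0 <= om ->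
  (mu + 1) * e < eps / 2 -> D * (B + 1) * om <= eps / 2 ->
  [/\ e < eps, e + D * om < eps & mu * e + D * (B * om) < eps].
Proof.
move=> mu0 e0 D0 B0 om0 h1 h2; have p1 : 0 <= mu * e by exact: mulr_ge0.
have p2 : 0 <= D * om by exact: mulr_ge0.
have p3 : 0 <= D * (B * om) by do 2 ?apply: mulr_ge0.
by split; lra.
Qed.

Lemma collar_reach (mu P eta s : R) : 36 * mu < eta * P -> 0 <= mu -> `|s| <= (1 - eta) * P ->
  `|s| + 18 * mu <= P.
Proof. lra. Qed.

(** The largest box radius is 18 mu, half of the assumed margin, so half of the collar stays
    free. *)
Lemma collar_box (mu P eta s t b : R) : 36 * mu < eta * P -> 0 < P ->
  `|t| <= (1 - eta) * P -> `|P * s - t| <= b -> b <= 18 * mu -> `|s| <= 1 - eta / 2.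
Proof.
move=> h P0 ht hs hb; rewrite -(ler_pM2l P0) -{1}(gtr0_norm P0) -normrM.
rewrite (_ : P * s = (P * s - t) + t); last by ring.
by apply: le_trans (ler_normD _ _) _; lra.
Qed.

Lemma open_collar (N : nat) b : open [set x : 'rV[R]_N | exists i, b < `|x 0 i|].
Proof.
rewrite (_ : [set x | _] = \bigcup_i [set x : 'rV[R]_N | b < `|x 0 i|]).
  apply: bigcup_open => i _; apply: open_cond => x.
  apply: (@continuous_comp _ _ _ (fun x : 'rV[R]_N => x 0 i) (fun t : R => `|t|)).
    exact: coord_continuous.
  exact: norm_continuous.
by apply/seteqP; split=> x; [move=> [i hi]; exists i|move=> [i _ hi]; exists i].
Qed.

Lemma bdry_collar_set (N : nat) b : b < 1 -> @bdry R N `<=` [set x | exists i, b < `|x 0 i|].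
Proof. by move=> b1 x [_ [i xi]]; exists i; rewrite xi. Qed.

Lemma jet_zero_local (q m n r : nat) (h : 'rV[R]_q -> 'rV[R]_m -> 'rV[R]_n) z
    (O : set 'rV[R]_m) x : open O -> O x -> (forall y, O y -> h z y = 0) -> jet_zero r (jet h) z x.
Proof.
move=> oO Ox h0 a j _; rewrite /jet dpartE.
by rewrite (@pdl_local R m _ O _ (fun=> 0) oO _ x Ox) ?pdl_cst0// => y /h0 ->; rewrite mxE.
Qed.

End Margins.

Theorem mainTheorem10 (R : realType) (k m n q r : nat)
  (hkm : (k < m)%N) (hn : (0 < n)%N) (hq : (0 < q)%N) (hr : (0 < r)%N)
  (nu : 'rV[R]_q -> 'rV[R]_m -> 'rV[R]_m)
  (sigma : jetfam R q m n) :
  (* tau_z(x) = ker nu_z(x) is a smooth family of hyperplane fields *)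
  (forall i : 'I_m, smooth2 (fun z x => nu z x 0 i)) ->
  (forall z x, cube z -> cube x -> nu z x != 0) ->
  (* sigma is a smooth family of sections *)
  (forall (a : mindex m) (j : 'I_n), smooth2 (fun z x => sigma z x a j)) ->
  (* sigma_z = 0 on an open neighbourhood of the boundary of I^m *)
  (exists U : set 'rV[R]_m, open U /\ @bdry R m `<=` U /\
     forall z x, cube z -> U x -> cube x -> jet_zero r sigma z x) ->
  (* sigma_z^perp = 0 on I^m with respect to tau_z *)
  (forall z x, cube z -> cube x -> perp_zero r sigma nu z x) ->
  (* sigma_z = 0 on I^m for z near the boundary of I^q *)
  (exists V : set 'rV[R]_q, open V /\ @bdry R q `<=` V /\
     forall z x, V z -> cube z -> cube x -> jet_zero r sigma z x) ->
  forall eps : R, 0 < eps ->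
  exists (F : 'rV[R]_q -> R -> 'rV[R]_m -> 'rV[R]_m)
         (h : 'rV[R]_q -> 'rV[R]_m -> 'rV[R]_n),
    isotopy_family F /\
    (forall j : 'I_n, smooth2 (fun z x => h z x 0 j)) /\
    (* sigma_hat_z := j^r(h_z) is C^0-close to sigma_z near F^z_1(I^k) *)
    (forall z, cube z ->
       exists W : set 'rV[R]_m, open W /\
         (F z 1 @` @subcube R m k) `<=` W /\
         forall x, W x -> cube x ->
           forall (a : mindex m) (j : 'I_n), (mlen a <= r)%N ->
             `|jet h z x a j - sigma z x a j| < eps) /\
    (* ||sigma_hat_z^perp||_{C^0} < eps on I^m w.r.t. tau_z *)
    (forall z x, cube z -> cube x -> perp_lt r (jet h) nu z x eps) /\
    (* dist_{C^0}(F^z_t, id) < eps *)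
    (forall z t x, cube z -> 0 <= t <= 1 -> cube x -> `|F z t x - x| < eps) /\
    (* F^z_t = id and sigma_hat_z = 0 near the boundary of I^m *)
    (exists U : set 'rV[R]_m, open U /\ @bdry R m `<=` U /\
       forall z t x, cube z -> 0 <= t <= 1 -> U x -> cube x ->
         F z t x = x /\ jet_zero r (jet h) z x) /\
    (* F^z_t = id and sigma_hat_z = 0 on I^m for z near the boundary of I^q *)
    (exists V : set 'rV[R]_q, open V /\ @bdry R q `<=` V /\
       forall z t x, V z -> cube z -> 0 <= t <= 1 -> cube x ->
         F z t x = x /\ jet_zero r (jet h) z x).
Proof.
move=> snu nu0 ssig [U [oU [bU hU]]] perp [Vz [oV [bV hV]]] eps eps0.
have m0 : (0 < m)%N by apply: leq_ltn_trans hkm.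
have lm : (m.-1 < m)%N by rewrite prednK.
(* As k < m, the cube I^k lies in the hyperplane where the last coordinate vanishes; clearing that
   hyperplane handles every k. *)
pose l : 'I_m := Ordinal lm.
have cnu i := smooth_continuous (snu i).
have csig a j := smooth_continuous (ssig a j).
have [ex /andP[ex0 ex1] hx] := bdry_collar oU bU.
have [ez /andP[ez0 ez1] hz] := bdry_collar oV bV.
pose eta := Num.min ex ez.
have eta0 : 0 < eta by rewrite lt_min ex0.
have etax : eta <= ex by rewrite ge_min lexx.
have etaz : eta <= ez by rewrite ge_min lexx orbT.
have sig0 z x : cube z -> cube x ->
    (exists i, 1 - eta <= `|z 0 i|) \/ (exists i, 1 - eta <= `|x 0 i|) ->
    jet_zero r sigma z x.
  move=> cz0 cx0 [] [i hi].
    by apply: hV => //; apply: hz => //; exists i; lra.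
  by apply: hU => //; apply: hx => //; exists i; lra.
have cV := unit_normal_continuous cnu nu0.
have [Ks0 Ks00 HKs0] := @bounded_family R (q + m) ('I_m * 'I_n)%type
  (fun ij w => sigma (lsubmx w) (rsubmx w) (mrep ij.1 r) ij.2)
  (fun ij w _ => csig (mrep ij.1 r) ij.2 w).
have bump0 (s : R) : s < -1 \/ 1 < s -> bumpf s = 0.
  by move=> h; apply: bump_eq0; case: h => /ltW; [left|right].
have [Kb Kb1 HKb] := dn_bounded_upto r (@Coo1_bump R) bump0.
have kap0 := kappa_gt0 R q m.
have [Ks Ks1 HKs] := dn_saw_bounded r kap0 r.
(* Coefficients will be pure r-th derivatives divided by the r-th power of a normal coordinate of
   size at least 1/m. *)
pose C := Ks0 * m%:R ^+ r.
have C0 : 0 <= C by rewrite mulr_ge0// exprn_ge0.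
pose JE := jet_error q m r C Kb Ks.
have JE0 : 0 <= JE.
  apply: mulr_ge0; first by apply: mulr_ge0.
  apply: mulr_ge0; first by rewrite addr_ge0// exprn_ge0.
  by apply: mulr_ge0; [apply: exprn_ge0; lra|lra].
pose A : R := (3 ^ (q + m))%:R * (C * Ks * m%:R + 1).
have c3 : (0 : R) < (3 ^ (q + m))%:R by rewrite ltr0n expn_gt0.
have CK0 : 0 <= C * Ks * m%:R by apply: mulr_ge0 => //; apply: mulr_ge0 => //; lra.
have A0 : 0 < A by apply: mulr_gt0 => //; lra.
(* [JE] involves neither [M] nor [P]. The m in the factor m + 1 pays for contraction with a unit
   vector. *)
have [M M0 HM] : exists2 M : nat, (0 < M)%N & (m%:R + 1) * (JE / M%:R) < eps / 2.
  have /filter_ex [M [M0 HM]] : \forall M \near \oo, (0 < M)%N /\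
      (m%:R + 1) * JE < eps / 2 * M%:R.
    by apply: filterI; [exact: nbhs_infty_gt|apply: near_lt_mulrn; rewrite divr_gt0].
  by exists M => //; rewrite mulrA ltr_pdivrMr// ltr0n.
have M0R : (0 : R) < M%:R by rewrite ltr0n.
(* The first bound makes layers of neighbouring nodes nearly parallel in phase, the second keeps the
   symbol errors below eps / 2. The first involves [M], so [M] precedes [P]. *)
pose om := Num.min (kappa R q m / (18 * m%:R ^+ 2 * M%:R)) (eps / (2 * A)).
have mM0 : (0 : R) < 18 * m%:R ^+ 2 * M%:R.
  by apply: mulr_gt0 => //; apply: mulr_gt0 => //; rewrite exprn_gt0// ltr0n.
have om0 : 0 < om by rewrite lt_min !divr_gt0// mulr_gt0.
have omk : 18 * m%:R ^+ 2 * M%:R * om <= kappa R q m.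
  by rewrite mulrC -ler_pdivlMr// ge_min lexx.
have omA : A * om <= eps / 2.
  by rewrite mulrC -ler_pdivlMr// -mulrA -invfM ge_min lexx orbT.
(* Multi-indices of length [r] have entries at most [r], so this finite type covers all that occur
   and one modulus [d] serves normals and symbols alike. *)
pose T1 := ('I_m + {ffun 'I_m -> 'I_r.+1} * 'I_n)%type.
pose aux (t : T1) (w : 'rV[R]_(q + m)) : R := match t with
  | inl i => unit_normal nu (lsubmx w) (rsubmx w) 0 i
  | inr aj => sigma (lsubmx w) (rsubmx w) [ffun i => nat_of_ord (aj.1 i)] aj.2 end.
have [d d0 Hd] := @unif_continuous_family R (q + m) T1 aux om om0
  (fun t => match t with
    | inl i => fun w cw => cV i w cw
    | inr aj => fun w _ => csig [ffun i => nat_of_ord (aj.1 i)] aj.2 w end).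
(* The demands on [P]: neighbouring nodes, and points in the unit box of a node, closer than [d];
   boxes of active nodes inside the collar; displacements 24 m / P below eps. *)
have /filter_ex [P [[HP1 HP2] [HP3 P0]]] : \forall P \near \oo,
    ((reach m)%:R + 1 < d * P%:R /\ 36 * m%:R < eta * P%:R) /\
    (24 * m%:R < eps * P%:R /\ (0 < P)%N).
  apply: filterI; apply: filterI; try exact: near_lt_mulrn; exact: nbhs_infty_gt.
have P0R : (0 : R) < P%:R by rewrite ltr0n.
pose nd := node q m P.
pose zn : nd -> 'rV[R]_q := @znode R q m P.
pose xn : nd -> 'rV[R]_m := @xnode R q m P.
have quot (s b : R) : (`|s / P%:R| <= b) = (`|s| <= b * P%:R).
  by rewrite normrM normfV (gtr0_norm P0R) ler_pdivrMr.
have czn p : cube (zn p).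
  by move=> i; rewrite -ler_norml mxE quot mul1r; exact: norm_centred.
have cxn p : cube (xn p).
  by move=> i; rewrite -ler_norml mxE quot mul1r; exact: norm_centred.
pose v (p : nd) := unit_normal nu (zn p) (xn p).
have v1 p : dot (v p) (v p) = 1 by exact: unit_normal1.
have [i0 Hi0] : exists i0 : nd -> 'I_m, forall p, 1 <= m%:R * `|v p 0 (i0 p)|.
  have H p := unit_coord (v1 p).
  by have [f Hf] := choice H; exists f.
have vi0 p : 0 < `|v p 0 (i0 p)|.
  by have := Hi0 p; rewrite normr_gt0; apply: contraTneq => ->; rewrite normr0 mulr0 ler10.
have vi0n p : v p 0 (i0 p) != 0 by rewrite -normr_gt0.
(* The multiple in [perp_rank_one] at the node, read off from the axis [i0 p] along which the normal
   is not small. *)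
pose c (p : nd) (j : 'I_n) : R := sigma (zn p) (xn p) (mrep (i0 p) r) j / v p 0 (i0 p) ^+ r.
have cE p a j : mlen a = r -> sigma (zn p) (xn p) a j = c p j * \prod_i v p 0 i ^+ a i.
  move=> ar; have := perp_rank_one (i0 p) j (czn p) (cxn p) (perp _ _ (czn p) (cxn p)) ar.
  rewrite -/(v p) => E; have vn : v p 0 (i0 p) ^+ r != 0 by rewrite expf_neq0.
  by apply: (mulIf vn); rewrite E /c; field.
have cC p j : `|c p j| <= C.
  rewrite /c normrM /C normfV normrX; apply: ler_pM => //.
    have := HKs0 (i0 p, j) (row_mx (zn p) (xn p)) (cube_join (czn p) (cxn p)).
    by rewrite row_mxKl row_mxKr.
  rewrite -exprVn; apply: lerXn2r; rewrite ?nnegrE ?invr_ge0//.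
  by rewrite -[leLHS]mul1r ler_pdivrMr.
(* Nodes within [eta] of either boundary are inactive; sigma vanishes there, and so do their
   coefficients. *)
pose act : pred nd := fun p => [forall i, `|cz R p i| <= (1 - eta) * P%:R] &&
  [forall i, `|cx R p i| <= (1 - eta) * P%:R].
have c_act p j : ~~ act p -> c p j = 0.
  rewrite negb_and !negb_forall => na.
  suff s0 : jet_zero r sigma (zn p) (xn p).
    rewrite /c s0 ?mul0r//.
    rewrite /mlen (bigD1 (i0 p)) //= ffunE eqxx big1 ?addn0// => i /negbTE ii.
    by rewrite ffunE ii.
  apply: sig0 => //; case/orP: na => /existsP[i]; rewrite -ltNge => hi; [left|right]; exists i;
    rewrite mxE -[leLHS]mulr1 normrM normfV (gtr0_norm P0R) ler_pdivlMr// mulr1; exact: ltW.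
have v_unif z x z' x' : cube z -> cube x -> cube z' -> cube x' ->
    (forall i, `|z 0 i - z' 0 i| < d) -> (forall i, `|x 0 i - x' 0 i| < d) ->
    (forall i, `|unit_normal nu z x 0 i - unit_normal nu z' x' 0 i| < om) /\
    (forall a j, mlen a = r -> `|sigma z x a j - sigma z' x' a j| < om).
  move=> cz1 cx1 cz2 cx2 dz dx.
  have dw i : `|(row_mx z x) 0 i - (row_mx z' x') 0 i| < d.
    rewrite -(splitK i); case: (fintype.split i) => e /=; first by rewrite !row_mxEl.
    by rewrite !row_mxEr.
  have H t := Hd t _ _ (cube_join cz1 cx1) (cube_join cz2 cx2) dw.
  split=> [i|a j ar]; first by have := H (inl i); rewrite /aux !row_mxKl !row_mxKr.
  have := H (inr ([ffun i => inord (a i)], j)); rewrite /aux !row_mxKl !row_mxKr /=.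
  rewrite (_ : [ffun i => _] = a) //; apply/ffunP => i; rewrite !ffunE inordK// ltnS -ar.
  by rewrite /mlen (bigD1 i) //= leq_addr.
have v_near p p' : near_node p p' -> forall i, `|v p 0 i - v p' 0 i| <= om.
  move=> /forallP np i.
  have D (e : 'I_(q + m)) : `|((p e)%:R - P%:R) / P%:R - ((p' e)%:R - P%:R) / P%:R| < d.
    rewrite -mulrBl normrM normfV (gtr0_norm P0R) ltr_pdivrMr//.
    apply: le_lt_trans HP1; rewrite -[leLHS]addr0; apply: lerD => //.
    by have /andP[] := np e; exact: norm_natrB_le.
  have [||h _] := v_unif (zn p) (xn p) (zn p') (xn p') (czn p) (cxn p) (czn p') (cxn p').
  - by move=> e; rewrite !mxE; exact: D.
  - by move=> e; rewrite !mxE; exact: D.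
  - exact: ltW.
have act_x p i : act p -> `|cx R p i| <= (1 - eta) * P%:R by move=> /andP[_ /forallP].
have act_z p i : act p -> `|cz R p i| <= (1 - eta) * P%:R by move=> /andP[/forallP].
have act_in p i : act p -> `|cx R p i| + 18 * m%:R <= P%:R.
  by move=> /act_x/(collar_reach HP2); apply.
have [theta [F [th01 isoF clearF moveF suppF]]] :=
  clearing_isotopy M0 P0 v1 l v_near omk act_in.
have HS k' s : (k' <= r)%N -> `|dn k' (profile q m r M) s| <= Ks by exact: HKs.
have v1i p i : `|v p 0 i| <= 1 by exact: coord_v.
pose h := corrugated r M v c theta.
have jet_h z x a j : (mlen a <= r)%N ->
    `|jet h z x a j - (if mlen a == r then top_symbol r M v c theta z x a j else 0)| <= JE / M%:R.
  by move=> ar; exact: jet_estimate.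
have near_box z x p : cube z -> cube x -> inbox p z x ->
    (forall i, `|v p 0 i - unit_normal nu z x 0 i| < om) /\
    (forall a j, mlen a = r -> `|sigma (zn p) (xn p) a j - sigma z x a j| < om).
  move=> cz0 cx0 /inboxP [zb xb].
  have dP : 1 / P%:R < d by rewrite ltr_pdivrMr//; apply: le_lt_trans HP1; rewrite lerDr.
  have B (s t : R) : `|P%:R * s - t| <= 1 -> `|t / P%:R - s| < d.
    move=> hs; apply: le_lt_trans dP; rewrite ler_pdivlMr//.
    rewrite -{2}(gtr0_norm P0R) -normrM -normrN.
    by rewrite (_ : - ((t / P%:R - s) * P%:R) = P%:R * s - t)//; field; rewrite gt_eqF.
  apply: v_unif => // i; rewrite mxE; exact: B.
have near_v z x p : cube z -> cube x -> inbox p z x ->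
    forall i, `|v p 0 i - unit_normal nu z x 0 i| <= om.
  by move=> cz0 cx0 ib i; apply: ltW; have [H _] := near_box z x p cz0 cx0 ib; exact: H.
have near_sigma z x p : cube z -> cube x -> inbox p z x ->
    forall a j, mlen a = r -> `|c p j * \prod_i v p 0 i ^+ a i - sigma z x a j| <= om.
  move=> cz0 cx0 ib a j ar; rewrite -cE//; apply: ltW.
  by have [_ H] := near_box z x p cz0 cx0 ib; exact: H.
have [small1 small2 small3] := error_budget (ler0n R m) (divr_ge0 JE0 (ler0n R M)) (ltW c3)
  CK0 (ltW om0) HM omA.
have box_x p x i b : act p -> xbox b p x -> b <= 18 * m%:R -> `|x 0 i| <= 1 - eta / 2.
  by move=> ap xb; exact: collar_box HP2 P0R (act_x p i ap) (xb i).
have box_z p z i b : act p -> zbox b p z -> b <= 18 * m%:R -> `|z 0 i| <= 1 - eta / 2.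
  by move=> ap zb; exact: collar_box HP2 P0R (act_z p i ap) (zb i).
have two_m : 2 <= 18 * m%:R :> R by rewrite -natrM ler_nat (@leq_trans 18)// leq_pmulr.
have one_m : 1 <= 18 * m%:R :> R by apply: le_trans two_m; rewrite ler1n.
have eta1 : 1 - eta / 2 < 1 by rewrite ltrBlDr ltrDl divr_gt0.
exists F, h; split; first exact: isoF.
split.
  move=> j; apply: Coo_smooth; apply: Coo_corrugated => i.
    rewrite (_ : (fun _ => _) = fun w : 'rV[R]_(q + m) => w 0 (lshift m i)).
      exact: Coo_coord.
    by apply/funext => w; rewrite mxE.
  rewrite (_ : (fun _ => _) = fun w : 'rV[R]_(q + m) => w 0 (rshift q i)).
    exact: Coo_coord.
  by apply/funext => w; rewrite mxE.
split.
  (* The complement of the bad set serves as the neighbourhood; [clearF] places the image of I^k in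
     it. *)
  move=> z cz0; exists [set x | ~ bad M v act theta z x]; split; first exact: open_not_bad.
  split.
    by move=> _ [x [cx0 xk] <-]; apply: clearF; apply: xk; rewrite /= -ltnS prednK.
  move=> x nb cx0 a j ar; apply: le_lt_trans small2.
  exact: (jet_close M0 P0 v1 th01 (ltW om0) c_act jet_h near_sigma j cz0 cx0
    (perp z x cz0 cx0) nb ar).
split.
  move=> z x cz0 cx0 a j ar.
  have [h1 h2] := jet_perp v1 (ltW om0) cC Ks1 HS jet_h near_v j cz0 cx0 ar.
  split; first exact: le_lt_trans small1.
  move=> w w1 wn; apply: le_lt_trans (h2 w w1 wn) _.
  by rewrite (_ : C * Ks * (m%:R * om) = C * Ks * m%:R * om)//; ring.
split.
  move=> z t x cz0 t01 cx0; apply: norm_rV_lt => // i; rewrite !mxE.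
  rewrite -(ltr_pM2l P0R) -{1}(gtr0_norm P0R) -normrM [ltRHS]mulrC.
  exact: le_lt_trans (moveF z t x i) HP3.
split.
  (* Boxes and zones of active nodes stop at 1 - eta / 2, so neither ripple nor twist reaches this
     collar. *)
  pose O : set 'rV[R]_m := [set x | exists i, 1 - eta / 2 < `|x 0 i|].
  have oO : open O by exact: open_collar.
  exists O; split=> //.
  split; first exact: bdry_collar_set.
  move=> z t x cz0 t01 Ox cx0; split.
    case: (suppF z t x) => // -[p [ap _ xb]]; case: Ox => i.
    by rewrite ltNge (box_x p _ _ _ ap xb).
  apply: (jet_zero_local oO Ox) => y [i yi]; apply: corrugated_eq0 => p j cn.
  apply/negP => /inboxP[_ xb].
  have ap : act p by apply: contraNT cn => na; rewrite c_act.
  by have := le_lt_trans (box_x p y i 1 ap xb one_m) yi; rewrite ltxx.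
exists [set z | exists i, 1 - eta / 2 < `|z 0 i|]; split; first exact: open_collar.
split; first exact: bdry_collar_set.
move=> z t x [i zi] cz0 t01 cx0; split.
  case: (suppF z t x) => // -[p [ap zb _]].
  by move: zi; rewrite ltNge (box_z p _ _ _ ap zb).
apply: (jet_zero_local openT) => // y _; apply: corrugated_eq0 => p j cn.
apply/negP => /inboxP[zb _].
have ap : act p by apply: contraNT cn => na; rewrite c_act.
by have := le_lt_trans (box_z p z i 1 ap zb one_m) zi; rewrite ltxx.
Qed.
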